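(* Let $1<q<\infty$. Let $p\in(1,\infty)$ and $\omega\in A_p$, put $\omega'=\omega^{-1/(p-1)}$ and $\beta_\omega:=1-(1-\alpha_0)^p/[\omega]_{A_p}$, where $\alpha_0$ is the reverse doubling constant of $X$. Let $1<p<t<\min\{r,\ \log_2(\beta_\omega^{-1})\,r/n\}<\infty$, or let $1<p\le t<r=\infty$. Then the dual of $\mathcal H_{p',\omega'}^{t',r'}(\ell^{q'})$ is $M_{p,\omega}^{t,r}(\ell^q)$ in the following sense: (i) for any $\vec g=\{g_j\}_{j\in\mathbb Z}\in M_{p,\omega}^{t,r}(\ell^q)$, the linear functional $J_{\vec g}$ defined by $$J_{\vec g}(\vec f):=\int_X\sum_{j\in\mathbb Z}f_j(x)g_j(x)\,d\mu(x),\qquad \vec f=\{f_j\}_{j\in\mathbb Z}\in\mathcal H_{p',\omega'}^{t',r'}(\ell^{q'}),$$ is bounded on $\mathcal H_{p',\omega'}^{t',r'}(\ell^{q'})$; (ii) for any $J\in(\mathcal H_{p',\omega'}^{t',r'}(\ell^{q'}))^\ast$ there exists a unique $\vec g\in M_{p,\omega}^{t,r}(\ell^q)$ such that $J=J_{\vec g}$ in $(\mathcal H_{p',\omega'}^{t',r'}(\ell^{q'}))^\ast$; moreover, $\|\vec g\|_{M_{p,\omega}^{t,r}(\ell^q)}=\|J\|_{(\mathcal H_{p',\omega'}^{t',r'}(\ell^{q'}))^\ast}$.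
   Context: Setting: $(X,\rho,\mu)$ is a space of homogeneous type with quasidistance $\rho$ and nonnegative Borel measure $\mu$, $\mu(X)=\infty$. $B(x,r)=\{y:\rho(x,y)<r\}$, $V(x,r)=\mu(B(x,r))$. Doubling: $V(x,2r)\le CV(x,r)$ for all $x\in X$, $r>0$; $n>0$ is a fixed constant such that $V(x,\lambda r)\le C\lambda^nV(x,r)$ for all $\lambda\ge1$, $x\in X$, $r>0$. Dyadic cubes: fix a Christ dyadic system $\mathcal D=\{Q_\tau^k:k\in\mathbb Z,\tau\in I_k\}$ of open subsets of $X$ such that: $\mu(X\setminus\bigcup_{\tau\in I_k}Q_\tau^k)=0$ for all $k$; if $i\ge k$ then either $Q_\tau^i\subset Q_\beta^k$ or $Q_\tau^i\cap Q_\beta^k=\emptyset$; for each $(k,\tau)$ and $i<k$ there is a unique $\tau'$ with $Q_\tau^k\subset Q_{\tau'}^i$; $\operatorname{diam}Q_\tau^k\le\kappa_0\gamma^k$; each $Q_\tau^k$ contains a ball $B(x_{Q_\tau^k},a_0\gamma^k)$. Here $\kappa_0\in(0,\infty)$ and $\gamma=a_0=1/2$ (normalized). The parent of $Q_\tau^k$ is the cube $Q_{\tau'}^{k-1}$ containing it. Reverse doubling: there is $\alpha_0\in(0,1)$ (the reverse doubling constant) with $\mu(Q)\le\alpha_0\mu(R)$ whenever $Q$ is a dyadic cube and $R$ is its parent. Weights: a weight is a locally integrable function on $X$ with values in $(0,\infty)$ a.e.; $\omega(E)=\int_E\omega\,d\mu$. For $1<p<\infty$, $\omega\in A_p$ iff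 $[\omega]_{A_p}:=\sup_B\big(\frac1{\mu(B)}\int_B\omega\,d\mu\big)\big(\frac1{\mu(B)}\int_B\omega^{-1/(p-1)}d\mu\big)^{p-1}<\infty$, supremum over all balls $B$. Primes on exponents denote conjugates ($1/p+1/p'=1$), while $\omega'=\omega^{-1/(p-1)}$. Bourgain-Morrey space: $\|f\|_{M_{p,\omega}^{t,r}}:=\Big\|\big\{\omega(Q_\tau^k)^{1/t-1/p}\big(\int_{Q_\tau^k}|f|^p\omega\,d\mu\big)^{1/p}\big\}_{k\in\mathbb Z,\tau\in I_k}\Big\|_{\ell^r}$; $M_{p,\omega}^{t,r}$ is the space of $f\in L^p_{\rm loc}(\omega)$ with finite norm. $M_{p,\omega}^{t,r}(\ell^q)$ is the space of sequences $\vec g=\{g_j\}_{j\in\mathbb Z}$ of measurable functions with $\|\vec g\|_{M_{p,\omega}^{t,r}(\ell^q)}:=\big\|\,\|\{g_j\}_j\|_{\ell^q}\big\|_{M_{p,\omega}^{t,r}}<\infty$. Block space: a sequence-valued function $\vec b=\{b^j\}_{j\in\mathbb Z}$ is a $(p',t',\omega',\ell^{q'})$-block supported in a dyadic cube $Q$ if $\operatorname{supp}\vec b\subset Q$ and $\big(\int_Q\|\vec b(x)\|_{\ell^{q'}}^{p'}\omega(x)^{-1/(p-1)}d\mu(x)\big)^{1/p'}\le\omega(Q)^{1/t-1/p}$. The space $\mathcal H_{p',\omega'}^{t',r'}(\ell^{q'})$ is the set of all measurable sequence-valued $\vec f$ on $X$ that can be written $\vec f=\sum_{k\in\mathbb Z}\sum_{\tau\in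 I_k}\lambda_{k,\tau}\vec b_{k,\tau}$ $\mu$-a.e., with $\{\lambda_{k,\tau}\}\in\ell^{r'}$ and each $\vec b_{k,\tau}$ a $(p',t',\omega',\ell^{q'})$-block supported in $Q_\tau^k$; its norm is the infimum of $\|\{\lambda_{k,\tau}\}\|_{\ell^{r'}}$ over all such decompositions. The dual $Y^\ast$ of $Y$ is the space of continuous linear functionals $T$ on $Y$ with $\|T\|_{Y^\ast}=\sup_{\|f\|_Y\le1}|T(f)|$. *)

(* Defs.v *)
From HB Require Import structures.
From mathcomp Require Import all_boot all_order all_algebra.
From mathcomp Require Import all_classical all_reals all_analysis.
Set Implicit Arguments.
Unset Strict Implicit.
Unset Printing Implicit Defensive.
Import Order.TTheory GRing.Theory Num.Theory.
Import numFieldNormedType.Exports.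
Local Open Scope classical_set_scope.
Local Open Scope ring_scope.

(* The quasidistance is an explicit function rho and not the canonical
   (pseudo)metric of a type: rho-balls need not be open. *)
Record quasidistance (R : realType) (X : Type) (rho : X -> X -> R) : Prop := {
  quasidistance_ge0 : forall x y, 0 <= rho x y ;
  quasidistance_eq0 : forall x y, rho x y = 0 <-> x = y ;
  quasidistance_sym : forall x y, rho x y = rho y x ;
  quasidistance_triangle : exists2 A0 : R, 1 <= A0 &
    forall x y z, rho x y <= A0 * (rho x z + rho z y) }.

Definition qball (R : realType) (X : Type) (rho : X -> X -> R) (x : X) (r : R)
  : set X := [set y | rho x y < r].

Definition qopen (R : realType) (X : Type) (rho : X -> X -> R) (U : set X) :=
  forall x, U x -> exists2 r : R, 0 < r & qball rho x r `<=` U.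

Definition qdiam (R : realType) (X : Type) (rho : X -> X -> R) (A : set X)
  : \bar R := ereal_sup [set (rho x y)%:E | x in A & y in A].

(* The sigma-algebra contains the Borel sets of the topology qopen; since balls
   may fail to be Borel, their measurability is required separately. *)
Record homogeneous_type (R : realType) (d : measure_display)
    (X : measurableType d) (rho : X -> X -> R)
    (mu : {measure set X -> \bar R}) : Prop := {
  homogeneous_rho : quasidistance rho ;
  homogeneous_open : forall U : set X, qopen rho U -> measurable U ;
  homogeneous_ball : forall x r, measurable (qball rho x r) ;
  homogeneous_pos : forall x (r : R), 0 < r -> (0 < mu (qball rho x r))%E ;
  homogeneous_fin : forall x (r : R), 0 < r -> (mu (qball rho x r) < +oo)%E ;
  homogeneous_doubling : exists C : R, forall x (r : R), 0 < r ->
    (mu (qball rho x (2 * r)) <= C%:E * mu (qball rho x r))%E }.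

Definition doubling_exponent (R : realType) (d : measure_display)
    (X : measurableType d) (rho : X -> X -> R)
    (mu : {measure set X -> \bar R}) (n : R) :=
  0 < n /\ exists C : R, forall x (l r : R), 1 <= l -> 0 < r ->
    (mu (qball rho x (l * r)) <= (C * l `^ n)%:E * mu (qball rho x r))%E.

(* Christ's system with gamma = a_0 = 1/2. *)
Record dyadic_system (R : realType) (d : measure_display)
    (X : measurableType d) (rho : X -> X -> R)
    (mu : {measure set X -> \bar R}) (I : int -> choiceType)
    (Q : forall k : int, I k -> set X) (kappa0 : R) : Prop := {
  dyadic_kappa0 : 0 < kappa0 ;
  dyadic_open : forall k (tau : I k), qopen rho (Q k tau) ;
  dyadic_cover : forall k, mu (~` \bigcup_(tau : I k) Q k tau) = 0%E ;
  dyadic_nested : forall k i (tau : I i) (beta : I k), (k <= i)%R ->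
    Q i tau `<=` Q k beta \/ Q i tau `&` Q k beta = set0 ;
  dyadic_ancestor : forall k (tau : I k) i, (i < k)%R ->
    exists! tau' : I i, Q k tau `<=` Q i tau' ;
  dyadic_diam : forall k (tau : I k),
    (qdiam rho (Q k tau) <= (kappa0 * (2^-1) ^ k)%:E)%E ;
  dyadic_ball : forall k (tau : I k),
    exists x, qball rho x (2^-1 * (2^-1) ^ k) `<=` Q k tau }.

Definition reverse_doubling (R : realType) (d : measure_display)
    (X : measurableType d) (mu : {measure set X -> \bar R})
    (I : int -> choiceType) (Q : forall k : int, I k -> set X) (alpha0 : R) :=
  0 < alpha0 < 1 /\
  forall k (tau : I k) (tau' : I (k - 1)), Q k tau `<=` Q (k - 1) tau' ->
    (mu (Q k tau) <= alpha0%:E * mu (Q (k - 1)%R tau'))%E.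

Section weights.
Context (R : realType) (d : measure_display) (X : measurableType d).
Variables (rho : X -> X -> R) (mu : {measure set X -> \bar R}).

Definition weight (w : X -> R) :=
  [/\ measurable_fun setT w,
      forall x (r : R), 0 < r -> mu.-integrable (qball rho x r) (EFin \o w)
    & {ae mu, forall x, 0 < w x}].

Definition wmeasure (w : X -> R) (E : set X) : \bar R :=
  (\int[mu]_(x in E) (w x)%:E)%E.

Definition average (B : set X) (f : X -> R) : \bar R :=
  ((fine (mu B))^-1%:E * \int[mu]_(x in B) (f x)%:E)%E.

Definition dual_weight (p : R) (w : X -> R) : X -> R :=
  fun x => w x `^ (- (p - 1)^-1).

Definition Ap_constant (p : R) (w : X -> R) : \bar R :=
  ereal_sup [set c | exists x (r : R), 0 < r /\
    c = (average (qball rho x r) w *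
         average (qball rho x r) (dual_weight p w) `^ (p - 1))%E].

Definition Ap (p : R) (w : X -> R) := weight w /\ (Ap_constant p w < +oo)%E.

Definition beta_weight (alpha0 p : R) (w : X -> R) : R :=
  1 - (1 - alpha0) `^ p / fine (Ap_constant p w).

End weights.

(* The value at -oo is junk. *)
Definition lnorm (R : realType) (T : choiceType) (s : \bar R) (a : T -> \bar R)
  : \bar R :=
  match s with
  | s0%:E => (\esum_(i in setT) (`|a i| `^ s0)) `^ s0^-1
  | +oo => ereal_sup (range (abse \o a))
  | -oo => 0
  end%E.

(* Unordered sum; meaningful when a is absolutely summable, which is always
   required alongside. *)
Definition usummable (R : realType) (T : choiceType) (a : T -> R) :=
  summable setT (EFin \o a).

Definition usum (R : realType) (T : choiceType) (a : T -> R) : R :=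
  fine (\esum_(i in setT) ((EFin \o a)^\+)%E i -
        \esum_(i in setT) ((EFin \o a)^\-)%E i)%E.

Definition lseq (R : realType) (X : Type) (q : R) (f : int -> X -> R)
  : X -> \bar R := fun x => lnorm q%:E (fun j => (f j x)%:E).

Section spaces.
Context (R : realType) (d : measure_display) (X : measurableType d).
Variables (mu : {measure set X -> \bar R}).
Variables (I : int -> choiceType) (Q : forall k : int, I k -> set X).
Variable (w : X -> R).

Definition cube (kt : {k : int & I k}) : set X := Q (tagged kt).

Definition morrey_norm (p t : R) (r : \bar R) (f : X -> \bar R) : \bar R :=
  lnorm r (fun kt : {k : int & I k} =>
    wmeasure mu w (cube kt) `^ (t^-1 - p^-1) *
    (\int[mu]_(x in cube kt) (`|f x| `^ p * (w x)%:E)) `^ p^-1)%E.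

Definition morrey_seq_norm (p t : R) (r : \bar R) (q : R) (g : int -> X -> R)
  : \bar R := morrey_norm p t r (lseq q g).

Definition morrey_seq (p t : R) (r : \bar R) (q : R) : set (int -> X -> R) :=
  [set g | (forall j, measurable_fun setT (g j)) /\
           (morrey_seq_norm p t r q g < +oo)%E].

(* A (p', t', w', l^q')-block, where p' and q' are the exponents dual to p
   and q; t' enters only through 1/t - 1/p = 1/p' - 1/t'. *)
Definition block (p p' t q' : R) (E : set X) (b : int -> X -> R) :=
  [/\ forall j, measurable_fun setT (b j),
      forall j x, ~ E x -> b j x = 0
    & ((\int[mu]_(x in E) (lseq q' b x `^ p' * (dual_weight p w x)%:E)) `^ p'^-1
       <= wmeasure mu w E `^ (t^-1 - p^-1))%E].

(* f = sum over all cubes of lambda * b almost everywhere, for a coefficient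
   family lambda in l^r'. *)
Definition block_decomposition (p p' t : R) (r' : \bar R) (q' : R)
    (f : int -> X -> R) (lambda : {k : int & I k} -> R) :=
  (lnorm r' (EFin \o lambda) < +oo)%E /\
  exists b : {k : int & I k} -> int -> X -> R,
    (forall kt, block p p' t q' (cube kt) (b kt)) /\
    {ae mu, forall x, forall j,
      usummable (fun kt => lambda kt * b kt j x) /\
      f j x = usum (fun kt => lambda kt * b kt j x)}.

Definition block_space (p p' t : R) (r' : \bar R) (q' : R)
  : set (int -> X -> R) :=
  [set f | (forall j, measurable_fun setT (f j)) /\
           exists lambda, block_decomposition p p' t r' q' f lambda].

Definition block_norm (p p' t : R) (r' : \bar R) (q' : R) (f : int -> X -> R)
  : \bar R :=
  ereal_inf [set lnorm r' (EFin \o lambda) |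
             lambda in block_decomposition p p' t r' q' f].

Definition pairing (g f : int -> X -> R) (x : X) : R :=
  usum (fun j => f j x * g j x).

Definition Jfun (g f : int -> X -> R) : R := \int[mu]_x pairing g f x.

(* The integral defining Jfun g f converges absolutely. *)
Definition Jfun_defined (g f : int -> X -> R) :=
  {ae mu, forall x, usummable (fun j => f j x * g j x)} /\
  mu.-integrable setT (EFin \o pairing g f).

End spaces.

(* Functionals on a subspace H of V carrying a (semi)norm N; elements of V are
   functions, not classes modulo almost-everywhere equality. *)
Section functionals.
Context (R : realType) (V : lmodType R).
Variables (H : set V) (N : V -> \bar R).

Definition linear_on (J : V -> R) :=
  forall (a : R) f h, H f -> H h -> J (a *: f + h) = a * J f + J h.

Definition bounded_on (J : V -> R) :=
  exists C : R, forall f, H f -> (`|J f|%:E <= C%:E * N f)%E.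

Definition continuous_on (J : V -> R) :=
  forall f, H f -> forall e : R, 0 < e -> exists2 delta : R, 0 < delta &
    forall h, H h -> (N (h - f) < delta%:E)%E -> `|J h - J f| < e.

Definition dual (J : V -> R) := linear_on J /\ continuous_on J.

Definition dual_norm (J : V -> R) : \bar R :=
  ereal_sup [set `|J f|%:E | f in H `&` [set f | (N f <= 1)%E]].

End functionals.

(* Main.v *)
(* The Morrey entry of a cube is dual to the size condition on a block, so
   Hoelder in l^q, in L^p on the cube and in l^r over the cubes gives
   |J_g f| <= |g| |f|.

   Conversely, let J be a continuous functional. The block space is stable
   under multipliers bounded by 1, and by dominated convergence in each of the
   three layers (coordinates, points, cubes) multipliers that tend to 0 almost
   everywhere send a fixed f to 0 in norm; for the cubes this uses that r' is
   finite. Fix f0 in the block space with all coordinates positive. Then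
   A |-> J(1_A f0 e_j) is a finite charge, absolutely continuous with respect
   to mu, and dividing its Radon-Nikodym density by f0_j gives g_j. Thus
   J = J_g on the f with finitely many nonzero coordinates and |f| <= C f0.
   Testing J on truncated extremal functions of this kind and letting the
   truncations go bounds the Morrey norm of g by that of J, and truncating an
   arbitrary f extends J = J_g to the whole block space. *)

Require Import Defs.
From HB Require Import structures.
From mathcomp Require Import all_boot all_order all_algebra.
From mathcomp Require Import all_classical all_reals all_analysis.
From mathcomp Require Import measurable_realfun.
From mathcomp Require Import ring lra.
Set Implicit Arguments.
Unset Strict Implicit.
Unset Printing Implicit Defensive.
Import Order.TTheory GRing.Theory Num.Theory.
Import numFieldNormedType.Exports.
Local Open Scope classical_set_scope.
Local Open Scope ring_scope.

(** * Unordered sums *)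

(** A positive [f0] on the whole of X puts [1_A f0 e_j] in the block space for every measurable A,
    so one charge per coordinate suffices and no densities found on single cubes have to be glued.
    What it does not give is any control of g beyond the integrability of each [g_j f0_j]: the
    Morrey norm of g may still be infinite, and its extremal sequences may lie outside the block
    space. Hence a test sequence is truncated three times: to finitely many coordinates, to a level
    set where it is at most [m f0], and to finitely many cubes. Every bound obtained is the norm of
    J itself, and the truncations are removed through increasing suprema, which need no finiteness.
    Up to a constant factor the extremal sequence is the same on every cube, namely
    [g_j |g_j|^(q-2) G^(p-q) w] with G the l^q norm of g. A finite combination of extremal blocks is
    therefore a bounded function times one sequence, and its pairing with g is the sum over the
    cubes of coefficient times Morrey entry, even though the cubes overlap. *)

Section esum_lemmas.
Local Open Scope ereal_scope.
Context (R : realType).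

Lemma fsume_seq (T : choiceType) (A : set T) (a : T -> \bar R) :
  finite_set A -> exists l : seq T, [/\ uniq l, [set` l] = A &
    \sum_(i \in A) a i = \sum_(i <- l) a i].
Proof.
move=> /finite_seqP[s sA]; exists (undup s).
have e : [set` undup s] = A.
  by rewrite sA; apply/seteqP; split => x /=; rewrite mem_undup.
by split; rewrite ?undup_uniq// -e -fsbig_seq ?undup_uniq.
Qed.

Lemma sum_le_esum (T : choiceType) (l : seq T) (a : T -> \bar R) :
  uniq l -> (forall i, 0 <= a i) -> \sum_(i <- l) a i <= \esum_(i in setT) a i.
Proof.
move=> ul a0; apply: esum_ge; exists [set` l]; first by split.
by rewrite -fsbig_seq.
Qed.

Lemma esum_leP (T : choiceType) (a : T -> \bar R) (B : \bar R) :
  (forall l : seq T, uniq l -> \sum_(i <- l) a i <= B) ->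
  \esum_(i in setT) a i <= B.
Proof.
move=> h; apply: ge_ereal_sup => _ [A [fA _]] <-.
by have [l [ul _ ->]] := fsume_seq a fA; exact: h.
Qed.

Lemma esumZ_le (T : choiceType) (c : R) (a : T -> \bar R) : (0 <= c)%R ->
  (forall i, 0 <= a i) ->
  \esum_(i in setT) (c%:E * a i) <= c%:E * \esum_(i in setT) a i.
Proof.
move=> c0 a0; apply: esum_leP => l ul.
rewrite -ge0_sume_distrr//; apply: lee_wpmul2l; first by rewrite lee_fin.
exact: sum_le_esum.
Qed.

Lemma esumZ (T : choiceType) (c : R) (a : T -> \bar R) : (0 <= c)%R ->
  (forall i, 0 <= a i) ->
  \esum_(i in setT) (c%:E * a i) = c%:E * \esum_(i in setT) a i.
Proof.
rewrite le_eqVlt => /predU1P[<- a0|c0 a0].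
  by rewrite mul0e esum1// => i _; rewrite mul0e.
apply/eqP; rewrite eq_le esumZ_le ?(ltW c0)//=.
rewrite -lee_pdivlMl//.
apply: le_trans (esumZ_le _ _); last 2 first.
- by rewrite invr_ge0 ltW.
- by move=> i; rewrite mule_ge0// lee_fin ltW.
by apply: le_esum => i _; rewrite muleA -EFinM mulVf ?gt_eqF// mul1e.
Qed.

Lemma esum_finsupp (T : choiceType) (l : seq T) (a : T -> \bar R) :
  uniq l -> (forall i, 0 <= a i) -> (forall i, i \notin l -> a i = 0) ->
  \esum_(i in setT) a i = \sum_(i <- l) a i.
Proof.
move=> ul a0 al; apply/eqP; rewrite eq_le sum_le_esum// andbT.
apply: esum_leP => l' ul'.
rewrite (bigID (fun i => i \in l))/= [X in _ + X]big1 ?adde0; last by move=> i;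
  exact: al.
rewrite -big_filter; set l1 := [seq i <- l' | i \in l].
have l1l : {subset l1 <= l} by move=> i; rewrite mem_filter => /andP[].
have -> : \sum_(i <- l1) a i = \sum_(i <- l | i \in l1) a i.
  rewrite -[RHS]big_filter; apply: perm_big; apply: uniq_perm.
  - exact: filter_uniq.
  - exact: filter_uniq.
  by move=> i; rewrite [RHS]mem_filter andb_idr//; exact: l1l.
by rewrite [leRHS](bigID (fun i => i \in l1))/= leeDl// sume_ge0.
Qed.

Lemma esum_eq0P (T : choiceType) (a : T -> \bar R) :
  (forall i, 0 <= a i) -> \esum_(i in setT) a i = 0 -> forall i, a i = 0.
Proof.
move=> a0 h i; apply/eqP; rewrite eq_le a0 andbT -h.
by have := @sum_le_esum _ [:: i] a isT a0; rewrite big_seq1.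
Qed.

Lemma le1_esum (T : choiceType) (a : T -> \bar R) i :
  (forall i, 0 <= a i) -> a i <= \esum_(i in setT) a i.
Proof.
by move=> a0; have := @sum_le_esum _ [:: i] a isT a0; rewrite big_seq1.
Qed.

Lemma esum_swap (S T : choiceType) (a : S -> T -> \bar R) :
  (forall i j, 0 <= a i j) ->
  \esum_(i in setT) \esum_(j in setT) a i j =
  \esum_(j in setT) \esum_(i in setT) a i j.
Proof.
move=> a0; rewrite !esum_esum//.
rewrite (reindex_esum (setT `*`` (fun=> setT)) _ (fun x => (x.2, x.1)))//.
by split=> [[i j]//|[i1 j1] [i2 j2] _ _ [-> ->]//|[i j] _]; exists (j, i).
Qed.

(** The bridge from unordered sums to series, through which measurability and monotone convergence
    are inherited. The sets [J n] are the fibres of an injection into [nat]; since empty fibres are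
    allowed, finite and infinite index sets are treated alike. *)
Lemma countable_esum (T : choiceType) : countable [set: T] ->
  exists J : nat -> set T, (forall n, J n = set0 \/ exists i, J n = [set i]) /\
   forall a : T -> \bar R, (forall i, 0 <= a i) ->
    \esum_(i in setT) a i = \sum_(n <oo) \esum_(i in J n) a i.
Proof.
move=> /countable_injP[e einj]; exists (fun n => e @^-1` [set n]); split.
  move=> n; have [[i /= ein]|h] := pselect (exists i, e i = n).
    right; exists i; apply/seteqP; split=> [j /= ejn|j ->//].
    by apply: einj; rewrite ?inE// ejn.
  by left; apply/seteqP; split => // i /= ein; apply: h; exists i.
move=> a a0; rewrite -nneseries_sum_bigcup//.
  by congr esum; apply/seteqP; split => // i _; exists (e i).
by move=> m n _ _ [i [/= <- <-]].
Qed.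

Lemma measurable_esum d (X : measurableType d) (D : set X) (T : choiceType)
    (f : T -> X -> \bar R) : countable [set: T] ->
  (forall i x, 0 <= f i x) -> (forall i, measurable_fun D (f i)) ->
  measurable_fun D (fun x => \esum_(i in setT) f i x).
Proof.
move=> /countable_esum[J [J1 Je]] f0 mf.
under eq_fun do rewrite Je//.
apply: (@ge0_emeasurable_sum _ _ _ _ (fun n x => \esum_(i in J n) f i x)
  xpredT) => [n x _ _|n _].
  exact: esum_ge0.
have [->|[i ->]] := J1 n.
  rewrite (_ : (fun _ => _) = cst 0)//.
  by apply/funext => x; rewrite esum_set0.
rewrite (_ : (fun _ => _) = f i)//.
by apply/funext => x; rewrite esum_set1.
Qed.

Lemma integral_esum d (X : measurableType d) (mu : {measure set X -> \bar R})
    (D : set X) (T : choiceType) (f : T -> X -> \bar R) : countable [set: T] ->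
  measurable D ->
  (forall i x, 0 <= f i x) -> (forall i, measurable_fun D (f i)) ->
  \int[mu]_(x in D) (\esum_(i in setT) f i x) =
  \esum_(i in setT) \int[mu]_(x in D) f i x.
Proof.
move=> /countable_esum[J [J1 Je]] mD f0 mf.
under eq_integral do rewrite Je//.
rewrite Je; last by move=> i; exact: integral_ge0.
rewrite integral_nneseries//; first last.
- by move=> n x _; exact: esum_ge0.
- move=> n; have [->|[i ->]] := J1 n.
    rewrite (_ : (fun _ => _) = cst 0)//.
    by apply/funext => x; rewrite esum_set0.
  rewrite (_ : (fun _ => _) = f i)//.
  by apply/funext => x; rewrite esum_set1.
apply: eq_eseriesr => n _; have [->|[i ->]] := J1 n.
  by under eq_integral do rewrite esum_set0; rewrite integral0 esum_set0.
rewrite esum_set1; last exact: integral_ge0.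
by apply: eq_integral => x _; rewrite esum_set1.
Qed.

Lemma ae_forall_countable d (X : measurableType d)
    (mu : {measure set X -> \bar R}) (T : choiceType) (P : T -> X -> Prop) :
  countable [set: T] -> (forall i, {ae mu, forall x, P i x}) ->
  {ae mu, forall x, forall i, P i x}.
Proof.
move=> /countable_injP[e einj] h.
have : {ae mu, forall x, forall n, forall i, e i = n -> P i x}.
  apply: ae_foralln => n.
  have [[i ein]|H] := pselect (exists i, e i = n).
    apply: filterS (h i) => x Pix j ejn.
    by have -> : j = i by apply: einj; rewrite ?inE// ejn.
  by apply: aeW => x i ein; exfalso; apply: H; exists i.
by apply: filterS => x Px i; exact: (Px (e i)).
Qed.

(** Dominated convergence for the counting measure: a finite set [A] carries all but [e / 2] of the
    dominating sum, and on [A] a finite sum of null sequences is a null sequence. It serves both for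
    the coordinates and for the cubes. *)
Lemma esum_dominated_cvg0 (T : choiceType) (b : T -> R) (a : nat -> T -> R) :
  \esum_(i in setT) (b i)%:E < +oo ->
  (forall n i, 0 <= a n i <= b i)%R ->
  (forall i (e : R), (0 < e)%R -> \forall n \near \oo, (a n i < e)%R) ->
  forall e : R, (0 < e)%R ->
    \forall n \near \oo, \esum_(i in setT) (a n i)%:E < e%:E.
Proof.
move=> bfin ab small e e0.
have a0 i : a n i @[n --> \oo] --> (0%R : R).
  apply/cvgrPdist_lt => e1 /(small i); apply: filterS => n.
  by rewrite sub0r normrN ger0_norm//; have /andP[] := ab n i.
have b0 i : (0 <= b i)%R by have /andP[/le_trans h /h] := ab 0%N i.
have e20 : (0 < e / 2)%R by rewrite divr_gt0.
have sb : \esum_(i in setT) (b i)%:E \is a fin_num.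
  by rewrite ge0_fin_numE//; apply: esum_ge0 => i _; rewrite lee_fin.
have := @ub_ereal_sup_adherent _ [set \sum_(x \in A) (b x)%:E | A in fsets setT]
  _ e20 sb.
move=> [_ [A [fA _] <-]]; rewrite -/(esum _ _) => hA.
have tail : \esum_(i in ~` A) (b i)%:E < (e / 2)%:E.
  move: sb hA; rewrite (esumID A)//; last by move=> i _; rewrite lee_fin.
  rewrite !setTI esum_fset//; last by move=> i _; rewrite lee_fin.
  rewrite fin_numD => /andP[sA sAc].
  rewrite -(fineK sA) -(fineK sAc) -!EFinD.
  by rewrite !lte_fin; lra.
have [l [ul lA _]] := fsume_seq (fun i => (b i)%:E) fA.
have : (\sum_(i <- l) a n i)%R @[n --> \oo] --> (0%R : R).
  elim: (l) => [|i l' IH].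
    rewrite (_ : (fun _ => _) = cst 0%R); first exact: cvg_cst.
    by apply/funext => n; rewrite big_nil.
  rewrite (_ : (fun _ => _) = (fun n => a n i + \sum_(i <- l') a n i)%R).
    2: by apply/funext => n; rewrite big_cons.
  by have := cvgD (a0 i) IH; rewrite addr0; exact.
move=> /cvgrPdist_lt /(_ _ e20); apply: filterS => n.
rewrite sub0r normrN ger0_norm; last first.
  by apply: sumr_ge0 => i _; have /andP[] := ab n i.
move=> hl.
rewrite (esumID A); last by move=> i _; rewrite lee_fin; have /andP[] := ab n i.
rewrite !setTI esum_fset//; last first.
  by move=> i _; rewrite lee_fin; have /andP[] := ab n i.
rewrite (splitr e) EFinD lteD//.
  have -> : \sum_(i \in A) (a n i)%:E = (\sum_(i <- l) a n i)%:E.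
    by rewrite -lA -fsbig_seq// sumEFin.
  by rewrite lte_fin.
apply: le_lt_trans tail; apply: le_esum => i _; rewrite lee_fin.
by have /andP[] := ab n i.
Qed.

End esum_lemmas.

(** * Hoelder's inequality *)

Section hoelder_lemmas.
Local Open Scope ereal_scope.
Context (R : realType).
Implicit Types (p q : R).

Lemma powR_div (x a p : R) : (0 <= x)%R -> (0 < a)%R ->
  ((x / a) `^ p = x `^ p / a `^ p)%R.
Proof.
move=> x0 a0; rewrite powRM ?invr_ge0 ?(ltW a0)//; congr (_ * _)%R.
by rewrite -powR_inv1 ?(ltW a0)// -powRrM mulN1r powRN.
Qed.

(** Young's inequality rescaled so that it is an equality at [x = a], [y = b]. Summed or integrated
    with [a] and [b] the two norms, it is Hoelder's inequality, without normalizing the factors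
    first. *)
Lemma weighted_young p q (a b : R) : (0 < p)%R -> (0 < q)%R ->
  (p^-1 + q^-1 = 1)%R -> (0 < a)%R -> (0 < b)%R ->
  exists al be : R, [/\ (0 < al)%R, (0 < be)%R,
    (forall x y : \bar R, 0 <= x -> 0 <= y ->
       x * y <= al%:E * x `^ p + be%:E * y `^ q) &
    (al * a `^ p + be * b `^ q = a * b)%R].
Proof.
move=> p0 q0 pq a0 b0.
have ap : (0 < a `^ p)%R by rewrite powR_gt0.
have bq : (0 < b `^ q)%R by rewrite powR_gt0.
pose al := (a * b / (p * a `^ p))%R; pose be := (a * b / (q * b `^ q))%R.
have al0 : (0 < al)%R by rewrite divr_gt0 ?mulr_gt0.
have be0 : (0 < be)%R by rewrite divr_gt0 ?mulr_gt0.
exists al, be; split => //; last first.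
  rewrite /al /be -[RHS]mulr1 -pq; field.
  by rewrite !gt_eqF.
have topr (x y : \bar R) : 0 <= y -> x <= +oo + be%:E * y `^ q.
  by move=> y0; rewrite addye ?leey// gt_eqF// (lt_le_trans _
    (mule_ge0 _ (poweR_ge0 _ _)))// ?lee_fin ?(ltW be0)// ltNyr.
have topl (x y : \bar R) : 0 <= y -> x <= al%:E * y `^ p + +oo.
  by move=> y0; rewrite addey ?leey// gt_eqF// (lt_le_trans _
    (mule_ge0 _ (poweR_ge0 _ _)))// ?lee_fin ?(ltW al0)// ltNyr.
have aly : al%:E * +oo = +oo :> \bar R by rewrite gt0_muley ?lte_fin.
have bey : be%:E * +oo = +oo :> \bar R by rewrite gt0_muley ?lte_fin.
move=> [x| |] [y| |] //.
- rewrite !lee_fin => x0 y0.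
  have := @conjugate_powR _ (x / a)%R (y / b)%R p q.
  rewrite !divr_ge0 ?(ltW a0) ?(ltW b0)// => /(_ isT isT p0 q0 pq).
  rewrite !powR_div// => h; rewrite -(ler_pM2l (mulr_gt0 a0 b0)) in h.
  have -> : (x * y = a * b * (x / a * (y / b)))%R.
    by field; rewrite !gt_eqF.
  apply: (le_trans h); rewrite le_eqVlt; apply/orP; left; apply/eqP.
  by rewrite /al /be; field; rewrite !gt_eqF.
- by move=> x0 _; rewrite poweRyr ?gt_eqF// bey; exact: topl.
- by move=> _ y0; rewrite poweRyr ?gt_eqF// aly; exact: topr.
- by move=> _ _; rewrite !poweRyr ?gt_eqF// aly bey leey.
Qed.

Lemma poweRK (x : \bar R) p : (0 < p)%R -> 0 <= x -> (x `^ p^-1) `^ p = x.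
Proof. by move=> p0 x0; rewrite -poweRrM mulVf ?gt_eqF// poweRe1. Qed.

Lemma poweRVK (x : \bar R) p : (0 < p)%R -> 0 <= x -> (x `^ p) `^ p^-1 = x.
Proof. by move=> p0 x0; rewrite -poweRrM mulfV ?gt_eqF// poweRe1. Qed.

Lemma le_poweR (x y : \bar R) p : (0 <= p)%R -> 0 <= x -> x <= y ->
  x `^ p <= y `^ p.
Proof.
move=> p0 x0 xy; apply: gt0_ler_poweR => //; rewrite in_itv/= ?leey ?andbT//.
exact: le_trans xy.
Qed.

Lemma le_poweRV (x y : \bar R) p : (0 < p)%R -> 0 <= x -> 0 <= y ->
  (x `^ p^-1 <= y) = (x <= y `^ p).
Proof.
move=> p0 x0 y0; apply/idP/idP => h.
  by rewrite -[x](poweRK p0)//; apply: le_poweR; rewrite ?(ltW p0) ?poweR_ge0.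
by rewrite -[y](poweRVK p0)//; apply: le_poweR => //; rewrite invr_ge0 ltW.
Qed.

Lemma esum_hoelder (T : choiceType) (x y : T -> \bar R) p q :
  (0 < p)%R -> (0 < q)%R -> (p^-1 + q^-1 = 1)%R ->
  (forall i, 0 <= x i) -> (forall i, 0 <= y i) ->
  \esum_(i in setT) (x i * y i) <=
  (\esum_(i in setT) (x i `^ p)) `^ p^-1 *
  (\esum_(i in setT) (y i `^ q)) `^ q^-1.
Proof.
move=> p0 q0 pq x0 y0.
set A := esum _ (fun i => x i `^ p); set B := esum _ (fun i => y i `^ q).
have A0 : 0 <= A by apply: esum_ge0 => i _; exact: poweR_ge0.
have B0 : 0 <= B by apply: esum_ge0 => i _; exact: poweR_ge0.
(* [weighted_young] needs norms in the open interval from 0 to [+oo]. If one of them is 0 the left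
   side vanishes, which also settles the product of 0 and [+oo]; afterwards an infinite norm makes
   the right side infinite. *)
have [Az|An] := eqVneq A 0.
  rewrite esum1 ?mule_ge0 ?poweR_ge0// => i _.
  have := @esum_eq0P _ _ _ (fun i => poweR_ge0 (x i) p) Az i.
  by move/poweR_eq0_eq0 => ->; rewrite ?mul0e.
have [Bz|Bn] := eqVneq B 0.
  rewrite esum1 ?mule_ge0 ?poweR_ge0// => i _.
  have := @esum_eq0P _ _ _ (fun i => poweR_ge0 (y i) q) Bz i.
  by move/poweR_eq0_eq0 => ->; rewrite ?mule0.
have Ap : 0 < A `^ p^-1 by apply: poweR_gt0; rewrite lt0e An.
have Bp : 0 < B `^ q^-1 by apply: poweR_gt0; rewrite lt0e Bn.
have [Ay|Ay] := eqVneq A +oo.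
  by rewrite Ay poweRyr ?invr_eq0 ?gt_eqF// gt0_mulye// leey.
have [By|By] := eqVneq B +oo.
  by rewrite By poweRyr ?invr_eq0 ?gt_eqF// gt0_muley// leey.
have AE : A `^ p^-1 = (fine (A `^ p^-1))%:E.
  by rewrite fineK// fin_num_poweR// ge0_fin_numE// ltey.
have BE : B `^ q^-1 = (fine (B `^ q^-1))%:E.
  by rewrite fineK// fin_num_poweR// ge0_fin_numE// ltey.
move: Ap Bp; rewrite AE BE; set a := fine _; set b := fine (B `^ _).
rewrite !lte_fin => a0 b0.
have [al [be [al0 be0 yg e]]] := weighted_young p0 q0 pq a0 b0.
apply: (@le_trans _ _ (\esum_(i in setT) (al%:E * x i `^ p + be%:E * y i `^
  q))).
  by apply: le_esum => i _; exact: yg.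
rewrite esumD; last 2 first.
- by move=> i _; rewrite mule_ge0 ?lee_fin ?(ltW al0)// poweR_ge0.
- by move=> i _; rewrite mule_ge0 ?lee_fin ?(ltW be0)// poweR_ge0.
rewrite !esumZ ?(ltW al0) ?(ltW be0)//; last 2 first.
- by move=> i; exact: poweR_ge0.
- by move=> i; exact: poweR_ge0.
rewrite -/A -/B -(poweRK p0 A0) -(poweRK q0 B0) AE BE !poweR_EFin -/a -/b.
by rewrite -!EFinM -EFinD e.
Qed.

Lemma hoelder_conjugate_real (r : R) : (1 < r)%R ->
  exists r' : R, [/\ hoelder_conjugate r%:E = r'%:E, (1 < r')%R &
    (r^-1 + r'^-1 = 1)%R].
Proof.
move=> r1; have r0 : (0 < r)%R by exact: lt_trans r1.
have r10 : (0 < r - 1)%R by rewrite subr_gt0.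
exists (r / (r - 1))%R; split.
- by rewrite /hoelder_conjugate/= eqe gt_eqF// -EFinD inver gt_eqF.
- by rewrite ltr_pdivlMr// mul1r gtrBl.
- by field; rewrite !gt_eqF.
Qed.

Lemma le_lnorm_real (T : choiceType) s (a b : T -> R) : (0 < s)%R ->
  (forall i, `|a i| <= `|b i|)%R ->
  lnorm s%:E (EFin \o a) <= lnorm s%:E (EFin \o b).
Proof.
move=> s0 ab; apply: le_poweR; first by rewrite invr_ge0 ltW.
  by apply: esum_ge0 => j _; exact: poweR_ge0.
apply: le_esum => j _; apply: le_poweR; [exact: ltW|exact: abse_ge0|exact: ab].
Qed.

Lemma lnormZ_real (T : choiceType) s (c : R) (a b : T -> R) : (0 < s)%R ->
  (0 <= c)%R -> (forall i, `|b i| = c * `|a i|)%R ->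
  lnorm s%:E (EFin \o b) = c%:E * lnorm s%:E (EFin \o a).
Proof.
move=> s0 c0 ba; rewrite /lnorm.
rewrite -[X in X * _](@poweRVK c%:E _ s0) ?lee_fin// -poweRM.
- rewrite poweR_EFin -esumZ ?powR_ge0//.
    congr (_ `^ _); apply: eq_esum => j _.
    by rewrite /= ba powRM// EFinM.
  by move=> j; exact: poweR_ge0.
- exact: poweR_ge0.
- by apply: esum_ge0 => j _; exact: poweR_ge0.
Qed.

Lemma lnorm_hoelder (T : choiceType) (r : \bar R) (x y : T -> \bar R) :
  1 < r ->
  \esum_(i in setT) (`|x i| * `|y i|) <=
  lnorm (hoelder_conjugate r) x * lnorm r y.
Proof.
case: r => [r||//].
  rewrite lte_fin => r1; have r0 : (0 < r)%R by exact: lt_trans r1.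
  have [r' [-> r'1 rr']] := hoelder_conjugate_real r1.
  rewrite /lnorm; apply: esum_hoelder => //; first exact: lt_trans r'1.
  by rewrite addrC.
move=> _; rewrite hoelder_conjugatey /=.
set S := ereal_sup _.
have xS i : `|y i| <= S by apply: ereal_sup_ubound; exists i.
rewrite invr1 poweRe1; last by apply: esum_ge0 => i _; exact: poweR_ge0.
(* On an empty index set [S] is [-oo]; both sums vanish then, and so does the product. *)
have [[i0 _]|h] := pselect (exists i : T, True); last first.
  rewrite !esum1 ?mul0e// => i; exfalso; apply: h; exists i => //.
have S0 : 0 <= S by apply: le_trans (xS i0).
under [X in _ <= X * _]eq_esum do rewrite poweRe1//.
have [Sy|Sy] := eqVneq S +oo; last first.
  have SE : S = (fine S)%:E by rewrite fineK// ge0_fin_numE// ltey.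
  rewrite muleC SE -esumZ ?fine_ge0//.
  by apply: le_esum => i _; rewrite muleC -SE lee_wpmul2r.
rewrite Sy; have [z|n] := eqVneq (\esum_(i in setT) `|x i|) 0.
  rewrite z mul0e esum1// => i _.
  by have := @esum_eq0P _ _ _ (fun i => abse_ge0 (x i)) z i => ->;
    rewrite mul0e.
rewrite gt0_muley ?leey// lt0e n; exact: esum_ge0.
Qed.

End hoelder_lemmas.

(** * Signed unordered sums *)

Section usum_lemmas.
Context (R : realType) (T : choiceType).
Implicit Types (a b c : T -> R).

Lemma usummableP a :
  usummable a <-> (\esum_(i in setT) `|a i|%:E < +oo)%E.
Proof. by []. Qed.

(** Positive and negative parts are not additive. Allowing any difference of nonnegative summable
    families in their place is what makes [usumD] and [usumZ] a matter of regrouping. *)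
Lemma usumE b c : (forall i, 0 <= b i) -> (forall i, 0 <= c i) ->
  usummable b -> usummable c ->
  usum (fun i => b i - c i) =
  fine (\esum_(i in setT) (b i)%:E) - fine (\esum_(i in setT) (c i)%:E).
Proof.
move=> b0 c0 sb sc; rewrite /usum.
have := esumB sb sc (fun i _ => b0 i : (0 <= (b i)%:E)%E)
  (fun i _ => c0 i : (0 <= (c i)%:E)%E).
rewrite -fineB => [<- //||].
  move: sb; rewrite /usummable summableE; congr (_ \is a fin_num).
  by apply: eq_esum => i _ /=; rewrite ger0_norm.
move: sc; rewrite /usummable summableE; congr (_ \is a fin_num).
by apply: eq_esum => i _ /=; rewrite ger0_norm.
Qed.

Lemma usum_ge0 a : (forall i, 0 <= a i) ->
  usum a = fine (\esum_(i in setT) (a i)%:E).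
Proof.
move=> a0; rewrite /usum [X in (_ - X)%E]esum1 ?sube0.
  by congr fine; apply: eq_esum => i _; rewrite funeposE/=; apply/max_idPl;
    rewrite lee_fin.
by move=> i _; rewrite funenegE/=; apply/max_idPr; rewrite lee_fin oppr_le0.
Qed.

Let pos a i := Num.max (a i) 0.
Let neg a i := Num.max (- a i) 0.

Let pos0 a i : 0 <= pos a i. Proof. by rewrite /pos le_max lexx orbT. Qed.
Let neg0 a i : 0 <= neg a i. Proof. by rewrite /neg le_max lexx orbT. Qed.

Let posneg a : a = fun i => pos a i - neg a i.
Proof.
apply/funext => i; rewrite /pos /neg; case: (leP 0 (a i)) => h.
  by rewrite max_r ?oppr_le0// subr0.
by rewrite max_l ?oppr_ge0 ?(ltW h)// sub0r opprK.
Qed.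

Lemma le_usummable a b : (forall i, `|a i| <= `|b i|) -> usummable b ->
  usummable a.
Proof. by move=> ab; apply: le_lt_trans; apply: le_esum => i _; exact: ab. Qed.

Let pos_le a i : `|pos a i| <= `|a i|.
Proof.
rewrite ger0_norm//; rewrite /pos; case: (leP 0 (a i)) => h.
  by rewrite ger0_norm.
exact: normr_ge0.
Qed.

Let neg_le a i : `|neg a i| <= `|a i|.
Proof. by have := pos_le (fun i => - a i) i; rewrite /pos normrN. Qed.

Lemma usummableD a b : usummable a -> usummable b ->
  usummable (fun i => a i + b i).
Proof. exact: summableD. Qed.

Lemma usummableZ k a : usummable a -> usummable (fun i => k * a i).
Proof.
rewrite !usummableP => sa.
under eq_esum do rewrite normrM EFinM.
by rewrite esumZ// lte_mul_pinfty.
Qed.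

Let usum_fine b : (forall i, 0 <= b i) -> usummable b ->
  (\esum_(i in setT) (b i)%:E)%E \is a fin_num.
Proof.
move=> b0; rewrite /usummable summableE; congr (_ \is a fin_num).
by apply: eq_esum => i _ /=; rewrite ger0_norm.
Qed.

Lemma usumD a b : usummable a -> usummable b ->
  usum (fun i => a i + b i) = usum a + usum b.
Proof.
move=> sa sb.
have sp := le_usummable (pos_le a) sa; have sn := le_usummable (neg_le a) sa.
have tp := le_usummable (pos_le b) sb; have tn := le_usummable (neg_le b) sb.
rewrite (_ : (fun i => a i + b i) =
    (fun i => (pos a i + pos b i) - (neg a i + neg b i))); last first.
  apply/funext => i; rewrite [in LHS](posneg a) [in LHS](posneg b); ring.
rewrite usumE; last 4 first.
- by move=> i; rewrite addr_ge0.
- by move=> i; rewrite addr_ge0.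
- exact: usummableD.
- exact: usummableD.
rewrite [in RHS](posneg a) [in RHS](posneg b) !usumE//.
under eq_esum do rewrite EFinD.
under [X in _ - fine X]eq_esum do rewrite EFinD.
rewrite !esumD//; do ?[by move=> i _; rewrite lee_fin].
rewrite !fineD; do ?exact: usum_fine.
ring.
Qed.

Lemma usumN a : usummable a -> usum (fun i => - a i) = - usum a.
Proof.
move=> sa.
have sp := le_usummable (pos_le a) sa; have sn := le_usummable (neg_le a) sa.
rewrite [in LHS](posneg a) [in RHS](posneg a) usumE//.
rewrite (_ : (fun i => _) = (fun i => neg a i - pos a i)).
  by rewrite usumE// opprB.
by apply/funext => i; rewrite opprB.
Qed.

Lemma usumZ k a : usummable a -> usum (fun i => k * a i) = k * usum a.
Proof.
move=> sa.
wlog k0 : k / 0 <= k => [h|].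
  have [/h//|k0] := leP 0 k.
  have := h (- k); rewrite oppr_ge0 ltW// => /(_ isT) e.
  rewrite (_ : (fun i => _) = (fun i => - (- k * a i))).
    by rewrite usumN ?e; [rewrite mulNr opprK|exact: usummableZ].
  by apply/funext => i; rewrite mulNr opprK.
have sp := le_usummable (pos_le a) sa; have sn := le_usummable (neg_le a) sa.
rewrite [in LHS](posneg a) [in RHS](posneg a).
rewrite (_ : (fun i => _) = (fun i => k * pos a i - k * neg a i)); last first.
  by apply/funext => i; rewrite mulrBr.
rewrite !usumE//; do ?[by move=> i; rewrite mulr_ge0]; do ?exact: usummableZ.
under eq_esum do rewrite EFinM.
under [X in _ - fine X]eq_esum do rewrite EFinM.
rewrite !esumZ//; do ?[by move=> i; rewrite lee_fin].
by rewrite !fineM//; [rewrite mulrBr|exact: usum_fine..].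
Qed.

Lemma le_norm_usum a : usummable a ->
  (`|usum a|%:E <= \esum_(i in setT) `|a i|%:E)%E.
Proof.
move=> sa.
have sp := le_usummable (pos_le a) sa; have sn := le_usummable (neg_le a) sa.
rewrite [in leLHS](posneg a) usumE//.
have -> : (\esum_(i in setT) `|a i|%:E =
   \esum_(i in setT) (pos a i)%:E + \esum_(i in setT) (neg a i)%:E)%E.
  rewrite -esumD; do ?[by move=> i _; rewrite lee_fin].
  apply: eq_esum => i _; rewrite -EFinD /pos /neg; case: (leP 0 (a i)) => h.
    by rewrite max_r ?oppr_le0// addr0 ger0_norm.
  by rewrite max_l ?oppr_ge0 ?(ltW h)// add0r ltr0_norm.
rewrite -(fineK (usum_fine (pos0 a) sp)) -(fineK (usum_fine (neg0 a) sn)).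
rewrite -EFinD lee_fin /=; apply: le_trans (ler_normB _ _) _.
by rewrite !ger0_norm// fine_ge0//; apply: esum_ge0 => i _; rewrite lee_fin.
Qed.

Lemma usummable_finsupp (l : seq T) a : uniq l ->
  (forall i, i \notin l -> a i = 0) -> usummable a.
Proof.
move=> ul al; rewrite usummableP (esum_finsupp ul)//.
  by rewrite sumEFin ltry.
by move=> i /al ->; rewrite normr0.
Qed.

Lemma usum_finsupp (l : seq T) a : uniq l ->
  (forall i, i \notin l -> a i = 0) -> usum a = \sum_(i <- l) a i.
Proof.
move=> ul al.
have h b : (forall i, 0 <= b i) -> (forall i, i \notin l -> b i = 0) ->
    fine (\esum_(i in setT) (b i)%:E) = \sum_(i <- l) b i.
  move=> b0 bl; rewrite (esum_finsupp ul) ?sumEFin// => i /bl -> //.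
have pl i : i \notin l -> pos a i = 0 by move=> /al; rewrite /pos => ->;
  rewrite maxxx.
have nl i : i \notin l -> neg a i = 0.
  by move=> /al; rewrite /neg => ->; rewrite oppr0 maxxx.
rewrite [LHS](_ : _ = usum (fun i => pos a i - neg a i));
  last by rewrite -posneg.
rewrite usumE//; [|exact: usummable_finsupp ul pl|exact: usummable_finsupp ul
  nl].
by rewrite !h// -sumrB; apply: eq_bigr => i _;
  rewrite [RHS](congr1 (@^~ i) (posneg a)).
Qed.

Lemma measurable_usum d (X : measurableType d) (f : T -> X -> R) :
  countable [set: T] -> (forall i, measurable_fun setT (f i)) ->
  measurable_fun setT (fun x => usum (fun i => f i x)).
Proof.
move=> cT mf; rewrite /usum.
apply: (measurableT_comp (@fine_measurable R setT measurableT)) => //.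
apply: emeasurable_funB; apply: measurable_esum => // i.
- rewrite (_ : (fun x => _) = ((EFin \o f i)^\+)%E); last first.
    by apply/funext => x; rewrite !funeposE.
  by apply: measurable_funepos; exact/measurable_EFinP.
- rewrite (_ : (fun x => _) = ((EFin \o f i)^\-)%E); last first.
    by apply/funext => x; rewrite !funenegE.
  by apply: measurable_funeneg; exact/measurable_EFinP.
Qed.

End usum_lemmas.

(** * The pairing of blocks with Morrey functions *)

Section lseq_lemmas.
Context (R : realType) (X : Type).
Implicit Types (q : R) (f g : int -> X -> R).

Lemma countable_int : countable [set: int].
Proof. exact: countableP. Qed.

Lemma lseq_ge0 q f x : (0 <= lseq q f x)%E.
Proof. exact: poweR_ge0. Qed.

Lemma lseq_poweR q f x : 0 < q ->
  (lseq q f x `^ q = \esum_(j in setT) (`|f j x| `^ q)%:E)%E.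
Proof.
by move=> q0; rewrite poweRK//; apply: esum_ge0 => j _; exact: poweR_ge0.
Qed.

Lemma lseq_poweRV q f x : 0 < q ->
  (lseq q f x = (\esum_(j in setT) (`|f j x| `^ q)%:E) `^ q^-1)%E.
Proof. by []. Qed.

Lemma le_lseq q f g x : 0 < q -> (forall j, `|f j x| <= `|g j x|) ->
  (lseq q f x <= lseq q g x)%E.
Proof. exact: le_lnorm_real. Qed.

Lemma lseqZ q f g x (c : R) : 0 < q -> 0 <= c ->
  (forall j, `|g j x| = c * `|f j x|) -> (lseq q g x = c%:E * lseq q f x)%E.
Proof. exact: lnormZ_real. Qed.

Lemma lseq0 q f x : 0 < q -> (forall j, f j x = 0) -> lseq q f x = 0%E.
Proof.
by move=> q0 f0; rewrite (@lseqZ q f f x 0)// ?mul0e// => j;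
  rewrite f0 normr0 mulr0.
Qed.

Lemma esum_mul_le_lseq q q' f g x : 0 < q -> 0 < q' -> q^-1 + q'^-1 = 1 ->
  (\esum_(j in setT) `|f j x * g j x|%:E <= lseq q' f x * lseq q g x)%E.
Proof.
move=> q0 q'0 qq'.
under eq_esum do rewrite normrM EFinM.
by apply: esum_hoelder => //; rewrite addrC.
Qed.

End lseq_lemmas.

Lemma measurable_lseq (R : realType) d (X : measurableType d) (q : R)
    (f : int -> X -> R) : (forall j, measurable_fun setT (f j)) ->
  measurable_fun setT (lseq q f).
Proof.
move=> mf; apply: (measurableT_comp (measurable_poweR _)).
apply: measurable_esum => [|j x|j]; first exact: countable_int.
  exact: poweR_ge0.
apply: (measurableT_comp (measurable_poweR _)).
by apply: measurableT_comp => //; exact/measurable_EFinP.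
Qed.

Section weighted_hoelder.
Local Open Scope ereal_scope.
Context (R : realType) d (X : measurableType d) (mu : {measure set X -> \bar
  R}).

(** The bounds [a] and [b] are arbitrary positive reals and not the norms themselves, so no
    degenerate case arises here. The relation between [u] and [v] distributes the weights as
    [F v^(1/p')] times [G u^(1/p)]. *)
Lemma weighted_hoelder (p p' a b : R) (D : set X) (F G : X -> \bar R)
    (u v : X -> R) :
  (0 < p)%R -> (0 < p')%R -> (p^-1 + p'^-1 = 1)%R -> (0 < a)%R -> (0 < b)%R ->
  measurable D -> measurable_fun setT F -> measurable_fun setT G ->
  measurable_fun setT u -> measurable_fun setT v ->
  (forall x, 0 <= F x) -> (forall x, 0 <= G x) -> (forall x, 0 <= v x)%R ->
  {ae mu, forall x, (0 < u x /\ v x `^ p'^-1 * u x `^ p^-1 = 1)%R} ->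
  \int[mu]_(x in D) (F x `^ p' * (v x)%:E) <= (a `^ p')%:E ->
  \int[mu]_(x in D) (G x `^ p * (u x)%:E) <= (b `^ p)%:E ->
  \int[mu]_(x in D) (F x * G x) <= (a * b)%:E.
Proof.
move=> p0 p'0 pp' a0 b0 mD mF mG mu' mv F0 G0 v0 uv hF hG.
have p'p : (p'^-1 + p^-1 = 1)%R by rewrite addrC.
have [al [be [al0 be0 yg e]]] := weighted_young p'0 p0 p'p a0 b0.
(* [u] is positive only almost everywhere; the absolute value makes the majorant nonnegative
   everywhere. *)
pose H x := al%:E * (F x `^ p' * (v x)%:E) + be%:E * `|G x `^ p * (u x)%:E|.
have mFp : measurable_fun D (fun x => F x `^ p' * (v x)%:E).
  apply: measurable_funTS; apply: emeasurable_funM; last exact/measurable_EFinP.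
  exact: (measurableT_comp (measurable_poweR _)).
have mGp : measurable_fun D (fun x => G x `^ p * (u x)%:E).
  apply: measurable_funTS; apply: emeasurable_funM; last exact/measurable_EFinP.
  exact: (measurableT_comp (measurable_poweR _)).
have H1 x : 0 <= F x `^ p' * (v x)%:E by rewrite mule_ge0 ?poweR_ge0// lee_fin.
apply: (@le_trans _ _ (\int[mu]_(x in D) H x)).
  apply: ae_ge0_le_integral => //.
  - by move=> x _; exact: mule_ge0.
  - by apply: measurable_funTS; exact: emeasurable_funM.
  - by move=> x _; rewrite adde_ge0// mule_ge0// lee_fin ltW.
  - apply: emeasurable_funD; apply: emeasurable_funM => //.
    exact: measurableT_comp.
  apply: filterS uv => x [u0 uv] _.
  have := yg (F x * (v x `^ p'^-1)%:E) (G x * (u x `^ p^-1)%:E).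
  rewrite !mule_ge0 ?lee_fin ?powR_ge0// => /(_ isT isT).
  rewrite muleACA -EFinM uv mule1 => /le_trans; apply.
  rewrite /H gee0_abs ?mule_ge0 ?poweR_ge0 ?lee_fin ?(ltW u0)//.
  rewrite !poweRM ?lee_fin ?powR_ge0// !poweR_EFin.
  rewrite -!powRrM mulVf ?gt_eqF// mulVf ?gt_eqF// !powRr1 ?(ltW u0)//.
have hG' : \int[mu]_(x in D) `|G x `^ p * (u x)%:E| <= (b `^ p)%:E.
  apply: le_trans hG; rewrite le_eqVlt; apply/orP; left; apply/eqP.
  apply: ae_eq_integral => //; first exact: measurableT_comp.
  move: uv; apply: filterS => x [u0 _] _.
  by rewrite gee0_abs// mule_ge0 ?poweR_ge0// lee_fin ltW.
rewrite ge0_integralD//; last 4 first.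
- by move=> x _; rewrite mule_ge0// lee_fin ltW.
- exact: emeasurable_funM.
- by move=> x _; rewrite mule_ge0// lee_fin ltW.
- by apply: emeasurable_funM => //; exact: measurableT_comp.
rewrite !ge0_integralZl//; [|exact: measurableT_comp|exact: ltW|exact: ltW].
by rewrite -e EFinD leeD// EFinM lee_wpmul2l// lee_fin ltW.
Qed.

End weighted_hoelder.

(* [c kt] is the weight [w(Q) ^ (1/t - 1/p)] of the cube [kt], which bounds the
   blocks on one side and multiplies the entries of the Morrey norm on the
   other; its positivity and finiteness are all that the duality uses of the
   weight of a cube. *)
Record cube_setting (R : realType) d (X : measurableType d)
    (mu : {measure set X -> \bar R}) (I : int -> choiceType)
    (Q : forall k : int, I k -> set X) (w : X -> R) (p t : R)
    (c : {k : int & I k} -> R) : Prop := {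
  cubes_nonempty : [set: {k : int & I k}] !=set0 ;
  cubes_countable : countable [set: {k : int & I k}] ;
  cube_measurable : forall kt, measurable (cube Q kt) ;
  cube_finite : forall kt, (mu (cube Q kt) < +oo)%E ;
  cubes_cover : {ae mu, forall x, exists kt, cube Q kt x} ;
  cube_coef_gt0 : forall kt, 0 < c kt ;
  cube_coefE : forall kt,
    (wmeasure mu w (cube Q kt) `^ (t^-1 - p^-1) = (c kt)%:E)%E ;
  cube_weight_measurable : measurable_fun setT w ;
  cube_weight_gt0 : {ae mu, forall x, 0 < w x} }.

Section block_pairing.
Context (R : realType) d (X : measurableType d) (mu : {measure set X -> \bar R})
  (I : int -> choiceType) (Q : forall k : int, I k -> set X) (w : X -> R)
  (p p' q q' t : R) (r : \bar R) (c : {k : int & I k} -> R).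
Hypothesis S : cube_setting mu Q w p t c.
Hypotheses (p1 : 1 < p) (pp' : p^-1 + p'^-1 = 1).
Hypotheses (q1 : 1 < q) (qq' : q^-1 + q'^-1 = 1) (r1 : (1 < r)%E).
Let K : choiceType := {k : int & I k}.
Let v := dual_weight p w.

Lemma conjugate_gt1 (a b : R) : 1 < a -> a^-1 + b^-1 = 1 -> 1 < b.
Proof.
move=> a1 ab; have a0 : 0 < a by exact: lt_trans a1.
have b1 : b^-1 = 1 - a^-1 by rewrite -ab addrC addKr.
have a1' : a^-1 < 1 by rewrite invf_lt1.
have b0 : 0 < b^-1 by rewrite b1 subr_gt0.
by rewrite -[b]invrK invf_gt1// b1 ltrBlDr ltrDl invr_gt0.
Qed.

Let p0 : 0 < p. Proof. exact: lt_trans p1. Qed.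
Let q0 : 0 < q. Proof. exact: lt_trans q1. Qed.
Let p'0 : 0 < p'. Proof. exact: (lt_trans ltr01 (conjugate_gt1 p1 pp')). Qed.
Let q'0 : 0 < q'. Proof. exact: (lt_trans ltr01 (conjugate_gt1 q1 qq')). Qed.

Lemma dual_weight_ge0 x : 0 <= dual_weight p w x.
Proof. exact: powR_ge0. Qed.

Lemma measurable_dual_weight : measurable_fun setT (dual_weight p w).
Proof.
exact: (measurableT_comp (@measurable_powR R _) (cube_weight_measurable S)).
Qed.

Lemma dual_weightE x : 0 < w x -> v x `^ p'^-1 * w x `^ p^-1 = 1.
Proof.
move=> w0; rewrite /v /dual_weight -powRrM -powRD; last first.
  by apply/implyP => _; rewrite gt_eqF.
have -> : p'^-1 = 1 - p^-1 by rewrite -pp' addrC addKr.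
rewrite [X in w x `^ X](_ : _ = 0) ?powRr0//.
by field; rewrite !gt_eqF// subr_gt0.
Qed.

Lemma block_cubeP kt (b : int -> X -> R) :
  block mu w p p' t q' (cube Q kt) b <->
  [/\ forall j, measurable_fun setT (b j),
      forall j x, ~ cube Q kt x -> b j x = 0
    & (\int[mu]_(x in cube Q kt) (lseq q' b x `^ p' * (v x)%:E)
       <= (c kt `^ p')%:E)%E].
Proof.
have i0 : (0 <= \int[mu]_(x in cube Q kt) (lseq q' b x `^ p' * (v x)%:E))%E.
  by apply: integral_ge0 => x _; rewrite mule_ge0 ?poweR_ge0// lee_fin powR_ge0.
rewrite /block (cube_coefE S) le_poweRV// lee_fin ltW//.
exact: (cube_coef_gt0 S).
Qed.

Definition morrey_entry (g : int -> X -> R) (kt : K) : \bar R :=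
  (wmeasure mu w (cube Q kt) `^ (t^-1 - p^-1) *
   (\int[mu]_(x in cube Q kt) (`|lseq q g x| `^ p * (w x)%:E)) `^ p^-1)%E.

Lemma morrey_entryE g kt : morrey_entry g kt = ((c kt)%:E *
   (\int[mu]_(x in cube Q kt) (lseq q g x `^ p * (w x)%:E)) `^ p^-1)%E.
Proof.
rewrite /morrey_entry (cube_coefE S); congr (_ * _ `^ _)%E.
apply: eq_integral => x _; by rewrite gee0_abs ?lseq_ge0.
Qed.

Lemma morrey_entry_ge0 g kt : (0 <= morrey_entry g kt)%E.
Proof. by rewrite mule_ge0 ?poweR_ge0. Qed.

Lemma morrey_seq_normE g :
  morrey_seq_norm mu Q w p t r q g = lnorm r (morrey_entry g).
Proof. by []. Qed.

(** [w] may be negative on a null set, where results on nonnegative integrands do not apply; with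
    its absolute value they do. *)
Lemma weight_abs (D : set X) (F : X -> \bar R) : measurable D ->
  measurable_fun D F -> (forall x, 0 <= F x)%E ->
  (\int[mu]_(x in D) (F x * (w x)%:E) = \int[mu]_(x in D) (F x * `|w x|%:E))%E.
Proof.
move=> mD mF F0.
have mw : measurable_fun D w.
  exact: measurable_funTS (cube_weight_measurable S).
apply: ae_eq_integral => //; first by apply: emeasurable_funM => //;
  exact/measurable_EFinP.
  apply: emeasurable_funM => //; apply/measurable_EFinP.
  exact: measurableT_comp.
move: (cube_weight_gt0 S); apply: filterS => x w0 _.
by rewrite gtr0_norm.
Qed.

Lemma weight_integral_ge0 (D : set X) (F : X -> \bar R) : measurable D ->
  measurable_fun D F -> (forall x, 0 <= F x)%E ->
  (0 <= \int[mu]_(x in D) (F x * (w x)%:E))%E.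
Proof.
by move=> mD mF F0; rewrite weight_abs//; apply: integral_ge0 => x _;
  rewrite mule_ge0.
Qed.

Lemma measurable_lseq_poweR (s e : R) (D : set X) (g : int -> X -> R) :
  (forall j, measurable_fun setT (g j)) ->
  measurable_fun D (fun x => lseq s g x `^ e)%E.
Proof.
move=> mg; apply: measurable_funTS.
exact: (measurableT_comp (measurable_poweR _) (measurable_lseq _ mg)).
Qed.

Lemma block_pairing_le kt b g : block mu w p p' t q' (cube Q kt) b ->
  (forall j, measurable_fun setT (g j)) ->
  (\int[mu]_(x in cube Q kt) (lseq q' b x * lseq q g x) <= morrey_entry g kt)%E.
Proof.
move=> /block_cubeP[mb _ bb] mg; rewrite morrey_entryE.
set G := integral _ _ (fun x => _ * (w x)%:E)%E.
have c0 := cube_coef_gt0 S kt; have mQ := cube_measurable S kt.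
have G0 : (0 <= G)%E.
  apply: weight_integral_ge0 => //; first exact: measurable_lseq_poweR.
  by move=> x; exact: poweR_ge0.
have [Gy|Gy] := eqVneq G +oo%E.
  by rewrite Gy poweRyr ?gt_eqF ?invr_gt0// gt0_muley ?lte_fin// leey.
have GE : G = (fine G)%:E by rewrite fineK// ge0_fin_numE// ltey.
(* The second bound in [weighted_hoelder] must be positive, while the norm [a] of [g] may be 0.
   Enlarging [a] by [e / c kt] costs exactly [e] after multiplication by [c kt]. *)
rewrite GE poweR_EFin -EFinM; apply/lee_addgt0Pr => e e0.
set a := fine G `^ p^-1.
have a0 : 0 <= a by exact: powR_ge0.
have ec0 : 0 < e / c kt by rewrite divr_gt0.
have -> : ((c kt * a)%:E + e%:E = (c kt * (a + e / c kt))%:E)%E.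
  by rewrite -EFinD mulrDr mulrCA divff ?mulr1// gt_eqF.
apply: (weighted_hoelder p0 p'0 pp' c0 (u := w) (v := v)) => //.
- by rewrite ltr_wpDl.
- exact: measurable_lseq.
- exact: measurable_lseq.
- exact: (cube_weight_measurable S).
- exact: measurable_dual_weight.
- by move=> x; exact: lseq_ge0.
- by move=> x; exact: lseq_ge0.
- exact: dual_weight_ge0.
- by move: (cube_weight_gt0 S); apply: filterS => x w0; rewrite dual_weightE.
- rewrite -/G GE lee_fin.
  have -> : fine G = a `^ p.
    by rewrite /a -powRrM mulVf ?gt_eqF// powRr1// fine_ge0.
  by apply: ge0_ler_powR; rewrite ?nnegrE ?(ltW p0)//;
    [rewrite addr_ge0// ltW|rewrite lerDl ltW].
Qed.

(** The absolute values stand inside, so sums and integral may be exchanged freely. The same bound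
    then yields both the absolute convergence of the pairing and the estimate of [Jfun]. *)
Lemma pairing_le f lambda g :
  block_decomposition mu Q w p p' t (hoelder_conjugate r) q' f lambda ->
  (forall j, measurable_fun setT (f j)) ->
  (forall j, measurable_fun setT (g j)) ->
  (\int[mu]_x (\esum_(j in setT) `|f j x * g j x|%:E) <=
   lnorm (hoelder_conjugate r) (EFin \o lambda) *
   morrey_seq_norm mu Q w p t r q g)%E.
Proof.
move=> [_ [b [bb fb]]] mf mg.
have cK := cubes_countable S.
have mb kt j : measurable_fun setT (b kt j) by have [] := bb kt.
have mB kt : measurable_fun setT (fun x => lseq q' (b kt) x * lseq q g x)%E.
  by apply: emeasurable_funM; exact: measurable_lseq.
have B0 kt x : (0 <= `|lambda kt|%:E * (lseq q' (b kt) x * lseq q g x))%E.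
  by rewrite mule_ge0// mule_ge0// lseq_ge0.
apply: (@le_trans _ _ (\int[mu]_x \esum_(kt in setT)
    (`|lambda kt|%:E * (lseq q' (b kt) x * lseq q g x)))%E).
  apply: ae_ge0_le_integral => //.
  - by move=> x _; exact: esum_ge0.
  - apply: measurable_esum => //; first exact: countable_int.
    move=> j; apply/measurable_EFinP; apply: measurableT_comp => //.
    exact: measurable_funM.
  - by move=> x _; exact: esum_ge0.
  - by apply: measurable_esum => // kt; exact: emeasurable_funM.
  apply: filterS fb => x fb _.
  apply: (@le_trans _ _ (\esum_(j in setT) \esum_(kt in setT)
      (`|lambda kt|%:E * `|b kt j x * g j x|%:E))%E).
    apply: le_esum => j _; have [sj ->] := fb j.
    rewrite normrM EFinM.
    apply: (@le_trans _ _ ((\esum_(kt in setT) `|lambda kt * b kt j x|%:E) *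
      `|g j x|%:E)%E).
      by rewrite lee_wpmul2r// le_norm_usum.
    rewrite muleC -esumZ//; apply: le_esum => kt _.
    by rewrite -!EFinM !normrM lee_fin mulrC mulrA.
  rewrite esum_swap; last by move=> j kt; rewrite mule_ge0.
  apply: le_esum => kt _; rewrite esumZ// lee_wpmul2l//.
  exact: esum_mul_le_lseq.
rewrite integral_esum//; last by move=> kt; exact: emeasurable_funM.
apply: le_trans (lnorm_hoelder _ _ r1).
apply: le_esum => kt _; rewrite ge0_integralZl//; last first.
  by move=> x _; rewrite mule_ge0// lseq_ge0.
rewrite lee_wpmul2l// (gee0_abs (morrey_entry_ge0 g kt)).
apply: le_trans (block_pairing_le (bb kt) mg).
rewrite [leRHS]integral_mkcond le_eqVlt; apply/orP; left; apply/eqP.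
apply: eq_integral => x _; rewrite patchE; case: ifPn => // /negP xQ.
rewrite (lseq0 q'0) ?mul0e// => j.
by have [_ b0 _] := bb kt; apply: b0 => h; apply: xQ; rewrite inE.
Qed.

End block_pairing.

(** * Absolute convergence and linearity of the pairing functional *)

Section pairing_functional.
Context (R : realType) d (X : measurableType d) (mu : {measure set X -> \bar
  R}).
Implicit Types f g h : int -> X -> R.

Lemma measurable_pairing g f : (forall j, measurable_fun setT (f j)) ->
  (forall j, measurable_fun setT (g j)) -> measurable_fun setT (pairing g f).
Proof.
move=> mf mg; apply: measurable_usum => [|j]; first exact: countable_int.
exact: measurable_funM.
Qed.

Lemma measurable_esum_pairing g f : (forall j, measurable_fun setT (f j)) ->
  (forall j, measurable_fun setT (g j)) ->
  measurable_fun setT (fun x => \esum_(j in setT) `|f j x * g j x|%:E)%E.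
Proof.
move=> mf mg; apply: measurable_esum => //; first exact: countable_int.
move=> j; apply/measurable_EFinP; apply: measurableT_comp => //.
exact: measurable_funM.
Qed.

Lemma Jfun_defined_esum g f : (forall j, measurable_fun setT (f j)) ->
  (forall j, measurable_fun setT (g j)) ->
  (\int[mu]_x (\esum_(j in setT) `|f j x * g j x|%:E) < +oo)%E ->
  Jfun_defined mu g f /\
  (`|Jfun mu g f|%:E <= \int[mu]_x (\esum_(j in setT) `|f j x * g j x|%:E))%E.
Proof.
move=> mf mg fin.
have mE := measurable_esum_pairing mf mg.
have E0 x : (0 <= \esum_(j in setT) `|f j x * g j x|%:E)%E by exact: esum_ge0.
have iE : mu.-integrable setT (fun x => \esum_(j in setT) `|f j x * g j
  x|%:E)%E.
  by apply/integrableP; split => //; under eq_integral do rewrite gee0_abs//.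
have aeE : {ae mu, forall x, usummable (fun j => f j x * g j x)}.
  have := integrable_ae measurableT iE; apply: filterS => x /(_ I) h.
  by apply/usummableP; rewrite ltey_eq h.
have mp := measurable_pairing mf mg.
have le : (\int[mu]_x `|(pairing g f x)%:E| <=
    \int[mu]_x (\esum_(j in setT) `|f j x * g j x|%:E))%E.
  apply: ae_ge0_le_integral => //.
  - by apply: measurableT_comp => //; exact/measurable_EFinP.
  - by move: aeE; apply: filterS => x sx _; exact: le_norm_usum.
have ip : mu.-integrable setT (EFin \o pairing g f).
  apply/integrableP; split; first exact/measurable_EFinP.
  exact: le_lt_trans le fin.
split; first by split.
rewrite /Jfun /Rintegral.
have fi := integrable_fin_num measurableT ip.
apply: le_trans le; rewrite -abse_EFin fineK//.
by apply: le_abse_integral => //; exact/measurable_EFinP.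
Qed.

Lemma Jfun_linear g f h (a : R) : (forall j, measurable_fun setT (f j)) ->
  (forall j, measurable_fun setT (h j)) ->
  (forall j, measurable_fun setT (g j)) ->
  Jfun_defined mu g f -> Jfun_defined mu g h ->
  Jfun_defined mu g (fun j x => a * f j x + h j x) /\
  Jfun mu g (fun j x => a * f j x + h j x) = a * Jfun mu g f + Jfun mu g h.
Proof.
move=> mf mh mg [sf If] [sh Ih].
pose l := fun j x => a * f j x + h j x.
have ml j : measurable_fun setT (l j).
  by apply: measurable_funD => //; exact: measurable_funM.
have lE x : (fun j => l j x * g j x) =
    (fun j => a * (f j x * g j x) + h j x * g j x).
  by apply/funext => j; rewrite /l; ring.
have E : {ae mu, forall x, usummable (fun j => l j x * g j x) /\
    pairing g l x = a * pairing g f x + pairing g h x}.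
  apply: filterS2 sf sh => x sfx shx; rewrite /pairing lE; split.
    by apply: usummableD => //; exact: usummableZ.
  by rewrite usumD ?usumZ//; exact: usummableZ.
have I2 : mu.-integrable setT (fun x => (a * pairing g f x + pairing g h x)%:E).
  under eq_fun do rewrite EFinD EFinM.
  by apply: integrableD => //; exact: integrableZl.
have mpl : measurable_fun setT (EFin \o pairing g l).
  by apply/measurable_EFinP; exact: measurable_pairing.
have aeE : ae_eq mu setT (fun x => (a * pairing g f x + pairing g h x)%:E)
    (EFin \o pairing g l).
  by move: E; apply: filterS => x [_ e] _ /=; rewrite e.
have Il : mu.-integrable setT (EFin \o pairing g l).
  move/integrableP : I2 => [m2 fin2]; apply/integrableP; split => //.
  apply: le_lt_trans fin2; rewrite le_eqVlt; apply/orP; left; apply/eqP.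
  apply: ae_eq_integral => //; [exact: measurableT_comp..|].
  exact/ae_eq_abse/ae_eq_sym.
split.
  by split => //; move: E; apply: filterS => x [].
rewrite /Jfun -/l /Rintegral.
transitivity (fine (\int[mu]_x (a * pairing g f x + pairing g h x)%:E)).
  congr fine; apply: ae_eq_integral => //; last exact: ae_eq_sym.
  by case/integrableP : I2.
under eq_integral do rewrite EFinD EFinM.
rewrite integralD//; last exact: integrableZl.
rewrite integralZl// fineD.
- by rewrite fineM// (integrable_fin_num measurableT If).
- by apply: fin_numM => //; exact: (integrable_fin_num measurableT If).
- exact: (integrable_fin_num measurableT Ih).
Qed.

End pairing_functional.

(** * Multipliers and convergence in the block space *)

Section small_sequences.
Context (R : realType).
Implicit Types (u : nat -> \bar R).

Lemma ge0_cvg0P u : (forall n, 0 <= u n)%E ->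
  (u n @[n --> \oo] --> 0%E) <->
  (forall e : R, 0 < e -> \forall n \near \oo, (u n < e%:E)%E).
Proof.
move=> u0; split => [/fine_cvgP[fu /cvgrPdist_lt h] e /h|h].
  apply: filterS2 fu => n fu /=; rewrite sub0r normrN ger0_norm ?fine_ge0//.
  by rewrite -lte_fin fineK.
apply/fine_cvgP; split.
  apply: filterS (h 1 ltr01) => n un; rewrite ge0_fin_numE//.
  exact: lt_trans un (ltry _).
apply/cvgrPdist_lt => e /[dup] e0 /h; apply: filterS => n un /=.
rewrite sub0r normrN ger0_norm ?fine_ge0// -lte_fin fineK// ge0_fin_numE//.
exact: lt_trans un (ltry _).
Qed.

Lemma small_poweR u (s : R) : 0 < s -> (forall n, 0 <= u n)%E ->
  (forall e : R, 0 < e -> \forall n \near \oo, (u n < e%:E)%E) ->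
  forall e : R, 0 < e -> \forall n \near \oo, (u n `^ s < e%:E)%E.
Proof.
move=> s0 u0 h e e0.
have := h (e `^ s^-1); rewrite powR_gt0// => /(_ isT); apply: filterS => n un.
rewrite ltNge; apply/negP => eu; move: un; rewrite ltNge => /negP; apply.
rewrite -[u n](poweRVK s0)// -poweR_EFin; apply: le_poweR => //.
  by rewrite invr_ge0 ltW.
by rewrite lee_fin ltW.
Qed.

Lemma small_mule u (c : R) : 0 <= c -> (forall n, 0 <= u n)%E ->
  (forall e : R, 0 < e -> \forall n \near \oo, (u n < e%:E)%E) ->
  forall e : R, 0 < e -> \forall n \near \oo, (c%:E * u n < e%:E)%E.
Proof.
move=> c0 u0 h e e0.
have c1 : 0 < c + 1 by rewrite ltr_wpDl.
have := h (e / (c + 1)); rewrite divr_gt0// => /(_ isT); apply: filterS => n un.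
apply: (@le_lt_trans _ _ ((c + 1)%:E * u n)%E).
  by rewrite lee_wpmul2r// lee_fin lerDl.
by rewrite muleC -lte_pdivlMr// -EFinM.
Qed.

Lemma exists_pos_summable (T : choiceType) : countable [set: T] ->
  exists eta : T -> R, (forall i, 0 < eta i) /\
    (\esum_(i in setT) (eta i)%:E <= 1)%E.
Proof.
move=> /countable_injP[e einj].
exists (fun i => 1 / (2 ^ (e i).+1)%:R); split.
  by move=> i; rewrite divr_gt0// ltr0n expn_gt0.
rewrite -(esum_image setT e (fun n => (1 / (2 ^ n.+1)%:R)%:E))//.
apply: (@le_trans _ _ (\esum_(n in setT) (1 / (2 ^ n.+1)%:R)%:E)%E).
  rewrite esum_mkcond; apply: le_esum => n _; case: ifP => // _.
rewrite -nneseries_esumT//.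
exact: (epsilon_trick0 xpredT).
Qed.

Lemma usum_gt0 (T : choiceType) (a : T -> R) i : (forall j, 0 <= a j) ->
  usummable a -> 0 < a i -> 0 < usum a.
Proof.
move=> a0 sa ai; rewrite usum_ge0//; apply: fine_gt0; apply/andP; split.
  apply: (@lt_le_trans _ _ (a i)%:E); first by rewrite lte_fin.
  by apply: (@le1_esum _ _ (fun j => (a j)%:E)).
apply: le_lt_trans sa; apply: le_esum => j _; rewrite lee_fin.
exact: ler_norm.
Qed.

End small_sequences.

Section block_space_lemmas.
Context (R : realType) d (X : measurableType d) (mu : {measure set X -> \bar R})
  (I : int -> choiceType) (Q : forall k : int, I k -> set X) (w : X -> R)
  (p p' q q' t : R) (r : \bar R) (c : {k : int & I k} -> R).
Hypothesis S : cube_setting mu Q w p t c.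
Hypotheses (p1 : 1 < p) (pp' : p^-1 + p'^-1 = 1).
Hypotheses (q1 : 1 < q) (qq' : q^-1 + q'^-1 = 1) (r1 : (1 < r)%E).
Let K : choiceType := {k : int & I k}.
Let v := dual_weight p w.
Let p0 : 0 < p. Proof. exact: lt_trans p1. Qed.
Let q0 : 0 < q. Proof. exact: lt_trans q1. Qed.
Let p'0 : 0 < p'. Proof. exact: (lt_trans ltr01 (conjugate_gt1 p1 pp')). Qed.
Let q'0 : 0 < q'. Proof. exact: (lt_trans ltr01 (conjugate_gt1 q1 qq')). Qed.

Local Notation dec :=
  (block_decomposition mu Q w p p' t (hoelder_conjugate r) q').
Local Notation lam_norm l := (lnorm (hoelder_conjugate r) (EFin \o l)).
Local Notation bint kt b :=
  (\int[mu]_(x in cube Q kt) (lseq q' b x `^ p' * (v x)%:E))%E.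

Lemma hoelder_conjugate_ge1_real :
  exists s : R, hoelder_conjugate r = s%:E /\ 1 <= s.
Proof.
case: r r1 => [r0||//].
  rewrite lte_fin => /hoelder_conjugate_real[s [-> s1 _]].
  by exists s; rewrite ltW.
by move=> _; exists 1; rewrite hoelder_conjugatey.
Qed.

Lemma bint_scale kt (b b' : int -> X -> R) (a : R) : 0 <= a ->
  (forall j, measurable_fun setT (b j)) ->
  (forall j x, `|b' j x| = a * `|b j x|) ->
  (bint kt b' = (a `^ p')%:E * bint kt b)%E.
Proof.
move=> a0 mb bb'; rewrite -ge0_integralZl//; first last.
- by rewrite lee_fin powR_ge0.
- by move=> x _; rewrite mule_ge0 ?poweR_ge0// lee_fin powR_ge0.
- apply: emeasurable_funM; first exact: measurable_lseq_poweR.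
  apply/measurable_EFinP; apply: measurable_funTS.
  exact: measurable_dual_weight S.
- exact: cube_measurable S kt.
apply: eq_integral => x _.
rewrite (lseqZ q'0 a0 (fun j => bb' j x)) poweRM ?lseq_ge0//.
by rewrite poweR_EFin muleA.
Qed.

Lemma bint_le kt (b b' : int -> X -> R) :
  (forall j, measurable_fun setT (b j)) ->
  (forall j, measurable_fun setT (b' j)) ->
  (forall j x, `|b' j x| <= `|b j x|) -> (bint kt b' <= bint kt b)%E.
Proof.
move=> mb mb' bb'.
have mv : measurable_fun (cube Q kt) (EFin \o v).
  apply/measurable_EFinP; apply: measurable_funTS.
  exact: measurable_dual_weight S.
apply: ge0_le_integral.
- exact: cube_measurable S kt.
- by move=> x _; rewrite mule_ge0 ?poweR_ge0// lee_fin powR_ge0.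
- by apply: emeasurable_funM => //; exact: measurable_lseq_poweR.
- by apply: emeasurable_funM => //; exact: measurable_lseq_poweR.
- move=> x _; apply: lee_wpmul2r; first by rewrite lee_fin powR_ge0.
  apply: le_poweR; rewrite ?lseq_ge0 ?(ltW p'0)//.
  by apply: le_lseq => // j; exact: bb'.
Qed.

(** The constant [M] moves into the coefficients: [M^-1 * s] has modulus at most 1 and so maps
    blocks to blocks. *)
Lemma dec_mul f lambda (s : int -> X -> R) (M : R) : 0 < M ->
  (forall j, measurable_fun setT (s j)) -> (forall j x, `|s j x| <= M) ->
  dec f lambda -> dec (fun j x => s j x * f j x) (fun kt => M * lambda kt).
Proof.
move=> M0 ms sM [lfin [b [bb fb]]].
have [rr [rrE rr1]] := hoelder_conjugate_ge1_real.
split.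
  rewrite rrE (@lnormZ_real _ _ _ M lambda)//.
  - by rewrite -rrE lte_mul_pinfty// lee_fin ltW.
  - exact: lt_le_trans rr1.
  - exact: ltW.
  - by move=> i; rewrite normrM gtr0_norm.
exists (fun kt j x => M^-1 * s j x * b kt j x); split => [kt|].
  apply/(block_cubeP q' S p1 pp').
  have /(block_cubeP q' S p1 pp')[mb b0 bb'] := bb kt.
  split.
  - by move=> j; apply: measurable_funM => //; exact: measurable_funM.
  - by move=> j x /b0 ->; rewrite mulr0.
  - apply: le_trans bb'; apply: bint_le => //.
      by move=> j; apply: measurable_funM => //; exact: measurable_funM.
    move=> j x; rewrite normrM ler_piMl// normrM gtr0_norm ?invr_gt0//.
    by rewrite mulrC ler_pdivrMr// mul1r.
move: fb; apply: filterS => x fb j; have [sb ->] := fb j.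
have -> : (fun kt => M * lambda kt * (M^-1 * s j x * b kt j x)) =
    (fun kt => s j x * (lambda kt * b kt j x)).
  by apply/funext => kt; field; rewrite gt_eqF.
by split; [exact: usummableZ|rewrite usumZ].
Qed.

Lemma dec_measurable_mul f lambda (s : int -> X -> R) (M : R) : 0 < M ->
  (forall j, measurable_fun setT (s j)) -> (forall j x, `|s j x| <= M) ->
  (forall j, measurable_fun setT (f j)) -> dec f lambda ->
  block_space mu Q w p p' t (hoelder_conjugate r) q'
    (fun j x => s j x * f j x).
Proof.
move=> M0 ms sM mf df; split; first by move=> j; exact: measurable_funM.
by exists (fun kt => M * lambda kt); exact: dec_mul.
Qed.

(** Two of the three dominated convergences: over the coordinates at almost every point, then over
    the points of the cube, with the integrand of [b] itself as majorant. *)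
Lemma bint_cvg0 kt (b : int -> X -> R) (s : nat -> int -> X -> R) :
  block mu w p p' t q' (cube Q kt) b ->
  (forall n j, measurable_fun setT (s n j)) ->
  (forall n j x, `|s n j x| <= 1) ->
  {ae mu, forall x, forall j, forall e : R, 0 < e ->
     \forall n \near \oo, `|s n j x| < e} ->
  forall e : R, 0 < e ->
  \forall n \near \oo, (bint kt (fun j x => s n j x * b j x)%R < e%:E)%E.
Proof.
move=> /(block_cubeP q' S p1 pp')[mb b0 bb] ms s1 s0.
have mQ := cube_measurable S kt.
have mv : measurable_fun (cube Q kt) (EFin \o v).
  apply/measurable_EFinP; apply: measurable_funTS.
  exact: measurable_dual_weight S.
have msb n j : measurable_fun setT (fun x => s n j x * b j x).
  exact: measurable_funM.
pose F n x := (lseq q' (fun j x => s n j x * b j x)%R x `^ p' * (v x)%:E)%E.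
pose G x := (lseq q' b x `^ p' * (v x)%:E)%E.
have F0 n x : (0 <= F n x)%E.
  by rewrite mule_ge0 ?poweR_ge0// lee_fin powR_ge0.
have G0 x : (0 <= G x)%E.
  by rewrite mule_ge0 ?poweR_ge0// lee_fin powR_ge0.
have mF n : measurable_fun (cube Q kt) (F n).
  by apply: emeasurable_funM => //; exact: measurable_lseq_poweR.
have mG : measurable_fun (cube Q kt) G.
  by apply: emeasurable_funM => //; exact: measurable_lseq_poweR.
have iG : mu.-integrable (cube Q kt) G.
  apply/integrableP; split => //.
  under eq_integral do rewrite gee0_abs//.
  exact: le_lt_trans bb (ltry _).
have FG n x : (F n x <= G x)%E.
  apply: lee_wpmul2r; first by rewrite lee_fin powR_ge0.
  apply: le_poweR; rewrite ?lseq_ge0 ?(ltW p'0)//.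
  by apply: le_lseq => // j; rewrite normrM ler_piMl.
have F_cvg : {ae mu, forall x, cube Q kt x -> F n x @[n --> \oo] --> 0%E}.
  have := integrable_ae mQ iG; move: s0 (cube_weight_gt0 S).
  apply: filterS3 => x sx wx Gfin Qx; have {}Gfin := Gfin Qx.
  have v0 : 0 < v x by exact: powR_gt0.
  apply/ge0_cvg0P => //.
  suff h : forall e : R, 0 < e -> \forall n \near \oo,
      ((v x)%:E * lseq q' (fun j x => s n j x * b j x)%R x `^ p' < e%:E)%E.
    by move=> e /h; apply: filterS => n; rewrite /F muleC.
  apply: small_mule; [exact: ltW|by move=> n; exact: poweR_ge0|].
  apply: small_poweR => //; first by move=> n; exact: lseq_ge0.
  apply: small_poweR; first by rewrite invr_gt0.
    by move=> n; apply: esum_ge0 => j _; exact: poweR_ge0.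
  apply: (@esum_dominated_cvg0 _ _ (fun j => `|b j x| `^ q')
      (fun n j => `|s n j x * b j x| `^ q')).
  (* [G x] is finite and [v x] is positive, so the l^q' norm of [b] at [x] is finite; this is the
     dominating sum. *)
  + have : (lseq q' b x `^ q' < +oo)%E.
      apply: poweR_lty; apply: (@lty_poweRy _ _ p'); first by rewrite gt_eqF.
      rewrite ltNge leye_eq; apply/negP => /eqP ly.
      by move: Gfin; rewrite /G ly gt0_mulye// lte_fin.
    by rewrite lseq_poweR.
  + move=> n j; rewrite powR_ge0/=; apply: ge0_ler_powR.
    * exact: ltW.
    * by rewrite nnegrE.
    * by rewrite nnegrE.
    * by rewrite normrM ler_piMl.
  + move=> j e e0; have c1 : 0 < `|b j x| + 1 by rewrite ltr_wpDl.
    have := sx j (e `^ q'^-1 / (`|b j x| + 1)).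
    rewrite divr_gt0 ?powR_gt0// => /(_ isT); apply: filterS => n.
    rewrite ltr_pdivlMr// => h.
    have h2 : `|s n j x * b j x| < e `^ q'^-1.
      by apply: le_lt_trans h; rewrite normrM ler_wpM2l// lerDl.
    have -> : e = (e `^ q'^-1) `^ q'.
      by rewrite -powRrM mulVf ?gt_eqF// powRr1// ltW.
    by apply: gt0_ltr_powR => //; rewrite nnegrE ?powR_ge0.
have F_dom : {ae mu, forall x n, cube Q kt x -> (`|F n x| <= G x)%E}.
  by apply: aeW => x n _; rewrite gee0_abs.
have [_ _] := @dominated_convergence _ _ _ mu _ mQ F (cst 0%E) G mF
   (measurable_cst _) F_cvg iG F_dom.
rewrite integral0 => h; apply: (ge0_cvg0P _).1; [|exact: h].
by move=> n; apply: integral_ge0 => x _; exact: F0.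
Qed.

(** The multiplied blocks shrink, and their loss of size is moved into the coefficients. [de n kt]
    is the size of the multiplied block relative to the allowed [c kt]; dividing the block by
    [dl n kt] leaves a block, with coefficient [lambda kt * dl n kt]. For each cube this factor
    tends to 0 by [bint_cvg0] and is at most 1, so dominated convergence in l^r', with majorant
    [lambda], finishes. *)
Lemma dec_cvg0 f lambda (s : nat -> int -> X -> R) : dec f lambda ->
  (forall n j, measurable_fun setT (s n j)) ->
  (forall n j x, `|s n j x| <= 1) ->
  {ae mu, forall x, forall j, forall e : R, 0 < e ->
     \forall n \near \oo, `|s n j x| < e} ->
  forall e : R, 0 < e -> \forall n \near \oo, exists l : K -> R,
    dec (fun j x => s n j x * f j x) l /\ (lam_norm l < e%:E)%E.
Proof.
move=> [lfin [b [bb fb]]] ms s1 s0.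
have [rr [rrE rr1]] := hoelder_conjugate_ge1_real.
have rr0 : 0 < rr by exact: lt_le_trans rr1.
pose sb n kt j x := s n j x * b kt j x.
have c0 kt := cube_coef_gt0 S kt.
have bl kt := (block_cubeP q' S p1 pp' kt (b kt)).1 (bb kt).
have mb kt j : measurable_fun setT (b kt j) by case: (bl kt).
have msb n kt j : measurable_fun setT (sb n kt j) by exact: measurable_funM.
have i0 kt b' : (0 <= bint kt b')%E.
  by apply: integral_ge0 => x _; rewrite mule_ge0 ?poweR_ge0// lee_fin powR_ge0.
have sbc n kt : (bint kt (sb n kt) <= (c kt `^ p')%:E)%E.
  have [_ _ h] := bl kt; apply: le_trans h; apply: bint_le => //.
  by move=> j x; rewrite normrM ler_piMl.
have sbfin n kt : (bint kt (sb n kt) \is a fin_num).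
  by rewrite ge0_fin_numE//; exact: le_lt_trans (sbc n kt) (ltry _).
pose de n kt := (fine (bint kt (sb n kt))) `^ p'^-1 / c kt.
have de0 n kt : 0 <= de n kt by rewrite divr_ge0 ?powR_ge0 ?ltW.
have de1 n kt : de n kt <= 1.
  rewrite ler_pdivrMr// mul1r.
  have -> : c kt = (c kt `^ p') `^ p'^-1.
    by rewrite -powRrM mulfV ?gt_eqF// powRr1// ltW.
  apply: ge0_ler_powR;
    rewrite ?nnegrE ?powR_ge0 ?fine_ge0 ?invr_ge0 ?(ltW p'0)//.
  by rewrite -lee_fin fineK.
(* The maximum keeps the divisor positive where a truncated block vanishes. *)
pose dl n kt := Num.max (de n kt) n.+1%:R^-1.
have dl0 n kt : 0 < dl n kt by rewrite lt_max invr_gt0 ltr0n orbT.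
have dl1 n kt : dl n kt <= 1 by rewrite ge_max de1 invf_le1 ?ler1n ?ltr0n.
have decn n : dec (fun j x => s n j x * f j x) (fun kt => lambda kt * dl n kt).
  split.
    apply: le_lt_trans lfin; rewrite rrE; apply: le_lnorm_real => // kt.
    by rewrite normrM ler_piMr// gtr0_norm.
  exists (fun kt j x => (dl n kt)^-1 * sb n kt j x); split => [kt|].
    apply/(block_cubeP q' S p1 pp'); split.
    - by move=> j; exact: measurable_funM.
    - by move=> j x; have [_ h _] := bl kt => /h; rewrite /sb => ->;
        rewrite !mulr0.
    - rewrite (@bint_scale kt (sb n kt) _ (dl n kt)^-1)//; last 2 first.
      + by rewrite invr_ge0 ltW.
      + by move=> j x; rewrite normrM gtr0_norm ?invr_gt0.
      rewrite -(fineK (sbfin n kt)) -EFinM lee_fin -powR_inv1 ?(ltW (dl0 _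
        _))//.
      rewrite -powRrM mulN1r powRN mulrC ler_pdivrMr ?powR_gt0//.
      rewrite -powRM ?(ltW (c0 kt)) ?(ltW (dl0 _ _))//.
      have -> : fine (bint kt (sb n kt)) = (c kt * de n kt) `^ p'.
        rewrite /de mulrC divfK ?gt_eqF// -powRrM mulVf ?gt_eqF// powRr1//.
        exact: fine_ge0.
      apply: ge0_ler_powR.
      + exact: ltW.
      + by rewrite nnegrE mulr_ge0// ltW.
      + by rewrite nnegrE mulr_ge0// ltW.
      + by apply: ler_wpM2l; [exact: ltW|rewrite le_max lexx].
  move: fb; apply: filterS => x fb j; have [sbx ->] := fb j.
  have -> : (fun kt => lambda kt * dl n kt * ((dl n kt)^-1 * sb n kt j x)) =
      (fun kt => s n j x * (lambda kt * b kt j x)).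
    by apply/funext => kt; rewrite /sb; field; rewrite gt_eqF.
  by split; [exact: usummableZ|rewrite usumZ].
suff small : forall e : R, 0 < e -> \forall n \near \oo,
    (lam_norm (fun kt => lambda kt * dl n kt)%R < e%:E)%E.
  move=> e /small; apply: filterS => n ln.
  by exists (fun kt => lambda kt * dl n kt).
rewrite rrE; apply: small_poweR; first by rewrite invr_gt0.
  by move=> n; apply: esum_ge0 => kt _; exact: poweR_ge0.
apply: (@esum_dominated_cvg0 _ _ (fun kt => `|lambda kt| `^ rr)
    (fun n kt => `|lambda kt * dl n kt| `^ rr)).
- move: lfin; rewrite rrE => /(@lty_poweRy _ _ _ _); apply.
  by rewrite invr_eq0 gt_eqF.
- move=> n kt; rewrite powR_ge0/=; apply: ge0_ler_powR;
    rewrite ?nnegrE ?(ltW rr0)//.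
  by rewrite normrM ler_piMr// gtr0_norm.
move=> kt e e0; have c1 : 0 < `|lambda kt| + 1 by rewrite ltr_wpDl.
pose e1 := e `^ rr^-1 / (`|lambda kt| + 1).
have e10 : 0 < e1 by rewrite divr_gt0 ?powR_gt0.
have h1 : \forall n \near \oo,
  n.+1%:R^-1 < e1 by exact: near_infty_natSinv_lt (PosNum e10).
have h2 : \forall n \near \oo, (bint kt (sb n kt) < ((c kt * e1) `^ p')%:E)%E.
  by apply: (bint_cvg0 (bb kt)) => //; rewrite powR_gt0// mulr_gt0.
apply: filterS2 h1 h2 => n h1 h2.
have h3 : dl n kt < e1.
  rewrite gt_max h1 andbT /de ltr_pdivrMr// mulrC.
  have -> : c kt * e1 = ((c kt * e1) `^ p') `^ p'^-1.
    by rewrite -powRrM mulfV ?gt_eqF// powRr1// ltW// mulr_gt0.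
  apply: gt0_ltr_powR; rewrite ?invr_gt0 ?nnegrE ?powR_ge0 ?fine_ge0//.
  by rewrite -lte_fin fineK.
have -> : e = (e `^ rr^-1) `^ rr.
  by rewrite -powRrM mulVf ?gt_eqF// powRr1// ltW.
apply: gt0_ltr_powR; rewrite ?nnegrE ?powR_ge0//.
rewrite normrM (gtr0_norm (dl0 _ _)).
apply: (@le_lt_trans _ _ ((`|lambda kt| + 1) * dl n kt)).
  by rewrite ler_wpM2r ?lerDl// ltW.
by rewrite mulrC -ltr_pdivlMr.
Qed.

End block_space_lemmas.

(** * Representation of functionals *)

(* With [A = {s >= 1/2}] one has [s = 1_A / 2 + s' / 2] and [0 <= s' <= 1], so
   a bound for [D] on the functions with values in [0, 1] improves by a factor
   2 at each step. *)
Lemma binary_expansion_vanish (R : realType) d (X : measurableType d)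
    (D : (X -> R) -> R) (C : R) :
  let bounded (s : X -> R) := measurable_fun setT s /\ exists M : R, forall x,
    `|s x| <= M in
  (forall a s s', bounded s -> bounded s' ->
    D (fun x => a * s x + s' x) = a * D s + D s') ->
  (forall A, measurable A -> D (\1_A) = 0) ->
  (forall s : X -> R, measurable_fun setT s -> (forall x, `|s x| <= 1) ->
    `|D s| <= C) ->
  forall s, bounded s -> D s = 0.
Proof.
move=> bounded Dlin D1 DC.
have b1 A : measurable A -> bounded (\1_A).
  move=> mA; split; first exact: measurable_indic.
  by exists 1 => x; rewrite indicE ger0_norm// lern1 leq_b1.
have D0 : D (fun _ => 0) = 0.
  have := D1 set0 measurable0; rewrite indic0; exact.
have b0 : bounded (fun _ => 0).
  by split; [exact: measurable_cst|exists 0 => x; rewrite normr0].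
have DZ a s : bounded s -> D (fun x => a * s x) = a * D s.
  move=> bs; have := Dlin a s _ bs b0; rewrite D0 addr0 => <-.
  by congr D; apply/funext => x; rewrite addr0.
have H n : forall s : X -> R, measurable_fun setT s -> (forall x,
  0 <= s x <= 1) ->
    `|D s| <= C / 2 ^+ n.
  elim: n => [s ms s01|n IH s ms s01].
    rewrite expr0 divr1; apply: DC => // x.
    by have /andP[s0 s1] := s01 x; rewrite ger0_norm.
  pose A := [set x | 2^-1 <= s x].
  have mA : measurable A.
    rewrite (_ : A = setT `&` s @^-1` `[2^-1, +oo[%classic).
      by apply: ms => //; exact: measurable_itv.
    by apply/seteqP; split => x /=; rewrite in_itv/= andbT /A/=; tauto.
  pose s' x := 2 * s x - \1_A x.
  have ms' : measurable_fun setT s'.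
    by apply: measurable_funB; [exact: measurable_funM|exact: measurable_indic].
  have s'01 x : 0 <= s' x <= 1.
    have /andP[s0 s1] := s01 x; rewrite /s' indicE.
    have [xA|xA] := boolP (x \in A).
      by move: xA; rewrite inE /A/= => xA; rewrite mulr1n; apply/andP; split;
        lra.
    have {}xA : s x < 2^-1.
      by rewrite ltNge; apply/negP => h; move/negP: xA; apply; rewrite inE.
    by rewrite mulr0n; apply/andP; split; lra.
  have bs' : bounded s'.
    by split => //; exists 1 => x; have /andP[? ?] := s'01 x; rewrite ger0_norm.
  have -> : s = (fun x => 2^-1 * s' x + 2^-1 * \1_A x).
    by apply/funext => x; rewrite /s'; lra.
  rewrite Dlin//; last first.
    by have [m [M bM]] := b1 A mA; split; [exact: measurable_funM|
      exists (2^-1 * M) => x; rewrite normrM ger0_norm// ler_wpM2l].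
  rewrite DZ ?D1//; last exact: b1.
  rewrite mulr0 addr0 normrM ger0_norm// exprS invfM mulrCA ler_wpM2l//.
  exact: IH.
have H0 (s : X -> R) : measurable_fun setT s -> (forall x,
  0 <= s x <= 1) -> D s = 0.
  move=> ms s01; apply/eqP; rewrite -normr_le0 leNgt; apply/negP => Ds0.
  have C0 : 0 < C by have := lt_le_trans Ds0 (H 0%N s ms s01);
    rewrite expr0 divr1.
  have := near_infty_natSinv_lt (PosNum (divr_gt0 Ds0 C0)) => -[n _ /(_ n
    (leqnn n))] /=.
  rewrite ltr_pdivlMr// ltNge => /negP; apply.
  apply: le_trans (H n s ms s01) _; rewrite mulrC ler_wpM2r ?(ltW C0)//.
  rewrite lef_pV2 ?posrE ?exprn_gt0 ?ltr0n//.
  by rewrite -natrX ler_nat; exact: ltn_expl.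
move=> s [ms [M sM]].
(* An affine change carries [s] into [0, 1], and the constant it introduces is a multiple of the
   indicator of [setT], on which [D] vanishes. The summand 1 keeps [N] positive. *)
pose N := `|M| + 1.
have N0 : 0 < N by rewrite /N ltr_wpDl.
have sN x : - N <= s x <= N.
  rewrite -ler_norml; apply: le_trans (sM x) _.
  by apply: le_trans (ler_norm _) _; rewrite /N lerDl.
pose u x := (s x + N) / (2 * N).
have mu : measurable_fun setT u.
  by apply: measurable_funM => //; exact: measurable_funD.
have u01 x : 0 <= u x <= 1.
  have /andP[h1 h2] := sN x; rewrite /u; apply/andP; split.
    by rewrite divr_ge0 ?mulr_ge0 ?(ltW N0)//; lra.
  by rewrite ler_pdivrMr ?mulr_gt0//; lra.
have bu : bounded u.
  by split => //; exists 1 => x; have /andP[? ?] := u01 x; rewrite ger0_norm.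
have bN : bounded (fun x : X => - N * \1_setT x).
  have [m [M' h]] := b1 setT measurableT; split; first exact: measurable_funM.
  by exists (`|-N| * M') => x; rewrite normrM ler_wpM2l.
have -> : s = (fun x => (2 * N) * u x + (- N * \1_setT x)).
  apply/funext => x; rewrite /u indicE in_setT mulr1n; field.
  by rewrite gt_eqF.
by rewrite Dlin// DZ ?D1// ?H0// ?mulr0 ?addr0//; exact: b1.
Qed.

(** * A strictly positive member of the block space *)

Section positive_member.
Context (R : realType) d (X : measurableType d) (mu : {measure set X -> \bar R})
  (I : int -> choiceType) (Q : forall k : int, I k -> set X) (w : X -> R)
  (p p' q q' t : R) (r : \bar R) (c : {k : int & I k} -> R).
Hypothesis S : cube_setting mu Q w p t c.
Hypotheses (p1 : 1 < p) (pp' : p^-1 + p'^-1 = 1).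
Hypotheses (q1 : 1 < q) (qq' : q^-1 + q'^-1 = 1) (r1 : (1 < r)%E).
Let K : choiceType := {k : int & I k}.
Let v := dual_weight p w.
Let p'0 : 0 < p'. Proof. exact: (lt_trans ltr01 (conjugate_gt1 p1 pp')). Qed.
Let q'0 : 0 < q'. Proof. exact: (lt_trans ltr01 (conjugate_gt1 q1 qq')). Qed.

Lemma cube_sigma_finite : sigma_finite setT mu.
Proof.
have [N [mN N0 subN]] := cubes_cover S.
have /countable_injP[e einj] := cubes_countable S.
(* The cubes cover only almost everywhere; the null set [N], which contains the points they miss,
   comes first. *)
pose F n := if n is m.+1 then \bigcup_(kt in e @^-1` [set m]) cube Q kt else N.
have Fc m : F m.+1 = set0 \/ exists kt, F m.+1 = cube Q kt.
  have [[kt ekt]|h] := pselect (exists kt, e kt = m).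
    right; exists kt; apply/seteqP; split => [x [kt' /= ekt' Qx]|x Qx].
      by rewrite (_ : kt = kt')//; apply: einj; rewrite ?inE// ekt.
    by exists kt.
  left; apply/seteqP; split => // x [kt /= ekt _]; apply: h; by exists kt.
exists F.
  apply/esym/seteqP; split => // x _.
  have [Nx|Nx] := pselect (N x); first by exists 0%N.
  have [kt Qx] : exists kt, cube Q kt x by apply: contrapT => h; apply: Nx;
    exact: subN.
  by exists (e kt).+1 => //; exists kt.
case => [|m]; first by split => //=; rewrite N0.
have [->|[kt ->]] := Fc m; first by rewrite measure0.
by split; [exact: (cube_measurable S)|exact: (cube_finite S)].
Qed.

(** On each cube the block is [ka kt * eta_j^(1/q') * v^(-1/p')]. The factor [v^(-1/p')] cancels the
    weight in the block integral, and [eta] keeps the l^q' norm of the coordinates at most 1, so the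
    integral is at most [ka kt ^ p'] times the measure of the cube. Summing these blocks with the
    positive summable coefficients [th] gives positivity wherever some cube covers the point and [w]
    is positive. *)
Lemma exists_positive_member : exists (f0 : int -> X -> R) (lambda0 : K -> R),
  [/\ forall j, measurable_fun setT (f0 j), forall j x, 0 < f0 j x
    & block_decomposition mu Q w p p' t (hoelder_conjugate r) q' f0 lambda0].
Proof.
have [rr [rrE rr1]] := hoelder_conjugate_ge1_real r1.
have rr0 : 0 < rr by exact: lt_le_trans rr1.
have [eta [eta0 eta1]] := exists_pos_summable R countable_int.
have [th [th0 th1]] := exists_pos_summable R (cubes_countable S).
have thle1 kt : th kt <= 1.
  rewrite -lee_fin; apply: le_trans th1.
  by apply: (@le1_esum _ _ (fun kt => (th kt)%:E)) => i; rewrite lee_fin ltW.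
have c0 kt := cube_coef_gt0 S kt.
pose m kt := fine (mu (cube Q kt)).
have m0 kt : 0 <= m kt by exact: fine_ge0.
have mE kt : mu (cube Q kt) = (m kt)%:E.
  by rewrite fineK// ge0_fin_numE// (cube_finite S).
(* The bound by [c kt], together with the divisor [1 + m kt], gives the block condition: [p' >= 1]
   yields [m kt <= (1 + m kt) ^ p']. The bound by 1 gives the pointwise summability over the
   cubes. *)
pose ka kt := Num.min 1 (c kt) / (1 + m kt).
have ka0 kt : 0 < ka kt by rewrite divr_gt0 ?lt_min ?ltr01 ?c0// ltr_wpDr.
have kale1 kt : ka kt <= 1.
  rewrite ler_pdivrMr ?mul1r; last by rewrite ltr_wpDr.
  by rewrite ge_min lerDl m0.
have kac kt : ka kt `^ p' * m kt <= c kt `^ p'.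
  have p'1 : 1 <= p' by rewrite ltW// (conjugate_gt1 p1 pp').
  have a1 : 1 <= 1 + m kt by rewrite lerDl.
  have a0 : 0 < 1 + m kt by exact: lt_le_trans a1.
  rewrite /ka powR_div ?le_min ?ler01 ?(ltW (c0 kt))//.
  rewrite mulrAC ler_pdivrMr ?powR_gt0//; apply: ler_pM; rewrite ?powR_ge0//.
    apply: ge0_ler_powR;
      rewrite ?nnegrE ?le_min ?ler01 ?(ltW p'0) ?(ltW (c0 _))//.
    by rewrite ge_min lexx orbT.
  apply: (@le_trans _ _ (1 + m kt)); first by rewrite lerDr.
  by rewrite -[leLHS]powRr1 ?(ltW a0)//; apply: ler_powR.
pose ze j := eta j `^ q'^-1.
have ze0 j : 0 < ze j by rewrite powR_gt0.
pose vi x := v x `^ (- p'^-1).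
have vi0 x : 0 <= vi x by exact: powR_ge0.
have mvi : measurable_fun setT vi.
  apply: (measurableT_comp (@measurable_powR R _)).
  exact: measurable_dual_weight S.
pose b kt j x := ka kt * ze j * vi x * \1_(cube Q kt) x.
have b0 kt j x : 0 <= b kt j x.
  by do 3 (apply: mulr_ge0 => //); exact: ltW.
have mb kt j : measurable_fun setT (b kt j).
  apply: measurable_funM; last by apply: measurable_indic;
    exact: cube_measurable S kt.
  by apply: measurable_funM.
have bb kt : block mu w p p' t q' (cube Q kt) (b kt).
  apply/(block_cubeP q' S p1 pp'); split => //.
    move=> j x Qx; rewrite /b indicE memNset// mulr0 //.
  apply: (@le_trans _ _ (\int[mu]_(x in cube Q kt) (cst (ka kt `^ p')%:E x))%E).
    apply: ge0_le_integral.
    - exact: cube_measurable S kt.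
    - by move=> x _; rewrite mule_ge0 ?poweR_ge0// lee_fin powR_ge0.
    - apply: emeasurable_funM; first exact: measurable_lseq_poweR.
      apply/measurable_EFinP; apply: measurable_funTS.
      exact: measurable_dual_weight S.
    - exact: measurable_cst.
    - move=> x Qx.
      have [v0|v0] := eqVneq (v x) 0.
        by rewrite -/v v0 mule0 lee_fin powR_ge0.
      have {}v0 : 0 < v x by rewrite lt_neqAle eq_sym v0 powR_ge0.
      have kv0 : 0 <= ka kt * vi x by rewrite mulr_ge0 ?vi0// ltW.
      apply: (@le_trans _ _ (((ka kt * vi x)%:E * 1) `^ p' * (v x)%:E)%E).
        apply: lee_wpmul2r; first by rewrite lee_fin ltW.
        apply: le_poweR; rewrite ?lseq_ge0 ?(ltW p'0)//.
        rewrite (@lseqZ _ _ q' (fun j _ => ze j) (b kt) x (ka kt * vi x))//.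
          apply: lee_wpmul2l; first by rewrite lee_fin.
          rewrite le_poweRV//; last by apply: esum_ge0 => j _; exact: poweR_ge0.
          rewrite poweR1r; apply: le_trans eta1; apply: le_esum => j _.
          rewrite /= lee_fin gtr0_norm// /ze -powRrM mulVf ?gt_eqF// powRr1//.
          exact: ltW.
        move=> j; rewrite (ger0_norm (b0 _ _ _)) (gtr0_norm (ze0 _)) /b indicE
          mem_set//.
        by rewrite mulr1; ring.
      rewrite mule1 poweR_EFin -EFinM lee_fin powRM ?vi0 ?(ltW (ka0 _))//.
      rewrite /vi -powRrM mulNr mulVf ?gt_eqF// powRN powRr1 ?(ltW v0)//.
      by rewrite -mulrA mulVf ?mulr1// gt_eqF.
  rewrite integral_cst; last exact: cube_measurable S kt.
  by rewrite mE -EFinM lee_fin.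
pose y j x := usum (fun kt => th kt * b kt j x).
have sy j x : usummable (fun kt => th kt * b kt j x).
  apply/usummableP; apply: (@le_lt_trans _ _
    ((ze j * vi x)%:E * \esum_(kt in setT) (th kt)%:E)%E); last first.
    apply: (@le_lt_trans _ _ ((ze j * vi x)%:E * 1)%E);
      last by rewrite mule1 ltry.
    by apply: lee_wpmul2l => //; rewrite lee_fin mulr_ge0 ?vi0// ltW.
  rewrite -esumZ; last 2 first.
  - by rewrite mulr_ge0 ?vi0// ltW.
  - by move=> kt; rewrite lee_fin ltW.
  apply: le_esum => kt _; rewrite -EFinM lee_fin ger0_norm; last first.
    by rewrite mulr_ge0// ltW.
  rewrite mulrC ler_wpM2r ?(ltW (th0 _))// /b.
  rewrite [leLHS](_ : _ = (ze j * vi x) * (ka kt * \1_(cube Q kt) x));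
    last by ring.
  apply: ler_piMr; first by rewrite mulr_ge0 ?vi0// ltW.
  by rewrite mulr_ile1 ?(ltW (ka0 _))// indicE lern1 leq_b1.
have my j : measurable_fun setT (y j).
  apply: measurable_usum => [|kt]; first exact: cubes_countable S.
  exact: measurable_funM.
have ypos : {ae mu, forall x, forall j, 0 < y j x}.
  move: (cubes_cover S) (cube_weight_gt0 S); apply: filterS2 => x [kt Qx] wx j.
  apply: (@usum_gt0 _ _ _ kt) => //.
    by move=> kt'; rewrite mulr_ge0// ltW.
  rewrite mulr_gt0// /b indicE mem_set// mulr1.
  apply: mulr_gt0; first by apply: mulr_gt0.
  by apply: powR_gt0; exact: powR_gt0.
(* A decomposition holds almost everywhere only, so [y] may be replaced by [1]
   on the null set where it is not positive. *)
exists (fun j x => if 0 < y j x then y j x else 1), th; split.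
- move=> j; apply: measurable_fun_ifT => //.
  by apply: measurable_fun_ltr => //; exact: measurable_cst.
- by move=> j x; case: ifP.
split.
  rewrite rrE; apply: poweR_lty; apply: (@le_lt_trans _ _ 1%E);
    last exact: ltry.
  apply: le_trans th1; apply: le_esum => kt _.
  rewrite /= lee_fin gtr0_norm// -[leRHS]powRr1 ?(ltW (th0 _))//.
  by apply: ger_powR; rewrite // th0 thle1.
exists b; split => //.
by move: ypos; apply: filterS => x yx j; rewrite yx; split.
Qed.

End positive_member.

(** * Continuity along multipliers and the density of each coordinate *)

Section functional_on_block_space.
Context (R : realType) d (X : measurableType d) (mu : {measure set X -> \bar R})
  (I : int -> choiceType) (Q : forall k : int, I k -> set X) (w : X -> R)
  (p p' q q' t : R) (r : \bar R) (c : {k : int & I k} -> R).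
Hypothesis S : cube_setting mu Q w p t c.
Hypotheses (p1 : 1 < p) (pp' : p^-1 + p'^-1 = 1).
Hypotheses (q1 : 1 < q) (qq' : q^-1 + q'^-1 = 1) (r1 : (1 < r)%E).
Let K : choiceType := {k : int & I k}.

Local Notation dec :=
  (block_decomposition mu Q w p p' t (hoelder_conjugate r) q').
Local Notation lam_norm l := (lnorm (hoelder_conjugate r) (EFin \o l)).
Local Notation H := (block_space mu Q w p p' t (hoelder_conjugate r) q'
  : set (int -> X -> R^o)).
Local Notation N := (block_norm mu Q w p p' t (hoelder_conjugate r) q').

Lemma lam_normZ (a : R) (l : K -> R) : 0 <= a ->
  lam_norm (fun kt => a * l kt) = (a%:E * lam_norm l)%E.
Proof.
move=> a0; have [rr [-> rr1]] := hoelder_conjugate_ge1_real r1.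
apply: lnormZ_real => //; first exact: lt_le_trans rr1.
by move=> i; rewrite normrM ger0_norm.
Qed.

Lemma lam_norm_ge0 (l : K -> R) : (0 <= lam_norm l)%E.
Proof.
by have [rr [-> rr1]] := hoelder_conjugate_ge1_real r1; exact: poweR_ge0.
Qed.

Lemma dec_scale f l (a : R) : 0 < a -> dec f l ->
  dec (fun j x => a * f j x) (fun kt => a * l kt).
Proof.
move=> a0; apply: (dec_mul S p1 pp' q1 qq' r1 (s := fun _ _ => a)) => //.
by move=> _ _; rewrite gtr0_norm.
Qed.

Lemma block_norm_le f l : dec f l -> (N f <= lam_norm l)%E.
Proof. by move=> df; apply: ereal_inf_lbound; exists l. Qed.

Lemma block_space0 : H (fun _ _ => 0).
Proof.
have [f0 [l0 [mf0 _ df0]]] := exists_positive_member S p1 pp' q1 qq' r1.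
have := dec_measurable_mul S p1 pp' q1 qq' r1 ltr01 (s := fun _ _ => 0)
  (fun _ => measurable_cst _) _ mf0 df0.
rewrite (_ : (fun j x => 0 * f0 j x) = (fun _ _ => 0)); last first.
  by apply/funext => j; apply/funext => x; rewrite mul0r.
by apply => j x; rewrite normr0.
Qed.

Section linear_functional.
Variable J : (int -> X -> R^o) -> R.
Hypothesis linJ : linear_on H J.

Lemma linear_onE (a : R) f h : H f -> H h ->
  J (fun j x => a * f j x + h j x) = a * J f + J h.
Proof. exact: linJ. Qed.

Lemma linear_on0 : J (fun _ _ => 0) = 0.
Proof.
have := linear_onE 1 block_space0 block_space0.
rewrite (_ : (fun j x => 1 * 0 + 0) = (fun _ _ => 0)).
  by move=> e; lra.
by apply/funext => j; apply/funext => x; rewrite mulr0 addr0.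
Qed.

Lemma linear_onZ (a : R) f : H f -> J (fun j x => a * f j x) = a * J f.
Proof.
move=> Hf; have := linear_onE a Hf block_space0; rewrite linear_on0 addr0 => <-.
by congr J; apply/funext => j; apply/funext => x; rewrite addr0.
Qed.

Hypothesis contJ : continuous_on H N J.

(** Continuity at 0 in terms of decompositions: the block norm is an infimum, so exhibiting one
    decomposition with small coefficients is enough. *)
Lemma continuous_on_small (e : R) : 0 < e -> exists2 de : R, 0 < de &
  forall f l, (forall j, measurable_fun setT (f j)) -> dec f l ->
    (lam_norm l < de%:E)%E -> `|J f| < e.
Proof.
move=> /(contJ block_space0)[de de0 h]; exists de => // f l mf df lde.
have Hf : H f by split => //; exists l.
rewrite -[J f]subr0 -linear_on0; apply: (h f Hf).
apply: le_lt_trans lde; rewrite -[leRHS]/(lam_norm l).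
rewrite (_ : (_ - _) = f); first exact: block_norm_le df.
by apply/funext => j; apply/funext => x; exact: subr0.
Qed.

Lemma continuous_on_mul_cvg0 f (s : nat -> int -> X -> R) : H f ->
  (forall n j, measurable_fun setT (s n j)) ->
  (forall n j x, `|s n j x| <= 1) ->
  {ae mu, forall x, forall j, forall e : R, 0 < e ->
     \forall n \near \oo, `|s n j x| < e} ->
  forall e : R, 0 < e ->
    \forall n \near \oo, `|J (fun j x => s n j x * f j x)| < e.
Proof.
move=> [mf [l df]] ms s1 s0 e /continuous_on_small[de de0 h].
have := dec_cvg0 S p1 pp' q1 qq' r1 df ms s1 s0 de0.
apply: filterS => n [l' [dl' l'de]]; apply: (h _ l') => // j.
exact: measurable_funM.
Qed.

Lemma continuous_on_bounded (A : R) : 0 < A -> exists2 C : R, 0 <= C &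
  forall f l, (forall j, measurable_fun setT (f j)) -> dec f l ->
    (lam_norm l < A%:E)%E -> `|J f| <= C.
Proof.
move=> A0; have [de de0 h] := continuous_on_small ltr01.
exists (A / de); first by rewrite divr_ge0// ltW.
move=> f l mf df lA.
have dA0 : 0 < de / A by rewrite divr_gt0.
have Hf : H f by split => //; exists l.
have := h _ _ _ (dec_scale dA0 df).
rewrite lam_normZ; last exact: ltW.
rewrite linear_onZ// normrM gtr0_norm// => H1.
have /ltW : de / A * `|J f| < 1.
  apply: H1 => [j|]; first exact: measurable_funM.
  rewrite [ltRHS](_ : _ = (de / A)%:E * A%:E)%E.
    by rewrite lte_pmul2l// lte_fin.
  by rewrite -EFinM divfK// gt_eqF.
by rewrite mulrAC ler_pdivrMr// mul1r mulrC -ler_pdivlMr.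
Qed.

Section coordinate.
Variables (f0 : int -> X -> R) (j : int).
Hypothesis f0_gt0 : forall i x, 0 < f0 i x.
Hypothesis Hf0 : H f0.

Let bounded (s : X -> R) :=
  measurable_fun setT s /\ exists M : R, forall x, `|s x| <= M.
Let sel (s : X -> R) : int -> X -> R := fun i x => (i == j)%:R * s x * f0 i x.

Lemma block_space_coordinate s : bounded s -> H (sel s).
Proof.
move=> [ms [M sM]]; have [mf0 [l0 df0]] := Hf0.
apply: (@dec_measurable_mul _ _ _ _ _ _ _ _ _ _ _ _ _ _ S p1 pp' q1 qq' r1
  f0 l0 (fun i x => (i == j)%:R * s x) (`|M| + 1)) => //.
  by move=> i; apply: measurable_funM.
move=> i x; rewrite normrM ger0_norm ?ler0n//; apply: (@le_trans _ _ `|s x|).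
  by apply: ler_piMl => //; rewrite lern1 leq_b1.
by apply: le_trans (sM x) _; rewrite ler_wpDr// ler_norm.
Qed.

Lemma coordinate_linear a s s' : bounded s -> bounded s' ->
  J (sel (fun x => a * s x + s' x)) = a * J (sel s) + J (sel s').
Proof.
move=> bs bs'; rewrite -linear_onE; [|exact: block_space_coordinate..].
congr J; apply/funext => i; apply/funext => x; rewrite /sel.
by rewrite mulrDr mulrDl mulrCA !mulrA.
Qed.

Let bounded_indic A : measurable A -> bounded (\1_A).
Proof.
move=> mA; split; first exact: measurable_indic.
by exists 1 => x; rewrite indicE ger0_norm// lern1 leq_b1.
Qed.

(** Used twice for the charge [A |-> J (1_A f0 e_j)]: the tails of a disjoint union give countable
    additivity, and a constant sequence equal to a null set gives absolute continuity. *)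
Lemma coordinate_indic_cvg0 (G : nat -> set X) :
  (forall n, measurable (G n)) ->
  {ae mu, forall x, \forall n \near \oo, ~ G n x} ->
  forall e : R, 0 < e -> \forall n \near \oo, `|J (sel (\1_(G n)))| < e.
Proof.
move=> mG Gx e e0.
pose s n (i : int) x : R := (i == j)%:R * \1_(G n) x.
apply: (@continuous_on_mul_cvg0 f0 s Hf0 _ _ _ e e0).
- by move=> n i; apply: measurable_funM => //; exact: measurable_indic.
- move=> n i x; rewrite /s indicE normrM !ger0_norm ?ler0n//.
  by rewrite mulr_ile1// lern1 leq_b1.
move: Gx; apply: filterS => x Gx i e1 e10; move: Gx; apply: filterS => n Gn.
by rewrite /s indicE memNset// mulr0 normr0.
Qed.

Lemma coordinate_density : exists g : X -> R,
  [/\ measurable_fun setT g, mu.-integrable setT (fun x => (g x * f0 j x)%:E) &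
   forall A, measurable A ->
     ((J (sel (\1_A)))%:E = \int[mu]_(x in A) (g x * f0 j x)%:E)%E].
Proof.
pose nu A := (J (sel (\1_A)))%:E.
have nu0 : nu set0 = 0%E.
  rewrite /nu indic0; congr _%:E; rewrite -[RHS]linear_on0; congr J.
  by apply/funext => i; apply/funext => x; rewrite /sel mulr0 mul0r.
have nufin A : measurable A -> nu A \is a fin_num by [].
have nusig : semi_sigma_additive nu.
  move=> F mF tF mUF; rewrite /nu.
  (* The value of [J] on the tail [G n] is exactly the defect of the [n]-th partial sum. *)
  pose G n := \bigcup_i F i `\` \big[setU/set0]_(i < n) F i.
  have mB n : measurable (\big[setU/set0]_(i < n) F i).
    exact: bigsetU_measurable.
  have mG n : measurable (G n) by exact: measurableD.
  have E n : (\sum_(0 <= i < n) (J (sel (\1_(F i))))%:E)%E =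
      (J (sel (\1_(\bigcup_i F i))) - J (sel (\1_(G n))))%:E.
    elim: n => [|n IH]; first by rewrite big_nil /G big_ord0 setD0 subrr.
    rewrite big_nat_recr//= IH -EFinD; congr _%:E.
    have -> : J (sel (\1_(G n))) = J (sel (\1_(F n))) + J (sel (\1_(G n.+1))).
      rewrite -[X in _ = X + _]mul1r -coordinate_linear;
        [|exact: bounded_indic..].
      congr (J (sel _)); apply/funext => x; rewrite mul1r !indicE.
      have [Fx|Fx] := pselect (F n x).
        rewrite (mem_set Fx) mem_set; last first.
          split; first by exists n.
          rewrite -bigcup_mkord => -[k /= kn Fkx].
          have kE : k = n by apply: tF => //; exists x.
          by rewrite kE ltnn in kn.
        rewrite memNset ?addr0// => -[_]; apply.
        by rewrite big_ord_recr/=; right.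
      rewrite (memNset Fx) add0r; congr (_%:R); congr nat_of_bool.
      rewrite /G big_ord_recr/= !in_setD in_setU (memNset Fx).
      by rewrite orbF.
    by ring.
  apply/fine_cvgP; split; first by apply: nearW => n; rewrite E.
  apply/cvgrPdist_lt => e e0.
  have Gx : {ae mu, forall x, \forall n \near \oo, ~ G n x}.
    apply: aeW => x.
    have [[k _ Fkx]|nU] := pselect ((\bigcup_i F i) x); last first.
      by apply: nearW => n [].
    exists k.+1 => // n /= kn [_]; apply.
    by rewrite -bigcup_mkord; exists k.
  have := coordinate_indic_cvg0 mG Gx e0; apply: filterS => n.
  by rewrite /= E /= opprB addrC subrK.
pose nuc : {charge set X -> \bar R} :=
  HB.pack nu (isCharge.Build _ X R nu nu0 nufin nusig).
pose mus : {sigma_finite_measure set X -> \bar R} :=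
  HB.pack (Measure.sort mu)
    (isSFinite.Build _ _ _ mu (sfinite_measure_sigma_finite (cube_sigma_finite
      S)))
    (isSigmaFinite.Build _ _ _ mu (cube_sigma_finite S)).
have numu : nuc `<< mus.
  apply/null_content_dominatesP => A mA muA0.
  suff : J (sel (\1_A)) = 0 by rewrite /= /nu => ->.
  apply/eqP; rewrite -normr_eq0 eq_le normr_ge0 andbT.
  apply/ler_addgt0Pr => e e0; rewrite add0r.
  have /(_ _ e e0) := @coordinate_indic_cvg0 (fun _ => A) (fun _ => mA).
  have h : {ae mu, forall x, \forall n \near \oo, ~ A x}.
    exists A; split => // x /= nA; apply: contrapT => Ax; apply: nA.
    exact: nearW.
  by move=> /(_ h)[n _ /(_ n (leqnn n))] /ltW.
pose G := Radon_Nikodym nuc mus.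
have Gfin x : G x \is a fin_num by exact: Radon_Nikodym_fin_num.
have Gint : mu.-integrable setT G by exact: (Radon_Nikodym_integrable numu).
have [mf0 _] := Hf0.
have gE x : fine (G x) / f0 j x * f0 j x = fine (G x).
  by rewrite divfK// gt_eqF.
exists (fun x => fine (G x) / f0 j x); split.
- apply: measurable_funM.
    apply: (measurableT_comp (@fine_measurable R setT measurableT)).
    by case/integrableP : Gint.
  have -> : (fun x => (f0 j x)^-1) = (fun x => f0 j x `^ -1).
    by apply/funext => x; rewrite powR_inv1// ltW.
  exact: (measurableT_comp (@measurable_powR R _)).
- rewrite (_ : (fun x => _) = G)//.
  by apply/funext => x; rewrite gE fineK.
- move=> A mA; transitivity (\int[mu]_(x in A) G x)%E.
    exact: (Radon_Nikodym_integral numu mA).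
  by apply: eq_integral => x _; rewrite gE fineK.
Qed.

End coordinate.

End linear_functional.

End functional_on_block_space.

(** * Representation on dominated sequences with finitely many coordinates *)

Section representation.
Context (R : realType) d (X : measurableType d) (mu : {measure set X -> \bar R})
  (I : int -> choiceType) (Q : forall k : int, I k -> set X) (w : X -> R)
  (p p' q q' t : R) (r : \bar R) (c : {k : int & I k} -> R).
Hypothesis S : cube_setting mu Q w p t c.
Hypotheses (p1 : 1 < p) (pp' : p^-1 + p'^-1 = 1).
Hypotheses (q1 : 1 < q) (qq' : q^-1 + q'^-1 = 1) (r1 : (1 < r)%E).
Let K : choiceType := {k : int & I k}.

Local Notation dec :=
  (block_decomposition mu Q w p p' t (hoelder_conjugate r) q').
Local Notation lam_norm l := (lnorm (hoelder_conjugate r) (EFin \o l)).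
Local Notation H := (block_space mu Q w p p' t (hoelder_conjugate r) q'
  : set (int -> X -> R^o)).
Local Notation N := (block_norm mu Q w p p' t (hoelder_conjugate r) q').

Variable J : (int -> X -> R^o) -> R.
Hypotheses (linJ : linear_on H J) (contJ : continuous_on H N J).
Variable f0 : int -> X -> R.
Hypothesis f0_gt0 : forall i x, 0 < f0 i x.
Hypothesis Hf0 : H f0.

Let bounded (s : X -> R) :=
  measurable_fun setT s /\ exists M : R, forall x, `|s x| <= M.
Let sel (j : int) (s : X -> R) : int -> X -> R := fun i x => (i == j)%:R * s x
  * f0 i x.

Section one_coordinate.
Variables (j : int) (g : X -> R).
Hypothesis mg : measurable_fun setT g.
Hypothesis ig : mu.-integrable setT (fun x => (g x * f0 j x)%:E).
Hypothesis Jg : forall A, measurable A ->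
  ((J (sel j (\1_A)))%:E = \int[mu]_(x in A) (g x * f0 j x)%:E)%E.

Lemma integrable_bounded_mul s : bounded s ->
  mu.-integrable setT (fun x => (s x * (g x * f0 j x))%:E).
Proof.
move=> [ms [M sM]]; case/integrableP : (ig) => mgf fingf.
apply: (@le_integrable _ _ _ mu _ measurableT _
  (fun x => (M * (g x * f0 j x))%:E)).
- apply/measurable_EFinP; apply: measurable_funM => //.
  exact/measurable_EFinP.
- move=> x _ /=; rewrite lee_fin !(normrM, normr_id) ler_wpM2r//.
  exact: le_trans (sM x) (ler_norm _).
- under eq_fun do rewrite EFinM; exact: integrableZl.
Qed.

(** The difference [D] of the two sides vanishes on indicators by the choice of [g]. To reach
    bounded functions, [binary_expansion_vanish] asks only for linearity and for one bound on the
    functions of modulus at most 1. *)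
Lemma coordinate_representation s : bounded s ->
  J (sel j s) = \int[mu]_x (s x * (g x * f0 j x)).
Proof.
move=> bs; have [mf0 [l0 df0]] := Hf0.
have l0fin : lam_norm l0 \is a fin_num.
  rewrite ge0_fin_numE; last exact: lam_norm_ge0.
  by case: df0.
have [C C0 JC] := continuous_on_bounded S p1 pp' q1 qq' r1 linJ contJ
  (ltr_wpDl (fine_ge0 (lam_norm_ge0 r1 l0)) ltr01 : 0 < fine (lam_norm l0) + 1).
pose D s := J (sel j s) - \int[mu]_x (s x * (g x * f0 j x)).
suff D0 : D s = 0 by apply/eqP; rewrite -subr_eq0 -/(D s) D0.
have b1 A : measurable A -> bounded (\1_A).
  move=> mA; split; first exact: measurable_indic.
  by exists 1 => x; rewrite indicE ger0_norm// lern1 leq_b1.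
(* [C] bounds the values of [J], since the multiplier [s] leaves the coefficients [l0] of [f0]
   admissible; the second term is the L^1 norm of [g * f0 j]. *)
apply: (@binary_expansion_vanish _ _ _ D
  (C + fine (\int[mu]_x `|(g x * f0 j x)%:E|)%E)) => //.
- move=> a s1 s2 bs1 bs2; rewrite /D.
  rewrite (coordinate_linear S p1 pp' q1 qq' r1 linJ j Hf0)//.
  have i1 := integrable_bounded_mul bs1; have i2 := integrable_bounded_mul bs2.
  have -> : \int[mu]_x ((a * s1 x + s2 x) * (g x * f0 j x)) =
     a * \int[mu]_x (s1 x * (g x * f0 j x)) + \int[mu]_x (s2 x * (g x * f0 j
       x)).
    rewrite -RintegralZl// -RintegralD//; last first.
      exact: (integrableZl measurableT a i1).
    by apply: eq_Rintegral => x _; ring.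
  by rewrite /sel; ring.
- move=> A mA; rewrite /D; apply/eqP; rewrite subr_eq0; apply/eqP.
  apply: EFin_inj; rewrite Jg// /Rintegral fineK; last first.
    exact: integrable_fin_num (integrable_bounded_mul (b1 A mA)).
  rewrite integral_mkcond; apply: eq_integral => x _.
  by rewrite patchE indicE; case: ifP => _; rewrite ?mul1r ?mul0r.
move=> s1 ms1 s11.
have bs1 : bounded s1 by split => //; exists 1.
apply: le_trans (ler_normB _ _) _; apply: lerD.
  apply: (JC _ (fun kt => 1 * l0 kt)).
  - by have [h _] := block_space_coordinate S p1 pp' q1 qq' r1 j Hf0 bs1;
      exact: h.
  - apply: (dec_mul S p1 pp' q1 qq' r1 ltr01 (s := fun i x => (i == j)%:R * s1
      x)).
    + by move=> i; apply: measurable_funM.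
    + move=> i x; rewrite normrM ger0_norm ?ler0n// mulr_ile1// lern1 leq_b1//.
    + exact: df0.
  - rewrite lam_normZ// mul1e -[ltLHS](fineK l0fin) lte_fin.
    by rewrite ltrDl.
have i1 := integrable_bounded_mul bs1.
have fi : (\int[mu]_x `|(g x * f0 j x)%:E|)%E \is a fin_num.
  by apply: integrable_fin_num => //; exact: integrable_abse.
rewrite -lee_fin fineK// /Rintegral -abse_EFin fineK; last first.
  exact: integrable_fin_num i1.
apply: (@le_trans _ _ (\int[mu]_x `|(s1 x * (g x * f0 j x))%:E|)%E).
  by apply: le_abse_integral => //; case/integrableP : i1.
apply: ge0_le_integral => //.
- by apply: measurableT_comp => //; case/integrableP : i1.
- by apply: measurableT_comp => //; case/integrableP : ig.
- by move=> x _; rewrite !abse_EFin lee_fin normrM ler_piMl.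
Qed.

End one_coordinate.

Variable g : int -> X -> R.
Hypothesis mg : forall j, measurable_fun setT (g j).
Hypothesis ig : forall j, mu.-integrable setT (fun x => (g j x * f0 j x)%:E).
Hypothesis Jg : forall j A, measurable A ->
  ((J (sel j (\1_A)))%:E = \int[mu]_(x in A) (g j x * f0 j x)%:E)%E.

(** Induction on [l] splits off one coordinate at a time. A single coordinate is [s * f0 j] with
    [s = f j / f0 j] bounded by [M], which is the case of [coordinate_representation]. *)
Lemma finite_representation (l : seq int) (M : R) (f : int -> X -> R) :
  (forall j, measurable_fun setT (f j)) ->
  (forall j x, `|f j x| <= M * f0 j x) ->
  (forall j x, j \notin l -> f j x = 0) ->
  [/\ H f, Jfun_defined mu g f & J f = Jfun mu g f].
Proof.
move=> mf fM fl; have [mf0 [l0 df0]] := Hf0.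
have mV j : measurable_fun setT (fun x => (f0 j x)^-1).
  have -> : (fun x => (f0 j x)^-1) = (fun x => f0 j x `^ -1).
    by apply/funext => x; rewrite powR_inv1// ltW.
  exact: (measurableT_comp (@measurable_powR R _)).
have fs0 j x : `|f j x / f0 j x| <= M.
  by rewrite normrM normfV (gtr0_norm (f0_gt0 _ _)) ler_pdivrMr.
have Hf : H f.
  have -> : f = (fun j x => f j x / f0 j x * f0 j x).
    by apply/funext => j; apply/funext => x; rewrite divfK// gt_eqF.
  apply: (dec_measurable_mul S p1 pp' q1 qq' r1 (M := `|M| + 1)
    (s := fun j x => f j x / f0 j x) _ _ _ mf0 df0).
  - by rewrite ltr_wpDl.
  - by move=> j; exact: measurable_funM.
  - by move=> j x; apply: le_trans (fs0 j x) _; rewrite ler_wpDr// ler_norm.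
suff [? ?] : Jfun_defined mu g f /\ J f = Jfun mu g f by split.
elim: l f mf fM fl fs0 Hf => [|j l IH] f mf fM fl fs0 Hf.
  have -> : f = (fun _ _ => 0).
    by apply/funext => i; apply/funext => x; rewrite fl.
  have mp x : pairing g (fun _ _ => 0) x = 0.
    by rewrite /pairing (@usum_finsupp _ _ [::])// ?big_nil// => i;
      rewrite mul0r.
  split.
    split; first by apply: aeW => x;
      apply: (@usummable_finsupp _ _ [::]) => // i _; rewrite mul0r.
    rewrite (_ : EFin \o _ = cst 0%E); first exact: integrable0.
    by apply/funext => x /=; rewrite mp.
  rewrite (linear_on0 S p1 pp' q1 qq' r1 linJ) /Jfun.
  rewrite (@eq_Rintegral _ _ _ mu setT (fun _ => 0)) => [|x _];
    last by rewrite mp.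
  by rewrite Rintegral_cst// mul0r.
pose s x := f j x / f0 j x.
have bs : bounded s.
  by split; [exact: measurable_funM|exists M => x; exact: fs0].
pose f1 := sel j s.
have f1j x : f1 j x = f j x.
  by rewrite /f1 /sel eqxx mul1r /s divfK// gt_eqF.
have f1i i x : i != j -> f1 i x = 0.
  by move=> /negPf ij; rewrite /f1 /sel ij !mul0r.
have Hf1 : H f1 := block_space_coordinate S p1 pp' q1 qq' r1 j Hf0 bs.
have mf1 : forall i, measurable_fun setT (f1 i) by case: Hf1.
have supp1 x : forall i, i \notin [:: j] -> f1 i x * g i x = 0.
  by move=> i; rewrite inE => /f1i ->; rewrite mul0r.
have pE x : pairing g f1 x = s x * (g j x * f0 j x).
  rewrite /pairing (usum_finsupp (l := [:: j]) isT (supp1 x)) big_seq1 /f1 /sel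
    eqxx.
  by rewrite mul1r -!mulrA (mulrC (f0 j x)).
have Jf1 : Jfun_defined mu g f1.
  split; first by apply: aeW => x;
    apply: (@usummable_finsupp _ _ [:: j]) => // i; exact: supp1.
  rewrite (_ : EFin \o _ = (fun x => (s x * (g j x * f0 j x))%:E)).
    exact: integrable_bounded_mul.
  by apply/funext => x /=; rewrite pE.
pose f2 i x := (i != j)%:R * f i x.
have mf2 i : measurable_fun setT (f2 i) by exact: measurable_funM.
have f2M i x : `|f2 i x| <= `|f i x|.
  rewrite normrM ger0_norm ?ler0n//.
  by apply: ler_piMl => //; rewrite lern1 leq_b1.
have Hf2 : H f2.
  have [_ [l1 df1]] := Hf.
  apply: (dec_measurable_mul S p1 pp' q1 qq' r1 ltr01
    (s := fun i _ => (i != j)%:R) _ _ mf df1) => // i x.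
  by rewrite ger0_norm ?ler0n// lern1 leq_b1.
have [Jf2 Jf2E] : Jfun_defined mu g f2 /\ J f2 = Jfun mu g f2.
  apply: IH => // [i x|i x il|i x].
  - exact: le_trans (f2M i x) (fM i x).
  - rewrite /f2; have [->|ij] := eqVneq i j; first by rewrite mul0r.
    by rewrite fl ?mulr0// inE negb_or ij.
  - apply: le_trans (fs0 i x); rewrite ![`|_ / _|]normrM.
    by apply: ler_wpM2r => //; exact: (f2M i x).
have fE : f = (fun i x => 1 * f1 i x + f2 i x).
  apply/funext => i; apply/funext => x; rewrite mul1r /f2.
  have [->|ij] := eqVneq i j; first by rewrite f1j mul0r addr0.
  by rewrite f1i// mul1r add0r.
have [Jf JfE] := Jfun_linear 1 mf1 mf2 mg Jf1 Jf2.
rewrite fE; split => //.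
rewrite (linear_onE linJ 1 Hf1 Hf2) Jf2E JfE; congr (_ * _ + _).
rewrite (coordinate_representation (ig j) (Jg j) bs) /Jfun.
by apply: eq_Rintegral => x _; rewrite pE.
Qed.

End representation.

(** * The Morrey norm of the representing sequence *)

Section suprema.
Local Open Scope ereal_scope.
Context (R : realType).
Implicit Types (a : nat -> \bar R).

Lemma ereal_sup_poweR a (s : R) : (0 < s)%R -> (forall n, 0 <= a n) ->
  ereal_sup (range (fun n => a n `^ s)) = ereal_sup (range a) `^ s.
Proof.
move=> s0 a0; have aS n : a n <= ereal_sup (range a).
  by apply: ereal_sup_ubound; exists n.
have aT n : a n `^ s <= ereal_sup (range (fun n => a n `^ s)).
  by apply: ereal_sup_ubound; exists n.
have S0 : 0 <= ereal_sup (range a) by exact: le_trans (a0 0%N) (aS 0%N).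
have T0 : 0 <= ereal_sup (range (fun n => a n `^ s)).
  exact: le_trans (poweR_ge0 _ _) (aT 0%N).
apply/eqP; rewrite eq_le; apply/andP; split.
  by apply: ge_ereal_sup => _ [n _ <-]; apply: le_poweR => //; exact: ltW.
rewrite -[leRHS](@poweRK _ _ s)//; apply: le_poweR => //; first exact: ltW.
apply: ge_ereal_sup => _ [n _ <-]; rewrite -[leLHS](@poweRVK _ _ s)//.
by apply: le_poweR; rewrite ?invr_ge0 ?(ltW s0) ?poweR_ge0.
Qed.

Lemma ereal_supZ a (c : R) : (0 <= c)%R -> (forall n, 0 <= a n) ->
  ereal_sup (range (fun n => c%:E * a n)) = c%:E * ereal_sup (range a).
Proof.
rewrite le_eqVlt => /predU1P[<- a0|c0 a0].
  rewrite mul0e; apply/eqP; rewrite eq_le; apply/andP; split.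
    by apply: ge_ereal_sup => _ [n _ <-]; rewrite mul0e.
  by apply: ereal_sup_ubound; exists 0%N; rewrite ?mul0e.
apply/eqP; rewrite eq_le; apply/andP; split.
  apply: ge_ereal_sup => _ [n _ <-]; apply: lee_wpmul2l;
    first by rewrite lee_fin ltW.
  by apply: ereal_sup_ubound; exists n.
rewrite -lee_pdivlMl//; apply: ge_ereal_sup => _ [n _ <-].
by rewrite lee_pdivlMl//; apply: ereal_sup_ubound; exists n.
Qed.

Lemma sum_ereal_sup_le (T : choiceType) (l : seq T) (y : T -> nat -> \bar R)
    (B : \bar R) : (forall i n, 0 <= y i n) ->
  (forall i m n, (m <= n)%N -> y i m <= y i n) ->
  (forall n, \sum_(i <- l) y i n <= B) ->
  \sum_(i <- l) ereal_sup (range (y i)) <= B.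
Proof.
move=> y0 ym yB.
have cv i : y i n @[n --> \oo] --> ereal_sup (range (y i)).
  by apply: ereal_nondecreasing_cvgn => m n; exact: ym.
have ynneg i : 0 <= ereal_sup (range (y i)).
  by apply: le_trans (y0 i 0%N) _; apply: ereal_sup_ubound; exists 0%N.
have cvs : \sum_(i <- l) y i n @[n --> \oo] --> \sum_(i <- l) ereal_sup (range
  (y i)).
  elim: l {yB} => [|i l IH].
    rewrite big_nil (_ : (fun _ => _) = cst 0); first exact: cvg_cst.
    by apply/funext => n; rewrite big_nil.
  rewrite big_cons (_ : (fun _ => _) = (fun n => y i n + \sum_(i <- l) y i n)).
    apply: cvgeD => //; apply: ge0_adde_def; rewrite inE//.
    exact: sume_ge0.
  by apply/funext => n; rewrite big_cons.
rewrite -(cvg_lim _ cvs)//; apply: lime_le; first by apply/cvg_ex; eexists;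
  exact: cvs.
exact: nearW.
Qed.

(** Monotone convergence for the counting measure, obtained on finite subfamilies, where limits and
    sums commute. *)
Lemma esum_ereal_sup (T : choiceType) (y : T -> nat -> \bar R) :
  (forall i n, 0 <= y i n) ->
  (forall i m n, (m <= n)%N -> y i m <= y i n) ->
  \esum_(i in setT) ereal_sup (range (y i)) =
  ereal_sup (range (fun n => \esum_(i in setT) y i n)).
Proof.
move=> y0 ym; apply/eqP; rewrite eq_le; apply/andP; split.
  apply: esum_leP => l ul; apply: sum_ereal_sup_le => // n.
  apply: le_trans (sum_le_esum ul (fun i => y0 i n)) _.
  by apply: ereal_sup_ubound; exists n.
apply: ge_ereal_sup => _ [n _ <-]; apply: le_esum => i _.
by apply: ereal_sup_ubound; exists n.
Qed.

Lemma integral_ereal_sup d (X : measurableType d)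
    (mu : {measure set X -> \bar R}) (A : set X) (f : nat -> X -> \bar R) :
  measurable A -> (forall n, measurable_fun A (f n)) ->
  (forall n x, 0 <= f n x) ->
  (forall x m n, (m <= n)%N -> f m x <= f n x) ->
  \int[mu]_(x in A) ereal_sup (range (f ^~ x)) =
  ereal_sup (range (fun n => \int[mu]_(x in A) f n x)).
Proof.
move=> mA mf f0 fm.
have ndf : nondecreasing_seq (fun n => \int[mu]_(x in A) f n x).
  by move=> m n mn; apply: ge0_le_integral => // x _; exact: fm.
rewrite -(cvg_lim _ (ereal_nondecreasing_cvgn ndf))//.
rewrite -monotone_convergence//; last by move=> x _ m n; exact: fm.
apply: eq_integral => x _; apply/esym/cvg_lim => //.
by apply: ereal_nondecreasing_cvgn => m n; exact: fm.
Qed.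

(* Tested on the extremal sequence [y ^ (r - 1)], restricted to a finite set
   and normalized. *)
Lemma lnorm_converse (T : choiceType) (r : \bar R) (y : T -> R) (D : R) :
  1 < r -> (0 <= D)%R -> (forall i, 0 <= y i)%R ->
  (forall (l : seq T) (a : T -> R), uniq l -> (forall i, 0 <= a i)%R ->
     (forall i, i \notin l -> a i = 0%R) ->
     lnorm (hoelder_conjugate r) (EFin \o a) <= 1 ->
     (\sum_(i <- l) a i * y i <= D)%R) ->
  lnorm r (EFin \o y) <= D%:E.
Proof.
move=> r1 D0 y0 h; case: r r1 h => [r|_ h|//]; last first.
  apply: ge_ereal_sup => _ [i _ <-] /=; rewrite ger0_norm// lee_fin.
  have := h [:: i] (fun j => (j == i)%:R)%R isT.
  rewrite big_seq1 eqxx mul1r; apply.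
  - by move=> j; rewrite ler0n.
  - by move=> j; rewrite inE => /negPf ->.
  rewrite hoelder_conjugatey /= invr1 poweRe1; last first.
    by apply: esum_ge0 => j _; rewrite lee_fin powR_ge0.
  rewrite (@esum_finsupp _ _ [:: i])//.
  + by rewrite big_seq1 /= eqxx normr1 powR1.
  + by move=> j; rewrite inE => /negPf /= ->; rewrite normr0 powR0.
rewrite lte_fin => r1; have [r' [-> r'1 rr']] := hoelder_conjugate_real r1.
move=> h; have r0 : (0 < r)%R by exact: lt_trans r1.
have r'0 : (0 < r')%R by exact: lt_trans r'1.
rewrite /lnorm le_poweRV//; last first.
  by apply: esum_ge0 => i _; exact: poweR_ge0.
apply: esum_leP => l ul.
under eq_bigr do rewrite /= ger0_norm//.
rewrite sumEFin poweR_EFin lee_fin.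
set s := (\sum_(i <- l) y i `^ r)%R.
have s0 : (0 <= s)%R by apply: sumr_ge0 => i _; exact: powR_ge0.
have [->|sn] := eqVneq s 0%R; first exact: powR_ge0.
have {sn}s0 : (0 < s)%R by rewrite lt_neqAle eq_sym sn.
pose a i := (if i \in l then y i `^ (r - 1) / s `^ r'^-1 else 0)%R.
have a0 i : (0 <= a i)%R.
  by rewrite /a; case: ifP => // _; rewrite divr_ge0 ?powR_ge0.
have rr'E : ((r - 1) * r' = r)%R.
  have : (r'^-1 = 1 - r^-1)%R by rewrite -rr' addrC addKr.
  move=> e; have -> : (r - 1 = r * r'^-1)%R.
    by rewrite e mulrBr mulr1 divff// gt_eqF.
  by rewrite divfK// gt_eqF.
have al i : i \notin l -> a i = 0%R by move=> /negPf il; rewrite /a il.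
have := h l a ul a0 al.
have -> : (\sum_(i <- l) a i * y i = s / s `^ r'^-1)%R.
  rewrite /s big_distrl/= big_seq [RHS]big_seq; apply: eq_bigr => i il.
  rewrite /a il mulrAC; congr (_ / _)%R.
  have [->|yn] := eqVneq (y i) 0%R; first by rewrite mulr0 powR0// gt_eqF.
  rewrite -[X in (_ * X)%R]powRr1// -powRD ?subrK//.
  by apply/implyP.
have -> : (s / s `^ r'^-1 = s `^ r^-1)%R.
  rewrite -powRN -[X in (X * _)%R]powRr1 ?(ltW s0)// -powRD; last first.
    by apply/implyP => _; rewrite gt_eqF.
  by congr (_ `^ _)%R; rewrite -rr' addrK.
move=> H; have {}H : (s `^ r^-1 <= D)%R.
  apply: H; rewrite /= (@esum_finsupp _ _ l)//; last first.
    by move=> i /al /= ->; rewrite normr0 powR0// gt_eqF.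
  rewrite (_ : \sum_(i <- l) _ = 1) ?poweR1r//.
  under eq_bigr do rewrite /= ger0_norm//.
  rewrite sumEFin; congr _%:E.
  rewrite (eq_big_seq (fun i => y i `^ r / s)%R); last first.
    move=> i il; rewrite /a il powR_div ?powR_ge0 ?powR_gt0//.
    by rewrite -!powRrM rr'E mulVf ?gt_eqF// powRr1// ltW.
  by rewrite -mulr_suml divff// gt_eqF.
have -> : s = ((s `^ r^-1) `^ r)%R.
  by rewrite -powRrM mulVf ?gt_eqF// powRr1// ltW.
by apply: ge0_ler_powR; rewrite ?nnegrE ?powR_ge0 ?(ltW r0).
Qed.

(** Removes a truncation: every operation in the Morrey norm (integral, power, constant factor, sum
    or supremum over the cubes) commutes with increasing suprema of nonnegative functions. It is
    applied first to the level sets and then to the coordinates. *)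
Lemma lnorm_density_sup d (X : measurableType d)
    (mu : {measure set X -> \bar R}) (T : choiceType) (E : T -> set X)
    (c : T -> R) (p : R) (r : \bar R) (f : nat -> X -> \bar R) (B : R) :
  (0 < p)%R -> 1 < r -> (0 <= B)%R ->
  (forall i, measurable (E i)) -> (forall i, 0 < c i)%R ->
  (forall n, measurable_fun setT (f n)) -> (forall n x, 0 <= f n x) ->
  (forall x m n, (m <= n)%N -> f m x <= f n x) ->
  (forall n, lnorm r (fun i =>
     (c i)%:E * (\int[mu]_(x in E i) f n x) `^ p^-1) <= B%:E) ->
  lnorm r (fun i => (c i)%:E *
    (\int[mu]_(x in E i) ereal_sup (range (f ^~ x))) `^ p^-1) <= B%:E.
Proof.
move=> p0 r1 B0 mE c0 mf f0 fm fB.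
pose y i n := (c i)%:E * (\int[mu]_(x in E i) f n x) `^ p^-1.
have y0 i n : 0 <= y i n by rewrite mule_ge0 ?poweR_ge0// lee_fin ltW.
have int0 i n : 0 <= \int[mu]_(x in E i) f n x by exact: integral_ge0.
have mfE i n : measurable_fun (E i) (f n) by exact: measurable_funTS.
have yS i : (c i)%:E * (\int[mu]_(x in E i) ereal_sup (range (f ^~ x))) `^ p^-1
    = ereal_sup (range (y i)).
  rewrite integral_ereal_sup// -ereal_sup_poweR ?invr_gt0//.
  by rewrite -ereal_supZ ?(ltW (c0 i))// => n; exact: poweR_ge0.
have ym i m n : (m <= n)%N -> y i m <= y i n.
  move=> mn; apply: lee_wpmul2l; first by rewrite lee_fin ltW.
  apply: le_poweR => //; first by rewrite invr_ge0 ltW.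
  by apply: ge0_le_integral => // x _; exact: fm.
under [X in lnorm r X]eq_fun do rewrite yS.
have yS0 i : 0 <= ereal_sup (range (y i)).
  by apply: le_trans (y0 i 0%N) _; apply: ereal_sup_ubound; exists 0%N.
case: r r1 fB => [r|_ fB|//]; last first.
  apply: ge_ereal_sup => _ [i _ <-] /=; rewrite gee0_abs//.
  apply: ge_ereal_sup => _ [n _ <-]; apply: le_trans (fB n) => /=.
  by apply: ereal_sup_ubound; exists i => //=; rewrite gee0_abs// y0.
rewrite lte_fin => r1 fB; have r0 : (0 < r)%R by exact: lt_trans r1.
rewrite /lnorm le_poweRV//; last first.
  by apply: esum_ge0 => i _; exact: poweR_ge0.
have -> : \esum_(i in [set: T]) `|ereal_sup (range (y i))| `^ r =
    \esum_(i in [set: T]) ereal_sup (range (fun n => y i n `^ r)).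
  by apply: eq_esum => i _; rewrite gee0_abs// ereal_sup_poweR.
rewrite esum_ereal_sup; last 2 first.
- by move=> i n; exact: poweR_ge0.
- by move=> i m n mn; apply: le_poweR; [exact: ltW|exact: y0|exact: ym].
apply: ge_ereal_sup => _ [n _ <-]; rewrite -le_poweRV//; last first.
  by apply: esum_ge0 => i _; exact: poweR_ge0.
apply: le_trans (fB n); rewrite /lnorm; apply: le_poweR.
- by rewrite invr_ge0 ltW.
- by apply: esum_ge0 => i _; exact: poweR_ge0.
by apply: le_esum => i _; rewrite gee0_abs//; exact: y0.
Qed.

End suprema.

(** The integers from [-n] to [n - 1], an increasing exhaustion along which the coordinates are
    truncated. *)
Definition int_range (n : nat) : seq int :=
  map Posz (iota 0 n) ++ map Negz (iota 0 n).

Lemma mem_int_range n j :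
  (j \in int_range n) = (match j with Posz k => k | Negz k => k end < n)%N.
Proof.
rewrite /int_range mem_cat; apply/orP/idP => [[] /mapP[k]|].
- by rewrite mem_iota add0n => kn ->.
- by rewrite mem_iota add0n => kn ->.
case: j => k kn; [left|right]; apply/mapP; exists k => //;
  rewrite mem_iota add0n.
- exact: kn.
- exact: kn.
Qed.

Lemma int_range_uniq n : uniq (int_range n).
Proof.
rewrite /int_range cat_uniq !map_inj_uniq ?iota_uniq//=; last 2 first.
- by move=> a b [].
- by move=> a b [].
by rewrite andbT; apply/hasPn => j /mapP[k _ ->]; apply/mapP => -[].
Qed.

(** * Testing on truncated extremal sequences *)

Section norm_estimate.
Context (R : realType) d (X : measurableType d) (mu : {measure set X -> \bar R})
  (I : int -> choiceType) (Q : forall k : int, I k -> set X) (w : X -> R)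
  (p p' q q' t : R) (r : \bar R) (c : {k : int & I k} -> R).
Hypothesis S : cube_setting mu Q w p t c.
Hypotheses (p1 : 1 < p) (pp' : p^-1 + p'^-1 = 1).
Hypotheses (q1 : 1 < q) (qq' : q^-1 + q'^-1 = 1) (r1 : (1 < r)%E).
Let K : choiceType := {k : int & I k}.
Let v := dual_weight p w.
Let p0 : 0 < p. Proof. exact: lt_trans p1. Qed.
Let q0 : 0 < q. Proof. exact: lt_trans q1. Qed.
Let p'0 : 0 < p'. Proof. exact: (lt_trans ltr01 (conjugate_gt1 p1 pp')). Qed.
Let q'0 : 0 < q'. Proof. exact: (lt_trans ltr01 (conjugate_gt1 q1 qq')). Qed.

Local Notation dec :=
  (block_decomposition mu Q w p p' t (hoelder_conjugate r) q').
Local Notation lam_norm l := (lnorm (hoelder_conjugate r) (EFin \o l)).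

Variables (g f0 : int -> X -> R) (D : R).
Hypothesis mg : forall j, measurable_fun setT (g j).
Hypothesis mf0 : forall j, measurable_fun setT (f0 j).
Hypothesis f0_gt0 : forall j x, 0 < f0 j x.
Hypothesis D0 : 0 <= D.

(** The sequences on which [finite_representation] identifies [J] with [Jfun mu g]. The functional
    does not appear in this section; it enters through the bound [D], to be taken as its norm. *)
Let dominated (f : int -> X -> R) := [/\ forall j, measurable_fun setT (f j),
  exists M : R, forall j x, `|f j x| <= M * f0 j x &
  exists l : seq int, forall j x, j \notin l -> f j x = 0].

Hypothesis dominated_defined : forall f, dominated f -> Jfun_defined mu g f.
Hypothesis dominated_le : forall f l, dominated f -> dec f l ->
  (lam_norm l <= 1)%E -> `|Jfun mu g f| <= D.

Lemma conjugate_subr1 (a b : R) : 1 < a -> a^-1 + b^-1 = 1 -> (a - 1) * b = a.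
Proof.
move=> a1 ab; have a0 : 0 < a by exact: lt_trans a1.
have b0 : 0 < b by exact: (lt_trans ltr01 (conjugate_gt1 a1 ab)).
have e : b^-1 = 1 - a^-1 by rewrite -ab addrC addKr.
have -> : a - 1 = a * b^-1 by rewrite e mulrBr mulr1 divff// gt_eqF.
by rewrite divfK// gt_eqF.
Qed.

Section truncation.
Variable L : seq int.
Hypothesis uL : uniq L.

Let gL j x := if j \in L then g j x else 0.
Let sg x := fine (lseq q gL x).
(* [F] is extremal in both Hoelder inequalities: [F . gL = h] pointwise and
   [|F|_q' ^ p' v = h] almost everywhere. The absolute value of [w] makes [h]
   nonnegative everywhere, also on the null set where [w <= 0]. *)
Let F j x := gL j x * `|gL j x| `^ (q - 2) * (sg x `^ (p - q) * `|w x|).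
Let h x := sg x `^ p * `|w x|.

Let mgL j : measurable_fun setT (gL j).
Proof. by rewrite /gL; case: (j \in L). Qed.

Let lseq_fin x : (lseq q gL x = (sg x)%:E)%E.
Proof.
rewrite fineK// ge0_fin_numE ?lseq_ge0//; apply: poweR_lty.
rewrite (@esum_finsupp _ _ L)//.
- by rewrite sumEFin ltry.
- by move=> j; exact: poweR_ge0.
- by move=> j /negPf jL; rewrite /= /gL jL normr0 powR0// gt_eqF.
Qed.

Let sg0 x : 0 <= sg x. Proof. by rewrite -lee_fin -lseq_fin lseq_ge0. Qed.

Let msg : measurable_fun setT sg.
Proof.
apply: (measurableT_comp (@fine_measurable R setT measurableT)).
exact: measurable_lseq.
Qed.

Let maw : measurable_fun setT (fun x => `|w x|).
Proof. by apply: measurableT_comp => //; exact: cube_weight_measurable S. Qed.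

Let mF j : measurable_fun setT (F j).
Proof.
have mpow (u : X -> R) (e : R) : measurable_fun setT u ->
    measurable_fun setT (fun x => u x `^ e).
  exact: (measurableT_comp (@measurable_powR R _)).
apply: measurable_funM; apply: measurable_funM => //.
  by apply: mpow; exact: measurableT_comp.
exact: mpow.
Qed.

Let mh : measurable_fun setT h.
Proof.
apply: measurable_funM => //.
exact: (measurableT_comp (@measurable_powR R _)).
Qed.

Let h0 x : 0 <= h x. Proof. by rewrite mulr_ge0// powR_ge0. Qed.

Let absF j x : `|F j x| = (sg x `^ (p - q) * `|w x|) * `|gL j x| `^ (q - 1).
Proof.
rewrite normrM mulrC; congr (_ * _).
  by rewrite ger0_norm// mulr_ge0// powR_ge0.
rewrite normrM (ger0_norm (powR_ge0 _ _)).
(* For [q < 2] the exponent [q - 2] in [F] is negative; where [gL] vanishes, its own factor makes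
   the product 0. *)
have [->|gn] := eqVneq (gL j x) 0.
  by rewrite normr0 mul0r powR0// subr_eq0 gt_eqF.
rewrite -[X in X * _]powRr1// -powRD; last by apply/implyP; rewrite normr_eq0.
by congr (_ `^ _); ring.
Qed.

Let FgL j x : F j x * gL j x = (sg x `^ (p - q) * `|w x|) * `|gL j x| `^ q.
Proof.
have [g0|gn] := eqVneq (gL j x) 0.
  by rewrite g0 mulr0 normr0 powR0 ?mulr0// gt_eqF.
have -> : `|gL j x| `^ q = gL j x ^+ 2 * `|gL j x| `^ (q - 2).
  rewrite -real_normK ?num_real// -powR_mulrn// -powRD.
    by congr (_ `^ _); ring.
  by apply/implyP; rewrite normr_eq0.
by rewrite /F; ring.
Qed.

Let sgq x : ((sg x `^ q)%:E = \esum_(j in setT) (`|gL j x| `^ q)%:E)%E.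
Proof. by rewrite -lseq_poweR// lseq_fin. Qed.

(** At the base 0 both sides are 0, even for negative [e], because [b] and [e + b] are nonzero. This
    covers the points where [sg] vanishes. *)
Let powR_sub (a b e : R) : 0 <= a -> b != 0 -> e + b != 0 -> a `^ e * a `^ b =
  a `^ (e + b).
Proof.
move=> a0 b0 eb; have [->|an] := eqVneq a 0.
  by rewrite (powR0 b0) mulr0 powR0.
by rewrite -powRD//; apply/implyP.
Qed.

Let esum_FgL x : (\esum_(j in setT) (F j x * gL j x)%:E = (h x)%:E)%E.
Proof.
under eq_esum do rewrite FgL EFinM.
rewrite esumZ//; last first.
  by rewrite mulr_ge0// powR_ge0.
rewrite -sgq -EFinM mulrAC powR_sub// ?subrK ?gt_eqF//.
Qed.

Let lseq_F x : (lseq q' F x = (sg x `^ (p - 1) * `|w x|)%:E)%E.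
Proof.
rewrite (@lseqZ _ _ q' (fun j x => `|gL j x| `^ (q - 1))%R F x
  (sg x `^ (p - q) * `|w x|))//; last 2 first.
- by rewrite mulr_ge0// powR_ge0.
- by move=> j; rewrite absF (ger0_norm (powR_ge0 _ _)).
have -> : (lseq q' (fun j x => `|gL j x| `^ (q - 1))%R x = (sg x `^ (q -
  1))%:E)%E.
  rewrite lseq_poweRV//.
  under eq_esum do rewrite (ger0_norm (powR_ge0 _ _)) -powRrM conjugate_subr1//.
  rewrite -sgq poweR_EFin -powRrM; congr (_ `^ _)%:E.
  by rewrite -{1}(conjugate_subr1 q1 qq') mulfK// gt_eqF.
rewrite -EFinM mulrAC powR_sub//.
- by congr (_ `^ _ * _)%:E; ring.
- by rewrite subr_eq0 gt_eqF.
- by rewrite (_ : _ + _ = p - 1) ?subr_eq0 ?gt_eqF//; ring.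
Qed.

(** The identity [(p - 1) * p' = p] gives the power of [sg], and the powers of [w] combine to the
    exponent [p' - 1 / (p - 1) = 1]. *)
Let block_density x : 0 < w x -> (lseq q' F x `^ p' * (v x)%:E = (h x)%:E)%E.
Proof.
move=> w0; rewrite lseq_F poweR_EFin -EFinM; congr _%:E.
rewrite powRM ?powR_ge0// -powRrM conjugate_subr1// /h -mulrA; congr (_ * _).
rewrite gtr0_norm// /v /dual_weight -powRD; last first.
  by apply/implyP => _; rewrite gt_eqF.
rewrite [X in w x `^ X](_ : _ = 1) ?powRr1 ?(ltW w0)//.
have e := conjugate_subr1 p1 pp'.
have pn : p - 1 != 0 by rewrite subr_eq0 gt_eqF.
have -> : p' = p / (p - 1) by rewrite -{1}e mulrAC divff ?mul1r.
by field.
Qed.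

Section level.
Variable m : nat.

(** Restricting [F] to this set makes it [dominated], so that the hypotheses on [Jfun] apply to
    it. *)
Let A := [set x | all (fun j => `|F j x| <= m%:R * f0 j x) L].

Lemma measurable_level : measurable A.
Proof.
rewrite /A; elim: (L) => [|j l IH] /=.
  by rewrite (_ : mkset _ = setT)//; apply/seteqP; split.
rewrite (_ : mkset _ = [set x | `|F j x| <= m%:R * f0 j x] `&`
    [set x | all (fun j => `|F j x| <= m%:R * f0 j x) l]).
  apply: measurableI => //.
  pose G x := m%:R * f0 j x - `|F j x|.
  have mG : measurable_fun setT G.
    apply: measurable_funB; first exact: measurable_funM.
    exact: measurableT_comp.
  rewrite (_ : mkset _ = setT `&` G @^-1` `[0, +oo[%classic).
    by apply: mG => //; exact: measurable_itv.
  by apply/seteqP; split => x /=; rewrite in_itv/= andbT /G subr_ge0; tauto.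
by apply/seteqP; split => x /= => [/andP[]//|[-> ->]].
Qed.

Let FA j x := \1_A x * F j x.
Let hA x := \1_A x * h x.

Let mFA j : measurable_fun setT (FA j).
Proof.
by apply: measurable_funM => //; exact: measurable_indic measurable_level.
Qed.

Let mhA : measurable_fun setT hA.
Proof.
by apply: measurable_funM => //; exact: measurable_indic measurable_level.
Qed.

Let hA0 x : 0 <= hA x. Proof. by rewrite mulr_ge0// indicE ler0n. Qed.

Let FA_supp j x : j \notin L -> FA j x = 0.
Proof. by move=> /negPf jL; rewrite /FA /F /gL jL !mul0r mulr0. Qed.

Let FA_le j x : `|FA j x| <= m%:R * f0 j x.
Proof.
have [jL|/FA_supp ->] := boolP (j \in L); last first.
  by rewrite normr0 mulr_ge0// ltW.
rewrite /FA indicE; have [xA|xA] := boolP (x \in A).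
  by rewrite mul1r; move: xA; rewrite inE => /allP/(_ j jL).
by rewrite mul0r normr0 mulr_ge0// ltW.
Qed.

Let dominated_FA : dominated FA.
Proof. by split => //; [exists m%:R|exists L => j x; exact: FA_supp]. Qed.

Let FAg0 j x : 0 <= FA j x * g j x.
Proof.
have [jL|/FA_supp ->] := boolP (j \in L); last by rewrite mul0r.
have gE : g j x = gL j x by rewrite /gL jL.
rewrite /FA -mulrA gE FgL mulr_ge0 ?indicE ?ler0n// mulr_ge0 ?powR_ge0//.
by rewrite mulr_ge0 ?powR_ge0.
Qed.

Let esum_FAg x : (\esum_(j in setT) (FA j x * g j x)%:E = (hA x)%:E)%E.
Proof.
transitivity (\esum_(j in setT) ((\1_A x)%:E * (F j x * gL j x)%:E))%E.
  apply: eq_esum => j _; rewrite -EFinM mulrA -/(FA j x); congr _%:E.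
  by rewrite /gL; case: ifPn => // /FA_supp ->; rewrite !mul0r.
rewrite esumZ ?esum_FgL ?EFinM//.
move=> j; rewrite FgL lee_fin mulr_ge0 ?powR_ge0//.
by rewrite mulr_ge0 ?powR_ge0.
Qed.

Let pairing_FA x : pairing g FA x = hA x.
Proof. by rewrite /pairing usum_ge0// esum_FAg. Qed.

Let ihA : mu.-integrable setT (EFin \o hA).
Proof.
have [_] := dominated_defined dominated_FA.
by rewrite (_ : pairing g FA = hA)//; apply/funext => x; rewrite pairing_FA.
Qed.

Let a kt := fine (\int[mu]_(x in cube Q kt) (hA x)%:E)%E.

Let aE kt : (\int[mu]_(x in cube Q kt) (hA x)%:E = (a kt)%:E)%E.
Proof.
rewrite fineK//; apply: integrable_fin_num; first exact: cube_measurable S kt.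
by apply: (integrableS measurableT) => //; exact: cube_measurable S kt.
Qed.

Let a0 kt : 0 <= a kt.
Proof. by rewrite -lee_fin -aE; apply: integral_ge0 => x _;
  rewrite lee_fin. Qed.

Let G kt := a kt `^ p^-1.
Let G0 kt : 0 <= G kt. Proof. exact: powR_ge0. Qed.
Let GpE kt : G kt `^ p = a kt.
Proof. by rewrite /G -powRrM mulVf ?gt_eqF// powRr1. Qed.

(** The constant that turns [FA] into a block on the cube. There [|FA|_q' ^ p' v] has integral
    [G kt ^ p], so the norm of [FA] is [G kt ^ (p - 1)], and this factor rescales it to [c kt]. The
    pairing of the block with [g] becomes [coef kt * G kt ^ p = c kt * G kt], the entry of the cube.
    If [G kt] is 0, so is [coef kt] by the convention for powers of 0, and the block is 0. *)
Let coef kt := c kt * G kt `^ (1 - p).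
Let coef0 kt : 0 <= coef kt.
Proof. by rewrite mulr_ge0 ?powR_ge0// (ltW (cube_coef_gt0 S kt)). Qed.

Let coef_a kt : coef kt * a kt = c kt * G kt.
Proof.
rewrite /coef -GpE -mulrA; congr (_ * _).
rewrite powR_sub// ?gt_eqF// subrK ?powRr1 ?oner_eq0//.
Qed.

Let b kt j x := coef kt * \1_(cube Q kt) x * FA j x.

Let block_b kt : block mu w p p' t q' (cube Q kt) (b kt).
Proof.
have mQ := cube_measurable S kt.
apply/(block_cubeP q' S p1 pp'); split.
- move=> j; apply: measurable_funM; last exact: mFA.
  by apply: measurable_funM => //; exact: measurable_indic.
- by move=> j x Qx; rewrite /b indicE memNset// mulr0 mul0r.
pose u x := (lseq q' FA x `^ p' * (v x)%:E)%E.
have mv : measurable_fun setT v by exact: measurable_dual_weight S.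
have -> : (\int[mu]_(x in cube Q kt) (lseq q' (b kt) x `^ p' * (v x)%:E) =
    \int[mu]_(x in cube Q kt) ((coef kt `^ p')%:E * u x))%E.
  apply: eq_integral => x; rewrite inE => Qx.
  rewrite (@lseqZ _ _ q' FA (b kt) x (coef kt))//.
    by rewrite poweRM ?lseq_ge0 ?lee_fin// poweR_EFin muleA.
  by move=> j; rewrite /b indicE mem_set// mulr1 normrM (ger0_norm (coef0 kt)).
have mu_ : measurable_fun (cube Q kt) u.
  apply: emeasurable_funM; first exact: measurable_lseq_poweR.
  by apply/measurable_EFinP; exact: measurable_funTS.
rewrite ge0_integralZl//; last 2 first.
- by move=> x _; rewrite mule_ge0 ?poweR_ge0// lee_fin powR_ge0.
- by rewrite lee_fin powR_ge0.
have -> : (\int[mu]_(x in cube Q kt) u x = \int[mu]_(x in cube Q kt) (hA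
  x)%:E)%E.
  apply: ae_eq_integral => //; first exact/measurable_EFinP/measurable_funTS.
  move: (cube_weight_gt0 S); apply: filterS => x w0 _.
  rewrite /u (@lseqZ _ _ q' F FA x (\1_A x))//.
  - rewrite poweRM ?lseq_ge0 ?lee_fin ?indicE ?ler0n// -muleA block_density//.
    rewrite poweR_EFin -EFinM /hA indicE; congr (_ * _)%:E.
    by case: (x \in A); rewrite ?powR1 ?powR0// gt_eqF.
  - by move=> j; rewrite /FA normrM ger0_norm// indicE ler0n.
rewrite aE -EFinM lee_fin /coef powRM ?powR_ge0 ?(ltW (cube_coef_gt0 S kt))//.
rewrite -mulrA ler_piMr ?powR_ge0// -powRrM.
have -> : (1 - p) * p' = - p.
  by rewrite -(opprB p 1) mulNr conjugate_subr1.
have [az|an] := eqVneq (G kt) 0.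
  by rewrite az powR0 ?mul0r// oppr_eq0 gt_eqF.
rewrite -GpE powRN mulVf//.
by rewrite gt_eqF// powR_gt0// lt_neqAle eq_sym an G0.
Qed.

Lemma level_estimate : (lnorm r (fun kt => (c kt)%:E *
  (\int[mu]_(x in cube Q kt) (hA x)%:E) `^ p^-1) <= D%:E)%E.
Proof.
rewrite (_ : (fun kt => _) = EFin \o (fun kt => c kt * G kt)); last first.
  by apply/funext => kt; rewrite aE poweR_EFin -EFinM.
apply: lnorm_converse => //.
  by move=> kt; rewrite mulr_ge0// (ltW (cube_coef_gt0 S kt)).
move=> l lam ul lam0 laml lam1.
(* All the blocks are multiples of the same [FA], so their combination is [FA] times the bounded
   function [psi] and is again [dominated]. *)
pose psi x := \sum_(kt <- l) lam kt * (coef kt * \1_(cube Q kt) x).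
have mQ kt := cube_measurable S kt.
have psi0 x : 0 <= psi x.
  by apply: sumr_ge0 => kt _; apply: mulr_ge0 => //; apply: mulr_ge0.
pose P := \sum_(kt <- l) lam kt * coef kt.
have psiP x : psi x <= P.
  apply: ler_sum => kt _; apply: ler_wpM2l => //.
  by apply: ler_piMr; [exact: coef0|rewrite indicE lern1 leq_b1].
have mpsi : measurable_fun setT psi.
  apply: measurable_sum => kt; apply: measurable_funM => //.
  by apply: measurable_funM => //; exact: measurable_indic.
pose f j x := psi x * FA j x.
have domf : dominated f.
  split.
  - by move=> j; exact: measurable_funM.
  - exists (P * m%:R) => j x; rewrite normrM (ger0_norm (psi0 x)) -mulrA.
    by apply: ler_pM.
  - by exists L => j x /FA_supp; rewrite /f => ->; rewrite mulr0.
have decf : dec f lam.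
  split; first exact: le_lt_trans lam1 (ltry _).
  exists b; split => //; apply: aeW => x j.
  have supp kt : kt \notin l -> lam kt * b kt j x = 0.
    by move=> /laml ->; rewrite mul0r.
  split; first exact: usummable_finsupp ul supp.
  rewrite (usum_finsupp ul supp) /f /psi mulr_suml; apply: eq_bigr => kt _.
  by rewrite /b !mulrA.
have := dominated_le domf decf lam1.
suff -> : Jfun mu g f = \sum_(kt <- l) lam kt * (c kt * G kt).
  exact: le_trans (ler_norm _).
have pf x : pairing g f x = psi x * hA x.
  rewrite -pairing_FA /pairing -usumZ.
    by congr usum; apply/funext => j; rewrite /f mulrA.
  rewrite usummableP; under eq_esum do rewrite ger0_norm//.
  by rewrite esum_FAg ltry.
rewrite /Jfun /Rintegral.
have -> : (\int[mu]_x (pairing g f x)%:E =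
    \sum_(kt <- l) (lam kt * (c kt * G kt))%:E)%E.
  transitivity (\int[mu]_x \sum_(kt <- l)
      ((lam kt * coef kt)%:E * (\1_(cube Q kt) x * hA x)%:E))%E.
    apply: eq_integral => x _; rewrite pf /psi mulr_suml -sumEFin.
    by apply: eq_bigr => kt _; rewrite -EFinM !mulrA.
  have mi kt : measurable_fun setT (fun x => (\1_(cube Q kt) x * hA x)%:E).
    apply/measurable_EFinP; apply: measurable_funM; last exact: mhA.
    exact: measurable_indic.
  rewrite ge0_integral_sum//; last 2 first.
  - by move=> kt; apply: emeasurable_funM.
  - by move=> kt x _; apply: mule_ge0; rewrite lee_fin; apply: mulr_ge0.
  apply: eq_bigr => kt _; rewrite ge0_integralZl//; last 2 first.
  - by move=> x _; rewrite lee_fin; apply: mulr_ge0.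
  - by rewrite lee_fin; apply: mulr_ge0.
  have -> : (\int[mu]_x (\1_(cube Q kt) x * hA x)%:E = (a kt)%:E)%E.
    rewrite -aE [RHS]integral_mkcond; apply: eq_integral => x _.
    by rewrite patchE indicE; case: ifP => _; rewrite ?mul1r ?mul0r.
  by rewrite -EFinM -mulrA coef_a.
by rewrite sumEFin.
Qed.

End level.

(** Since [L] is finite and [f0] positive, every point lies in some level set; the supremum over the
    levels is thus attained pointwise, with value [h x]. *)
Lemma truncation_estimate : (lnorm r (fun kt => (c kt)%:E *
  (\int[mu]_(x in cube Q kt) (lseq q gL x `^ p * `|w x|%:E)) `^ p^-1) <=
    D%:E)%E.
Proof.
pose A m := [set x | all (fun j => `|F j x| <= m%:R * f0 j x) L].
have Am m n x : (m <= n)%N -> A m x -> A n x.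
  move=> mn /= /allP Ax; apply/allP => j jL; apply: le_trans (Ax j jL) _.
  by apply: ler_wpM2r; [exact: ltW|rewrite ler_nat].
have Aex x : exists m, A m x.
  rewrite /A /=; elim: (L) => [|j l [m IH]]; first by exists 0%N.
  pose k := Num.bound (`|F j x| / f0 j x).
  have kF : `|F j x| <= k%:R * f0 j x.
    rewrite -ler_pdivrMr//; apply/ltW/archi_boundP.
    by rewrite divr_ge0// ltW.
  exists (maxn m k); rewrite /=; apply/andP; split.
    apply: le_trans kF _; apply: ler_wpM2r; first exact: ltW.
    by rewrite ler_nat leq_maxr.
  apply/allP => i il; apply: le_trans (allP IH i il) _.
  by apply: ler_wpM2r; [exact: ltW|rewrite ler_nat leq_maxl].
pose f m x := (\1_(A m) x * h x)%:E.
have f0' m x : (0 <= f m x)%E by rewrite lee_fin mulr_ge0.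
have fh m x : (f m x <= (h x)%:E)%E.
  by rewrite lee_fin ler_piMl// indicE lern1 leq_b1.
have supf x : ereal_sup (range (f ^~ x)) = (lseq q gL x `^ p * `|w x|%:E)%E.
  rewrite lseq_fin poweR_EFin -EFinM -/(h x); apply/eqP; rewrite eq_le.
  apply/andP; split; first by apply: ge_ereal_sup => _ [m _ <-].
  have [m Amx] := Aex x; apply: ereal_sup_ubound; exists m => //.
  by rewrite /f indicE mem_set// mul1r.
under [X in lnorm r X]eq_fun do under eq_integral do rewrite -supf.
apply: lnorm_density_sup => //.
- exact: cube_measurable S.
- exact: cube_coef_gt0 S.
- move=> m; apply/measurable_EFinP; apply: measurable_funM => //.
  by apply: measurable_indic; exact: measurable_level.
- move=> x m n mn; rewrite lee_fin; apply: ler_wpM2r => //.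
  rewrite !indicE; have [Amx|Amx] := pselect (A m x).
    by rewrite !mem_set//; exact: Am Amx.
  by rewrite memNset.
- by move=> m; exact: level_estimate.
Qed.

End truncation.

Lemma morrey_norm_le : (morrey_seq_norm mu Q w p t r q g <= D%:E)%E.
Proof.
pose gn n j x := if j \in int_range n then g j x else 0.
have gn_le n j x : `|gn n j x| <= `|g j x|.
  by rewrite /gn; case: ifP => // _; rewrite normr0.
have gn_mono m n j x : (m <= n)%N -> `|gn m j x| <= `|gn n j x|.
  move=> mn; rewrite /gn; case: ifPn => [jm|_]; last by rewrite normr0.
  by rewrite mem_int_range in jm; rewrite mem_int_range (leq_trans jm mn).
have mgn n j : measurable_fun setT (gn n j) by rewrite /gn; case: (j \in _).
pose f n x := (lseq q (gn n) x `^ p * `|w x|%:E)%E.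
have f0' n x : (0 <= f n x)%E by rewrite mule_ge0 ?poweR_ge0.
have supl x : ereal_sup (range (fun n => lseq q (gn n) x)) = lseq q g x.
  rewrite lseq_poweRV//.
  under eq_fun do rewrite lseq_poweRV//.
  rewrite ereal_sup_poweR ?invr_gt0//; last first.
    by move=> n; apply: esum_ge0 => j _; rewrite lee_fin powR_ge0.
  rewrite -esum_ereal_sup; last 2 first.
  - by move=> j n; rewrite lee_fin powR_ge0.
  - move=> j m n mn; rewrite lee_fin; apply: ge0_ler_powR;
      rewrite ?nnegrE ?(ltW q0)//.
    exact: gn_mono.
  congr (_ `^ _)%E; apply: eq_esum => j _; apply/eqP; rewrite eq_le.
  apply/andP; split.
    apply: ge_ereal_sup => _ [n _ <-]; rewrite lee_fin.
    by apply: ge0_ler_powR; rewrite ?nnegrE ?(ltW q0)//; exact: gn_le.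
  pose n := (match j with Posz k => k | Negz k => k end).+1.
  apply: ereal_sup_ubound; exists n => //.
  by rewrite /gn mem_int_range ltnSn.
have supf x : ereal_sup (range (f ^~ x)) = (lseq q g x `^ p * `|w x|%:E)%E.
  rewrite -supl -ereal_sup_poweR//; last by move=> n; exact: lseq_ge0.
  rewrite muleC -ereal_supZ//; last by move=> n; exact: poweR_ge0.
  have -> : f ^~ x = (fun n => `|w x|%:E * lseq q (gn n) x `^ p)%E.
    by apply/funext => n; rewrite muleC.
  by [].
have -> : morrey_seq_norm mu Q w p t r q g = lnorm r (fun kt => (c kt)%:E *
    (\int[mu]_(x in cube Q kt) ereal_sup (range (f ^~ x))) `^ p^-1)%E.
  rewrite morrey_seq_normE; congr lnorm; apply/funext => kt.
  rewrite (morrey_entryE q S) (weight_abs S)//.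
  - by congr (_ * _ `^ _)%E; apply: eq_integral => x _; rewrite supf.
  - exact: cube_measurable S kt.
  - exact: measurable_lseq_poweR.
  - by move=> x; exact: poweR_ge0.
apply: lnorm_density_sup => //.
- exact: cube_measurable S.
- exact: cube_coef_gt0 S.
- move=> n; apply: emeasurable_funM; first exact: measurable_lseq_poweR.
  apply/measurable_EFinP; apply: measurableT_comp => //.
  exact: cube_weight_measurable S.
- move=> x m n mn; apply: lee_wpmul2r => //; apply: le_poweR.
  + exact: ltW.
  + exact: lseq_ge0.
  + by apply: le_lseq => // j; exact: gn_mono.
- by move=> n; exact: (truncation_estimate (int_range_uniq n)).
Qed.

End norm_estimate.

(** * Duality over an abstract family of cubes *)

Section duality.
Context (R : realType) d (X : measurableType d) (mu : {measure set X -> \bar R})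
  (I : int -> choiceType) (Q : forall k : int, I k -> set X) (w : X -> R)
  (p p' q q' t : R) (r : \bar R) (c : {k : int & I k} -> R).
Hypothesis S : cube_setting mu Q w p t c.
Hypotheses (p1 : 1 < p) (pp' : p^-1 + p'^-1 = 1).
Hypotheses (q1 : 1 < q) (qq' : q^-1 + q'^-1 = 1) (r1 : (1 < r)%E).
Let K : choiceType := {k : int & I k}.

Local Notation dec :=
  (block_decomposition mu Q w p p' t (hoelder_conjugate r) q').
Local Notation lam_norm l := (lnorm (hoelder_conjugate r) (EFin \o l)).
Local Notation H := (block_space mu Q w p p' t (hoelder_conjugate r) q'
  : set (int -> X -> R^o)).
Local Notation N := (block_norm mu Q w p p' t (hoelder_conjugate r) q').
Local Notation M := (morrey_seq mu Q w p t r q).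
Local Notation normM := (morrey_seq_norm mu Q w p t r q).

Lemma morrey_seq_norm_ge0 g : (0 <= normM g)%E.
Proof.
(* For [r = +oo] a cube must exist: the supremum over no cubes would be [-oo]. *)
have [kt _] := cubes_nonempty S; rewrite morrey_seq_normE.
case: r r1 => [r0 _|_|//]; first exact: poweR_ge0.
apply: le_trans (morrey_entry_ge0 mu Q w p q t g kt) _.
by apply: ereal_sup_ubound; exists kt => //=;
  rewrite gee0_abs// morrey_entry_ge0.
Qed.

Lemma block_norm_ge0 f : (0 <= N f)%E.
Proof. by apply: le_ereal_inf_tmp => _ [l _ <-]; exact: lam_norm_ge0. Qed.

Section morrey_functional.
Variable g : int -> X -> R.
Hypothesis Mg : M g.

Let mg : forall j, measurable_fun setT (g j). Proof. by case: Mg. Qed.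

Lemma Jfun_dec f l : (forall j, measurable_fun setT (f j)) -> dec f l ->
  Jfun_defined mu g f /\ (`|Jfun mu g f|%:E <= lam_norm l * normM g)%E.
Proof.
move=> mf df; have le := pairing_le S p1 pp' q1 qq' r1 df mf mg.
have [Jdef Jle] : Jfun_defined mu g f /\ (`|Jfun mu g f|%:E <=
    \int[mu]_x (\esum_(j in setT) `|f j x * g j x|%:E))%E.
  apply: Jfun_defined_esum => //; apply: le_lt_trans le _.
  have [_ Mfin] := Mg; have [lfin _] := df.
  have l0 := lam_norm_ge0 r1 l.
  have -> : lam_norm l = (fine (lam_norm l))%:E by rewrite fineK// ge0_fin_numE.
  by apply: lte_mul_pinfty => //; rewrite lee_fin fine_ge0.
by split => //; exact: le_trans Jle le.
Qed.

Lemma Jfun_le_norm f : H f -> (`|Jfun mu g f|%:E <= normM g * N f)%E.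
Proof.
move=> [mf [l0 df0]]; have [_ Mfin] := Mg.
have M0 := morrey_seq_norm_ge0 g.
have ME : normM g = (fine (normM g))%:E by rewrite fineK// ge0_fin_numE.
have Nfin : N f \is a fin_num.
  rewrite ge0_fin_numE ?block_norm_ge0//.
  by apply: le_lt_trans (block_norm_le df0) _; case: df0.
set m := fine (normM g) in ME; have m0 : 0 <= m by rewrite -lee_fin -ME.
apply/lee_addgt0Pr => e e0.
(* The summand 1 allows for [m = 0]. *)
have e1 : 0 < e / (m + 1) by rewrite divr_gt0// ltr_wpDl.
have [_ [l dl <-] ll] := lb_ereal_inf_adherent e1 Nfin.
have [_ h] := Jfun_dec mf dl; apply: le_trans h _.
rewrite ME -(fineK Nfin);
  apply: (@le_trans _ _ ((fine (N f) + e / (m + 1))%:E * m%:E)%E).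
  apply: lee_wpmul2r; first by rewrite lee_fin.
  by apply: ltW; rewrite EFinD fineK.
rewrite -EFinM -EFinM -EFinD lee_fin mulrDl mulrC lerD2l.
rewrite mulrAC ler_pdivrMr; last by rewrite ltr_wpDl.
by rewrite ler_wpM2l ?lerDl// ltW.
Qed.

Lemma Jfun_linear_on : linear_on H (Jfun mu g).
Proof.
move=> a f h [mf [lf df]] [mh [lh dh]].
have [Jf _] := Jfun_dec mf df; have [Jh _] := Jfun_dec mh dh.
by have [_] := Jfun_linear a mf mh mg Jf Jh.
Qed.

Lemma Jfun_bounded_on : bounded_on H N (Jfun mu g).
Proof.
have [_ Mfin] := Mg; have M0 := morrey_seq_norm_ge0 g.
exists (fine (normM g)) => f Hf; rewrite fineK ?ge0_fin_numE//.
exact: Jfun_le_norm.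
Qed.

Lemma Jfun_mul_cvg0 f (s : nat -> int -> X -> R) : H f ->
  (forall n j, measurable_fun setT (s n j)) ->
  (forall n j x, `|s n j x| <= 1) ->
  {ae mu, forall x, forall j, forall e : R, 0 < e ->
     \forall n \near \oo, `|s n j x| < e} ->
  forall e : R, 0 < e ->
    \forall n \near \oo, `|Jfun mu g (fun j x => s n j x * f j x)| < e.
Proof.
move=> [mf [l df]] ms s1 s0 e e0; have [_ Mfin] := Mg.
have M0 := morrey_seq_norm_ge0 g.
have ME : normM g = (fine (normM g))%:E by rewrite fineK// ge0_fin_numE.
set m := fine (normM g) in ME; have m0 : 0 <= m by rewrite -lee_fin -ME.
have m1 : 0 < m + 1 by rewrite ltr_wpDl.
have e1 : 0 < e / (m + 1) by rewrite divr_gt0.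
have := dec_cvg0 S p1 pp' q1 qq' r1 df ms s1 s0 e1.
apply: filterS => n [l' [dl' l'e]].
have msf j : measurable_fun setT (fun x => s n j x * f j x).
  exact: measurable_funM.
have [_ h] := Jfun_dec msf dl'; rewrite -lte_fin; apply: le_lt_trans h _.
rewrite ME; apply: (@le_lt_trans _ _ (lam_norm l' * (m + 1)%:E)%E).
  by apply: lee_wpmul2l; [exact: lam_norm_ge0|rewrite lee_fin lerDl].
by rewrite -lte_pdivlMr// -EFinM.
Qed.

End morrey_functional.

Theorem block_morrey_duality :
  (forall g, M g ->
    [/\ forall f, H f -> Jfun_defined mu g f,
        linear_on H (Jfun mu g)
      & bounded_on H N (Jfun mu g)])
  /\
  (forall J : (int -> X -> R^o) -> R, dual H N J ->
    exists g, [/\ M g,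
      forall f, H f -> J f = Jfun mu g f,
      forall g', M g' -> (forall f, H f -> J f = Jfun mu g' f) ->
        {ae mu, forall x, forall j, g' j x = g j x}
    & normM g = dual_norm H N J]).
Proof.
split=> [g Mg|J [linJ contJ]].
  split; [|exact: Jfun_linear_on|exact: Jfun_bounded_on].
  by move=> f [mf [l df]]; have [] := Jfun_dec Mg mf df.
have [f0 [l0 [mf0 f0_gt0 df0]]] := exists_positive_member S p1 pp' q1 qq' r1.
have Hf0 : H f0 by split => //; exists l0.
have /choice[g gP] := fun j =>
  coordinate_density S p1 pp' q1 qq' r1 linJ contJ j f0_gt0 Hf0.
have mg j : measurable_fun setT (g j) by case: (gP j).
have ig j : mu.-integrable setT (fun x => (g j x * f0 j x)%:E) by case: (gP j).
have rep := finite_representation S p1 pp' q1 qq' r1 linJ contJ f0_gt0 Hf0 mg ig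
  (fun j => let: And3 _ _ h := gP j in h).
(* The infimum in the block norm need not be attained, so [N f <= 1] is used to produce a
   decomposition of norm below 2. That is enough for the dual norm of [J] to be finite. *)
have two0 : 0 < 2 :> R by [].
have [C C0 JC] := continuous_on_bounded S p1 pp' q1 qq' r1 linJ contJ two0.
have DC : (dual_norm H N J <= C%:E)%E.
  apply: ge_ereal_sup => _ [f [[mf _] /= Nf] <-]; rewrite lee_fin.
  have [_ [l dl <-] l2] : exists2 y,
    [set lam_norm l | l in dec f] y & (y < 2%:E)%E.
    by apply: ereal_inf_lt; apply: le_lt_trans Nf _; rewrite lte_fin ltr1n.
  exact: JC dl l2.
have D0 : (0 <= dual_norm H N J)%E.
  (* The zero sequence lies in the unit ball: it is [f0] times the multiplier 0, whose modulus is at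
     most [e], so the coefficients [e * l0], of norm at most 1, decompose it. *)
  pose e := (fine (lam_norm l0) + 1)^-1.
  have l00 : 0 <= fine (lam_norm l0) by rewrite fine_ge0// lam_norm_ge0.
  have e0 : 0 < e by rewrite invr_gt0 ltr_wpDl.
  have := dec_mul S p1 pp' q1 qq' r1 e0 (s := fun _ _ => 0)
    (fun _ => measurable_cst _) _ df0.
  rewrite (_ : (fun j x => 0 * f0 j x) = (fun _ _ => 0)); last first.
    by apply/funext => j; apply/funext => x; rewrite mul0r.
  move=> /(_ _)/wrap[|d0]; first by move=> j x; rewrite normr0 ltW.
  apply: ereal_sup_ubound; exists (fun _ _ => 0).
    split; first exact: block_space0 S p1 pp' q1 qq' r1.
    apply: le_trans (block_norm_le d0) _; rewrite lam_normZ//; last exact: ltW.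
    rewrite -(@fineK _ (lam_norm l0)); last first.
      by rewrite ge0_fin_numE ?lam_norm_ge0//; case: df0.
    by rewrite -EFinM lee_fin mulrC ler_pdivrMr ?ltr_wpDl// mul1r lerDl.
  by rewrite (linear_on0 S p1 pp' q1 qq' r1 linJ) normr0.
have DE : dual_norm H N J = (fine (dual_norm H N J))%:E.
  by rewrite fineK// ge0_fin_numE//; exact: le_lt_trans DC (ltry _).
have gD : (normM g <= dual_norm H N J)%E.
  rewrite DE; apply: (morrey_norm_le S p1 pp' q1 qq' r1 mg mf0 f0_gt0).
  - exact: fine_ge0.
  - by move=> f [mf [m fm] [l fl]]; have [] := rep l m f mf fm fl.
  - move=> f l [mf [m fm] [L fl]] df l1.
    have [Hf _ <-] := rep L m f mf fm fl.
    rewrite -lee_fin -DE; apply: ereal_sup_ubound; exists f => //; split => //.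
    exact: le_trans (block_norm_le df) l1.
have Mg : M g.
  by split => //; apply: le_lt_trans gD _; rewrite DE ltry.
have JE f : H f -> J f = Jfun mu g f.
  move=> Hf; have [mf [l df]] := Hf.
  (* On these sets [f] is cut to finitely many coordinates and to [|f| <= n f0], the range of
     [finite_representation]. Every [x] and [j] is eventually inside, because [f0] is positive. *)
  pose B n j := [set x | (j \in int_range n) && (`|f j x| <= n%:R * f0 j x)].
  have mB n j : measurable (B n j).
    rewrite /B; case: (j \in int_range n) => /=; last first.
      by rewrite (_ : mkset _ = set0)//; apply/seteqP; split.
    pose G x := n%:R * f0 j x - `|f j x|.
    have mG : measurable_fun setT G.
      apply: measurable_funB; first exact: measurable_funM.
      exact: measurableT_comp.
    rewrite (_ : mkset _ = setT `&` G @^-1` `[0, +oo[%classic).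
      by apply: mG => //; exact: measurable_itv.
    by apply/seteqP; split => x /=; rewrite in_itv/= andbT /G subr_ge0; tauto.
  pose s n j x : R := 1 - \1_(B n j) x.
  have mI n j : measurable_fun setT (\1_(B n j) : X -> R).
    exact: measurable_indic.
  have ms n j : measurable_fun setT (s n j) by exact: measurable_funB.
  have I1 n j x : `|\1_(B n j) x| <= 1 :> R.
    by rewrite indicE ger0_norm ?ler0n// lern1 leq_b1.
  have s1 n j x : `|s n j x| <= 1.
    rewrite /s indicE; case: (x \in _); first by rewrite subrr normr0.
    by rewrite subr0 normr1.
  have s0 : {ae mu, forall x, forall j, forall e : R, 0 < e ->
      \forall n \near \oo, `|s n j x| < e}.
    apply: aeW => x j e e0.
    pose n1 := (match j with Posz k => k | Negz k => k end).+1.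
    pose n2 := Num.bound (`|f j x| / f0 j x).
    exists (maxn n1 n2) => // n /=; rewrite geq_max => /andP[n1n n2n].
    rewrite /s indicE mem_set ?subrr ?normr0//.
    rewrite /B /= mem_int_range; apply/andP; split.
      by apply: leq_trans n1n; rewrite ltnSn.
    rewrite -ler_pdivrMr//; apply: (@le_trans _ _ n2%:R);
      last by rewrite ler_nat.
    by apply/ltW/archi_boundP; rewrite divr_ge0// ltW.
  (* Both functionals agree on the truncated part [f2], so their difference at [f] is their
     difference at the remainder [s n * f], where each of them tends to 0. *)
  have E n : J f - Jfun mu g f = J (fun j x => s n j x * f j x) -
      Jfun mu g (fun j x => s n j x * f j x).
    pose f1 j x := s n j x * f j x; pose f2 j x := \1_(B n j) x * f j x.
    have Hf1 : H f1 := dec_measurable_mul S p1 pp' q1 qq' r1 ltr01 (ms n) (s1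
      n) mf df.
    have Hf2 : H f2 := dec_measurable_mul S p1 pp' q1 qq' r1 ltr01 (mI n) (I1
      n) mf df.
    have fE : f = (fun j x => 1 * f1 j x + f2 j x).
      by apply/funext => j; apply/funext => x; rewrite /f1 /f2 /s; ring.
    have [mf2 _] := Hf2.
    have [_ _ Jf2] : [/\ H f2, Jfun_defined mu g f2 & J f2 = Jfun mu g f2].
      apply: (rep (int_range n) n%:R) => // j x.
        rewrite /f2 indicE; have [xB|xB] := boolP (x \in B n j).
          by rewrite mul1r; move: xB; rewrite inE => /andP[].
        by rewrite mul0r normr0 mulr_ge0// ltW.
      move=> /negPf jn; rewrite /f2 indicE memNset ?mul0r// /B /= jn.
      by [].
    have -> : J f = 1 * J f1 + J f2 by rewrite {1}fE; exact: linJ.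
    have -> : Jfun mu g f = 1 * Jfun mu g f1 + Jfun mu g f2.
      by rewrite {1}fE; exact: (Jfun_linear_on Mg).
    by rewrite Jf2 -/f1; ring.
  apply/eqP; rewrite -subr_eq0 -normr_eq0 eq_le normr_ge0 andbT.
  apply/ler_addgt0Pr => e e0; rewrite add0r.
  have e20 : 0 < e / 2 by rewrite divr_gt0.
  have h1 := continuous_on_mul_cvg0 S p1 pp' q1 qq' r1 linJ contJ Hf ms s1 s0
    e20.
  have h2 := Jfun_mul_cvg0 Mg Hf ms s1 s0 e20.
  have [n _ /(_ n (leqnn n)) [h1n h2n]] := filterI h1 h2.
  rewrite (E n); apply: le_trans (ler_normB _ _) _.
  by rewrite (splitr e) lerD// ltW.
exists g; split => //.
- move=> g' Mg' Jg'; apply: ae_forall_countable; first exact: countable_int.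
  move=> j.
  (* Testing on [1_A f0 e_j] gives [g'_j f0_j] and [g_j f0_j] the same integral over every
     measurable [A]; they agree almost everywhere, and the positive factor [f0_j] cancels. *)
  pose sel A i x : R := (i == j)%:R * \1_A x * f0 i x.
  have Hsel A : measurable A -> H (sel A).
    move=> mA; apply: (block_space_coordinate S p1 pp' q1 qq' r1 j Hf0).
    split; first exact: measurable_indic.
    by exists 1 => x; rewrite indicE ger0_norm// lern1 leq_b1.
  have pE A x : pairing g' (sel A) x = \1_A x * (g' j x * f0 j x).
    rewrite /pairing (@usum_finsupp _ _ [:: j])//.
      by rewrite big_seq1 /sel eqxx mul1r -mulrA (mulrC (f0 j x)).
    by move=> i; rewrite inE => /negPf ij; rewrite /sel ij !mul0r.
  have [mg' _] := Mg'.
  have idef A : measurable A -> Jfun_defined mu g' (sel A).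
    by move=> /Hsel[msel [l dl]]; have [] := Jfun_dec Mg' msel dl.
  have ig' : mu.-integrable setT (fun x => (g' j x * f0 j x)%:E).
    have [_] := idef setT measurableT.
    rewrite (_ : EFin \o _ = (fun x => (g' j x * f0 j x)%:E))//.
    by apply/funext => x /=; rewrite pE indicE in_setT mul1r.
  have [_ _ gj] := gP j.
  have : ae_eq mu setT (fun x => (g' j x * f0 j x)%:E) (fun x => (g j x * f0 j
    x)%:E).
    apply: integral_ae_eq => //; first by case/integrableP : (ig j).
    move=> A _ mA; rewrite -gj// Jg'; last exact: Hsel.
    rewrite /Jfun /Rintegral fineK; last first.
      by apply: integrable_fin_num => //; case: (idef A mA).
    rewrite [LHS]integral_mkcond; apply: eq_integral => x _.
    by rewrite pE patchE indicE; case: ifP => _; rewrite ?mul1r ?mul0r.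
  apply: filterS => x /(_ Logic.I) [/mulIf]; apply; by rewrite gt_eqF.
- apply/eqP; rewrite eq_le gD/=; apply: ge_ereal_sup => _ [f [Hf /= Nf] <-].
  rewrite JE//; apply: le_trans (Jfun_le_norm Mg Hf) _.
  rewrite -[leRHS]mule1; apply: lee_wpmul2l => //.
  exact: morrey_seq_norm_ge0.
Qed.

End duality.

(** * Dyadic cubes *)

Section countable_disjoint_family.
Local Open Scope ereal_scope.
Context (R : realType).

Lemma summable_countable (T : choiceType) (a : T -> \bar R) :
  (forall i, 0 <= a i) -> \esum_(i in setT) a i < +oo ->
  countable [set i | 0 < a i].
Proof.
move=> a0 afin.
have sfin : \esum_(i in setT) a i \is a fin_num.
  by rewrite ge0_fin_numE//; exact: esum_ge0.
have -> : [set i | 0 < a i] = \bigcup_(m in [set: nat]) [set i |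
  (m.+1%:R^-1)%:E <= a i].
  apply/seteqP; split => [i /= ai|i [m _ /= h]]; last first.
    by apply: lt_le_trans h; rewrite lte_fin invr_gt0.
  have [aiy|aiy] := eqVneq (a i) +oo; first by exists 0%N; rewrite //= aiy leey.
  have aiE : a i = (fine (a i))%:E by rewrite fineK// ge0_fin_numE// ltey.
  have fi0 : (0 < fine (a i))%R by rewrite -lte_fin -aiE.
  have [m _ /(_ m (leqnn m)) /= h] := near_infty_natSinv_lt (PosNum fi0).
  by exists m => //=; rewrite aiE lee_fin ltW.
apply: bigcup_countable => // m _; apply: finite_set_countable.
apply: contrapT => inf.
pose s := fine (\esum_(i in setT) a i).
(* More than [s * (m + 1)] indices with [a i] at least [1 / (m + 1)] would already sum to more than
   [s]. *)
have [B Bsub Bn] := infinite_set_fset (Num.bound (s * m.+1%:R)).+1 inf.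
have s0 : (0 <= s)%R by rewrite fine_ge0//; exact: esum_ge0.
have := sum_le_esum (finmap.fset_uniq B) a0; rewrite leNgt => /negP; apply.
rewrite -(fineK sfin) -/s.
apply: (@lt_le_trans _ _ (\sum_(i <- finmap.enum_fset B) (m.+1%:R^-1)%:E));
  last first.
  rewrite big_seq [leRHS]big_seq; apply: lee_sum => i iB; exact: Bsub.
rewrite sumEFin lte_fin big_const_seq count_predT iter_addr addr0.
rewrite -[X in (_ < X)%R]mulr_natl ltr_pdivlMr//.
apply: (@lt_le_trans _ _ (Num.bound (s * m.+1%:R))%:R).
  by apply: archi_boundP; rewrite mulr_ge0.
by rewrite ler_nat; exact: ltnW.
Qed.

(** Each [E i] meets some [B n] in positive measure. For a fixed [n] the traces are disjoint in a
    set of finite measure, so only countably many of them have positive measure. *)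
Lemma countable_disjoint d (X : measurableType d)
    (mu : {measure set X -> \bar R}) (T : choiceType) (E : T -> set X)
    (B : nat -> set X) :
  (forall i, measurable (E i)) -> trivIset setT E ->
  (forall i, 0 < mu (E i)) -> (forall n, measurable (B n)) ->
  (forall n, mu (B n) < +oo) -> \bigcup_n B n = setT ->
  countable [set: T].
Proof.
move=> mE tE E0 mB Bfin BT.
have mEB i n : measurable (E i `&` B n) by exact: measurableI.
have -> : [set: T] = \bigcup_(n in [set: nat]) [set i | 0 < mu (E i `&` B n)].
  apply/seteqP; split => // i _; apply: contrapT => h.
  have z n : mu (E i `&` B n) = 0.
    apply/eqP; rewrite eq_le measure_ge0 andbT leNgt; apply/negP => p.
    by apply: h; exists n.
  have := E0 i; rewrite -[E i]setIT -BT setI_bigcupr => /lt_geF/negP; apply.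
  apply: le_trans (measure_sigma_subadditive _ _ _ _) _; last first.
  - by rewrite eseries0// => n _ _; exact: z.
  - by [].
  - exact: bigcup_measurable.
  - exact: mEB.
apply: bigcup_countable => // n _; apply: summable_countable => //.
apply: le_lt_trans (Bfin n); apply: esum_leP => l ul.
rewrite fsbig_seq//= -measure_fin_bigcup//.
- by apply: le_measure; rewrite ?inE//;
    [exact: fin_bigcup_measurable|move=> x [i _ []]].
- apply: sub_trivIset (@subsetT _ _) _.
  by apply/trivIsetP => i j _ _ ij; rewrite setIACA (trivIsetP.1 tE)// set0I.
Qed.

End countable_disjoint_family.

Section dyadic_cubes.
Context (R : realType) d (X : measurableType d) (rho : X -> X -> R)
  (mu : {measure set X -> \bar R}) (I : int -> choiceType)
  (Q : forall k : int, I k -> set X) (kappa0 : R).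
Hypothesis hX : homogeneous_type rho mu.
Hypothesis muT : mu setT = +oo%E.
Hypothesis dQ : dyadic_system rho mu Q kappa0.

Let K : choiceType := {k : int & I k}.

Lemma dyadic_measurable k (tau : I k) : measurable (Q tau).
Proof. by apply: (homogeneous_open hX) => x; exact: (dyadic_open dQ). Qed.

Lemma dyadic_cover_measurable k : measurable (\bigcup_(tau : I k) Q tau).
Proof.
apply: (homogeneous_open hX) => x [tau _ Qx].
have [r r0 rQ] := dyadic_open dQ Qx.
by exists r => // y ry; exists tau => //; exact: rQ.
Qed.

Lemma dyadic_point k (tau : I k) : exists2 x, Q tau x &
  exists2 r : R, 0 < r & qball rho x r `<=` Q tau.
Proof.
have [x xQ] := dyadic_ball dQ tau.
have r0 : 0 < 2^-1 * (2^-1) ^ k :> R by rewrite mulr_gt0// exprz_gt0.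
exists x; last by exists (2^-1 * (2^-1) ^ k).
by apply: xQ; rewrite /qball /= (quasidistance_eq0 (homogeneous_rho hX) x x).2.
Qed.

Lemma dyadic_measure_gt0 k (tau : I k) : (0 < mu (Q tau))%E.
Proof.
have [x Qx [r r0 rQ]] := dyadic_point tau.
apply: lt_le_trans (homogeneous_pos hX x r0) _; apply: le_measure => //;
  rewrite inE.
  exact: homogeneous_ball hX x r.
exact: dyadic_measurable.
Qed.

Lemma dyadic_sub_ball k (tau : I k) : exists x, exists2 r : R, 0 < r &
  Q tau `<=` qball rho x r.
Proof.
have [x Qx _] := dyadic_point tau.
have k0 : 0 < kappa0 * (2^-1) ^ k.
  by rewrite mulr_gt0 ?exprz_gt0// (dyadic_kappa0 dQ).
exists x, (kappa0 * (2^-1) ^ k + 1); first by rewrite addr_gt0.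
move=> y Qy; rewrite /qball /=;
  apply: (@le_lt_trans _ _ (kappa0 * (2^-1) ^ k)); last by rewrite ltrDl.
rewrite -lee_fin; apply: le_trans (dyadic_diam dQ tau).
by apply: ereal_sup_ubound; exists x => //; exists y.
Qed.

Lemma dyadic_measure_fin k (tau : I k) : (mu (Q tau) < +oo)%E.
Proof.
have [x [r r0 Qr]] := dyadic_sub_ball tau.
apply: le_lt_trans (homogeneous_fin hX x r0); apply: le_measure => //;
  rewrite inE.
  exact: dyadic_measurable.
exact: homogeneous_ball hX x r.
Qed.

(** Otherwise nestedness would make the cube disjoint from all cubes of the next generation, hence
    null, although it contains a ball. *)
Lemma dyadic_child k (tau : I k) : exists sigma : I (k + 1),
  Q sigma `<=` Q tau.
Proof.
apply: contrapT => h.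
have : Q tau `<=` ~` \bigcup_(sigma : I (k + 1)) Q sigma.
  move=> x Qx [sigma _ Qsx]; apply: h; exists sigma.
  have kk : (k <= k + 1)%R by rewrite lerDl.
  case: (dyadic_nested dQ sigma tau kk) => // e.
  have : (Q sigma `&` Q tau) x by [].
  by rewrite e.
move=> sub; have := dyadic_measure_gt0 tau.
rewrite (_ : mu (Q tau) = 0%E) ?ltxx//.
apply/eqP; rewrite eq_le measure_ge0 andbT -(dyadic_cover dQ (k + 1)).
apply: le_measure => //; rewrite inE; first exact: dyadic_measurable.
exact: measurableC (dyadic_cover_measurable _).
Qed.

Lemma dyadic_inj k (tau tau' : I k) : Q tau `<=` Q tau' -> tau = tau'.
Proof.
move=> sub; have [sigma ssub] := dyadic_child tau.
have kk : (k < k + 1)%R by rewrite ltrDl.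
have [tau0 [_ u]] := dyadic_ancestor dQ sigma kk.
by rewrite -(u tau ssub) -(u tau' (subset_trans ssub sub)).
Qed.

Lemma dyadic_trivIset k : trivIset setT (@Q k).
Proof.
apply/trivIsetP => tau tau' _ _ tt'.
have [sub|//] := dyadic_nested dQ tau tau' (lexx k).
by move/eqP : tt'; rewrite (dyadic_inj sub).
Qed.

Lemma homogeneous_point : exists x : X, True.
Proof.
apply: contrapT => h; have e : [set: X] = set0.
  by apply/seteqP; split => // x _; apply: h; exists x.
by move: muT; rewrite e measure0.
Qed.

Lemma dyadic_countable : countable [set: K].
Proof.
have [x0 _] := homogeneous_point.
have Ik k : countable [set: I k].
  apply: (@countable_disjoint _ _ _ mu _ (@Q k) (fun n => qball rho x0
    n.+1%:R)).
  - exact: dyadic_measurable.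
  - exact: dyadic_trivIset.
  - exact: dyadic_measure_gt0.
  - by move=> n; exact: homogeneous_ball hX _ _.
  - by move=> n; apply: homogeneous_fin hX _ _ _.
  apply/seteqP; split => // y _.
  exists (Num.bound (rho x0 y)) => //; rewrite /qball /=.
  apply: (@lt_le_trans _ _ (Num.bound (rho x0 y))%:R); last by rewrite ler_nat.
  by apply: archi_boundP; exact: quasidistance_ge0 (homogeneous_rho hX) _ _.
have -> : [set: K] = \bigcup_(k in [set: int]) [set existT I k tau | tau in
  [set: I k]].
  by apply/seteqP; split => // -[k tau] _; exists k => //; exists tau.
apply: bigcup_countable => [|k _]; first exact: countableP.
exact: sub_countable (card_image_le _ _) (Ik k).
Qed.

(** The weight of a cube is finite because the cube lies in a ball, on which [w] is integrable. It
    is positive because [w] is positive almost everywhere and the cube has positive measure. The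
    power with exponent [1/t - 1/p] inherits both properties. *)
Lemma dyadic_setting (p t : R) (w : X -> R) : weight rho mu w ->
  exists c, cube_setting mu Q w p t c.
Proof.
move=> [mw iw w0].
have mK (kt : K) : measurable (cube Q kt) by exact: dyadic_measurable.
have mw' (kt : K) : measurable_fun (cube Q kt) (EFin \o w).
  by apply/measurable_EFinP; exact: measurable_funTS.
have wabs (kt : K) : (wmeasure mu w (cube Q kt) =
    \int[mu]_(x in cube Q kt) `|(w x)%:E|)%E.
  apply: ae_eq_integral => //; first exact: measurableT_comp.
  by move: w0; apply: filterS => x wx _; rewrite gee0_abs// lee_fin ltW.
have wfin (kt : K) : (wmeasure mu w (cube Q kt) < +oo)%E.
  have [x [r r0 Qr]] := dyadic_sub_ball (tagged kt).
  rewrite wabs; have : mu.-integrable (cube Q kt) (EFin \o w).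
    apply: integrableS (iw x r r0) => //; exact: homogeneous_ball hX _ _.
  by case/integrableP.
have wge0 (kt : K) : (0 <= wmeasure mu w (cube Q kt))%E.
  by rewrite wabs; exact: integral_ge0.
have wgt0 (kt : K) : (0 < wmeasure mu w (cube Q kt))%E.
  rewrite lt0e wge0 andbT; apply/eqP; rewrite wabs.
  move=> /(ae_eq_integral_abs _ (mK kt) (mw' kt)).1 wz.
  have [N [mN N0 sub]] : {ae mu, forall x, ~ cube Q kt x}.
    move: wz w0; apply: filterS2 => x wz wx Qx.
    by have := wz Qx; rewrite /= => -[] e; rewrite e ltxx in wx.
  have := dyadic_measure_gt0 (tagged kt); apply/negP; rewrite -leNgt -N0.
  apply: le_measure; rewrite ?inE//; first exact: mK kt.
  by move=> x Qx; apply: sub => /= h; exact: h.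
exists (fun kt => fine (wmeasure mu w (cube Q kt) `^ (t^-1 - p^-1))%E).
have cfin kt : (wmeasure mu w (cube Q kt) `^ (t^-1 - p^-1) \is a fin_num)%E.
  by apply: fin_num_poweR; rewrite ge0_fin_numE.
have cov : {ae mu, forall x, exists kt, cube Q kt x}.
  exists (~` \bigcup_(tau : I 0) Q tau); split.
  - exact: measurableC (dyadic_cover_measurable 0).
  - exact: dyadic_cover dQ 0.
  move=> x /= h [tau _ Qx]; apply: h; by exists (existT I 0 tau).
split => //.
- apply: contrapT => h; have [N [mN N0 sub]] := cov.
  have NT : N = setT.
    apply/seteqP; split => // x _; apply: sub => /= -[kt _]; apply: h.
    by exists kt.
  by move: N0; rewrite NT muT.
- exact: dyadic_countable.
- by move=> kt; exact: dyadic_measure_fin.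
- move=> kt; apply: fine_gt0; apply/andP; split; first exact: poweR_gt0.
  by rewrite -ge0_fin_numE ?poweR_ge0.
- by move=> kt; rewrite fineK.
Qed.

End dyadic_cubes.

Theorem theorem3p6 (R : realType) (d : measure_display) (X : measurableType d)
    (rho : X -> X -> R) (mu : {measure set X -> \bar R}) (n : R)
    (I : int -> choiceType) (Q : forall k : int, I k -> set X)
    (kappa0 alpha0 : R) (w : X -> R) (p p' q q' t : R) (r : \bar R) :
  homogeneous_type rho mu -> mu setT = +oo%E ->
  doubling_exponent rho mu n ->
  dyadic_system rho mu Q kappa0 ->
  reverse_doubling mu Q alpha0 ->
  1 < q -> q^-1 + q'^-1 = 1 ->
  1 < p -> p^-1 + p'^-1 = 1 ->
  Ap rho mu p w ->
  (let m := Order.min r ((ln (beta_weight rho mu alpha0 p w)^-1 / ln 2)%:E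
                           * r * n^-1%:E)%E in
   [/\ p < t, (t%:E < m)%E & (m < +oo)%E])
  \/ [/\ p <= t, (t%:E < r)%E & r = +oo%E] ->
  let r' := hoelder_conjugate r in
  let M := morrey_seq mu Q w p t r q in
  let H : set (int -> X -> R^o) := block_space mu Q w p p' t r' q' in
  let normM := morrey_seq_norm mu Q w p t r q in
  let normH := block_norm mu Q w p p' t r' q' in
  (forall g, M g ->
    [/\ forall f, H f -> Jfun_defined mu g f,
        linear_on H (Jfun mu g)
      & bounded_on H normH (Jfun mu g)])
  /\
  (forall J : (int -> X -> R^o) -> R, dual H normH J ->
    exists g, [/\ M g,
      forall f, H f -> J f = Jfun mu g f,
      forall g', M g' -> (forall f, H f -> J f = Jfun mu g' f) ->
        {ae mu, forall x, forall j, g' j x = g j x}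
    & normM g = dual_norm H normH J]).

Proof.
move=> hX muT _ dQ _ q1 qq' p1 pp' [hw _] hr.
(* Both ranges of exponents give [1 < p <= t < r]. *)
have r1 : (1 < r)%E.
  have [pt tr] : p <= t /\ (t%:E < r)%E.
    case: hr => [[pt]|[pt tr _]//]; rewrite lt_min => /andP[tr _] _.
    by split => //; exact: ltW.
  by apply: lt_trans tr; rewrite lte_fin; exact: lt_le_trans pt.
have [c S] := dyadic_setting hX muT dQ p t hw.
exact: (block_morrey_duality S p1 pp' q1 qq' r1).
Qed.
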